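(* Let $\kappa>0$, let $k\in\mathbb{R}^3$ with $|k|=\kappa$, and let $\psi_0(x)=e^{ikx}$. Let $\mathcal{U}\subset\mathbb{R}^3$ be the exterior region of a closed bounded regular surface $S$. Let $x_0\in\mathbb{R}^3$ and $\theta\in\mathbb{S}^2$ be such that $\theta\neq k/|k|$ and the ray $$L=L_{x_0,\theta}=\{x\in\mathbb{R}^3:\ x=x_0+s\theta,\ 0<s<+\infty\}$$ is contained in $\mathcal{U}$. Let $\Lambda$ be an arbitrary non-empty open interval of $L$. Then, for fixed $k$, the restriction to $L$ of a radiation solution $\psi_1$ of the Helmholtz equation $-\Delta\psi=\kappa^2\psi$ in $\mathcal{U}$ is uniquely determined by the intensity $|\psi_0+\psi_1|^2$ on $\Lambda$. That is, if $\psi_1$ and $\tilde\psi_1$ are two complex-valued radiation solutions in $\mathcal{U}$ with $$|\psi_0(x)+\psi_1(x)|^2=|\psi_0(x)+\tilde\psi_1(x)|^2\quad\text{for all }x\in\Lambda,$$ then $\psi_1(x)=\tilde\psi_1(x)$ for all $x\in L$.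
   Context: The region $\mathcal{U}$ is an open connected set in $\mathbb{R}^3$ consisting of all points outside a closed bounded regular surface $S$ (so $\mathcal{U}$ is the unbounded exterior of $S$, and $\mathbb{R}^3\setminus\mathcal{U}$ is bounded). The Helmholtz equation is $-\Delta\psi(x)=\kappa^2\psi(x)$, $x\in\mathcal{U}$, where $\Delta$ is the Laplacian in $x$ and $\kappa>0$. A radiation solution is a complex-valued solution $\psi_1$ of this equation on $\mathcal{U}$ that is of class $C^2$ and satisfies the Sommerfeld radiation condition $$|x|\left(\frac{\partial}{\partial|x|}-i\kappa\right)\psi_1(x)\to 0\quad\text{as }|x|\to+\infty,$$ uniformly in $x/|x|$. The function $\psi_0(x)=e^{ikx}$, where $kx$ denotes the Euclidean scalar product of $k$ and $x$, is the plane wave solution. $\mathbb{S}^2$ is the unit sphere in $\mathbb{R}^3$. An open interval of $L$ is a set $\{x_0+s\theta:\ s\in I\}$ with $I\subset(0,+\infty)$ an open interval. *)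

(* Defs.v *)
From mathcomp Require Import all_boot all_order all_algebra.
From mathcomp Require Import all_classical all_reals all_analysis.
From mathcomp Require Export complex.

Set Implicit Arguments.
Unset Strict Implicit.
Unset Printing Implicit Defensive.

Import Order.TTheory GRing.Theory Num.Theory.
Import numFieldNormedType.Exports.

Local Open Scope classical_set_scope.
Local Open Scope ring_scope.
Local Open Scope complex_scope.

(* The library norm `|x| of 'rV[R]_n is the sup norm; it defines the same
   topology and the same bounded sets as the Euclidean norm [enorm]. *)
Definition dotv (R : realType) (n : nat) (x y : 'rV[R]_n) : R :=
  \sum_(i < n) x 0 i * y 0 i.

Definition enorm (R : realType) (n : nat) (x : 'rV[R]_n) : R :=
  Num.sqrt (dotv x x).

(* f is of class C^m on U. Functions are total, but for U open only the values
   of f on U matter. *)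
Fixpoint class_C (R : realType) (n : nat) (W : normedModType R) (m : nat)
    (U : set 'rV[R]_n) (f : 'rV[R]_n -> W) : Prop :=
  (forall x, U x -> {for x, continuous f}) /\
  (if m is m'.+1 then
     forall i : 'I_n, (forall x, U x -> derivable f x (delta_mx 0 i)) /\
                      class_C m' U ('D_(delta_mx 0 i) f)
   else True).

(* A regular surface in the sense of differential geometry, of class C^1: each
   point has a neighbourhood V in which S is the image of an immersion X,
   defined on an open subset W of the plane, that is a homeomorphism onto
   its image. Such a surface has no boundary. *)
Definition regular_surface (R : realType) (S : set 'rV[R]_3) : Prop :=
  forall p, S p ->
  exists (V : set 'rV[R]_3) (W : set 'rV[R]_2)
         (X : 'rV[R]_2 -> 'rV[R]_3) (Y : 'rV[R]_3 -> 'rV[R]_2),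
    [/\ open V /\ V p, open W, X @` W = V `&` S,
        (forall q, W q -> Y (X q) = q) /\ {within V `&` S, continuous Y}
      & class_C 1 W X /\ (forall q, W q -> injective ('d X q))].

(* Since S is bounded, the complement of S has exactly one connected component
   with bounded complement; for compact S, openness and connectedness of U are
   consequences of the last two clauses. *)
Definition exterior_region (R : realType) (S U : set 'rV[R]_3) : Prop :=
  [/\ open U, connected U, bounded_set (~` U)
    & exists x, U = connected_component (~` S) x].

(* Directional derivative of a complex-valued function of real variables, taken
   on the real and imaginary parts (R[i] is not a normed R-module here). *)
Definition cderive (R : realType) (n : nat) (v : 'rV[R]_n)
    (f : 'rV[R]_n -> R[i]) (x : 'rV[R]_n) : R[i] :=
  'D_v (fun y => complex.Re (f y)) x +i* 'D_v (fun y => complex.Im (f y)) x.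

Definition cclass_C (R : realType) (n m : nat) (U : set 'rV[R]_n)
    (f : 'rV[R]_n -> R[i]) : Prop :=
  class_C m U (fun y => complex.Re (f y) : R) /\
  class_C m U (fun y => complex.Im (f y) : R).

Definition laplacian (R : realType) (n : nat) (f : 'rV[R]_n -> R[i])
    (x : 'rV[R]_n) : R[i] :=
  \sum_(i < n) cderive (delta_mx 0 i) (cderive (delta_mx 0 i) f) x.

Definition helmholtz (R : realType) (kappa : R) (U : set 'rV[R]_3)
    (psi : 'rV[R]_3 -> R[i]) : Prop :=
  forall x, U x -> - laplacian psi x = (kappa ^+ 2)%:C * psi x.

(* The derivative in |x| at x is the directional derivative along x / |x|;
   uniformity in x / |x| means that rho depends on eps only. *)
Definition sommerfeld (R : realType) (kappa : R) (U : set 'rV[R]_3)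
    (psi : 'rV[R]_3 -> R[i]) : Prop :=
  forall eps : R, 0 < eps -> exists rho : R,
    forall x, U x -> rho < enorm x ->
      `|(enorm x)%:C * (cderive ((enorm x)^-1 *: x) psi x
                        - (0 +i* kappa) * psi x)| < eps%:C.

Definition radiation_solution (R : realType) (kappa : R) (U : set 'rV[R]_3)
    (psi : 'rV[R]_3 -> R[i]) : Prop :=
  [/\ cclass_C 2 U psi, helmholtz kappa U psi & sommerfeld kappa U psi].

Definition plane_wave (R : realType) (k x : 'rV[R]_3) : R[i] :=
  cos (dotv k x) +i* sin (dotv k x).

Definition ray (R : realType) (x0 theta : 'rV[R]_3) : set 'rV[R]_3 :=
  [set x0 + s *: theta | s in [set s : R | 0 < s]].

Definition open_interval_of_ray (R : realType) (x0 theta : 'rV[R]_3)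
    (Lambda : set 'rV[R]_3) : Prop :=
  exists I : set R,
    [/\ open I, is_interval I, I `<=` [set s : R | 0 < s]
      & Lambda = [set x0 + s *: theta | s in I]].

(* Main.v *)
Require Import Defs.
From mathcomp Require Import all_boot all_order all_algebra.
From mathcomp Require Import all_classical all_reals all_analysis.
From mathcomp Require Import complex zify ring lra.

(* Fix a centre c and a unit vector e.  The spherical mean A_l(r) over the sphere of
   radius r about c of a solution of the Helmholtz equation against the Legendre polynomial
   P_l of the angle with e solves the radial equation
   r^2 A'' + 2 r A' + (kappa^2 r^2 - l (l + 1)) A = 0, and the Legendre expansion at the
   pole recovers the value at c + r e from the A_l(r).  Inside U, A_l is a multiple of the
   regular solution r^l (1 + ...), which makes a solution real analytic along lines.  Outside
   a ball, the radiation condition forces r A_l(r) to be a multiple of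
   e^(i kappa r) p_l(1 / r) with p_l a polynomial; the bound
   |p_l(t)| >= |leading coefficient of p_l| t^l makes the Legendre series converge, so that
   r e^(- i kappa r) psi(c + r e) is a power series in 1 / r (Atkinson-Wilcox).
   Both expansions have constants uniform in e, hence psi and its gradient are O(1 / |x|)
   and the radiation condition does not depend on the centre, which can be taken to be x0.

   Let W = psi1 - psi1' on the ray.  The difference of the two intensities,
   2 Re (conj psi0 W) + |psi1|^2 - |psi1'|^2, is analytic along L, so it vanishes on the part
   of L beyond Lambda.  With H = s e^(- i kappa s) W this says
   |Re (e^(i (kappa - k theta) s + i const) H)| <= K |H| / s, where kappa - k theta > 0 as
   theta <> k / |k|.  If H, a power series in 1 / s, had a nonzero leading term, then
   choosing the phase would contradict this for large s.  Hence W vanishes far away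
   and, by analyticity, on all of L. *)

Set Implicit Arguments.
Unset Strict Implicit.
Unset Printing Implicit Defensive.

Import Order.TTheory GRing.Theory Num.Theory.
Import numFieldNormedType.Exports.
Local Open Scope classical_set_scope.
Local Open Scope ring_scope.

(** * Integrals of continuous functions over a segment *)

(** Averaging against P_l about the axis e leaves one scalar radial function per degree, and every
    P_l equals 1 at the pole, so no addition theorem enters. Convergence always comes from
    comparison with a geometric series: dividing by the Legendre norms costs a multiple of 2^l,
    which the radial functions recover at a smaller radius, or a larger one outside. The obstacle
    outside a ball is to bound both constants of each mode by the size of the solution on a single
    sphere of radius r0. This takes a lower bound of |p_l(1/r0)| and control of all coefficients of
    p_l by the leading one: coefficient l - j is at most kappa^j / j! times the leading one, and the
    factorial absorbs the powers of r0 into a constant depending on kappa r0 only. Complex functions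
    are handled as pairs of real ones, the outgoing solution as two real solutions with constant
    Wronskian. Power series are expansions on ]0, d] with an error bound for every truncation, since
    the variable 1/r is positive; continuation therefore moves only in the direction of the line,
    and the way back to x0 uses the reversed line. *)

Definition Int (R : realType) (a b : R) (f : R -> R) : R :=
  \int[lebesgue_measure]_(x in `[a, b]) f x.

Lemma continuous_integrable (R : realType) (a b : R) (f : R -> R) :
  continuous f -> (@lebesgue_measure R).-integrable `[a, b] (EFin \o f).
Proof.
move=> cf; apply: continuous_compact_integrable; first exact: segment_compact.
exact: continuous_subspaceT.
Qed.

Lemma continuous_pair (T U V : topologicalType) (f : T -> U) (g : T -> V) (x : T) :
  {for x, continuous f} -> {for x, continuous g} ->
  {for x, continuous (fun t => (f t, g t))}.
Proof. by move=> cf cg; exact: (cvg_pair cf cg). Qed.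

Lemma eq_Int (R : realType) (a b : R) (f g : R -> R) :
  (forall x, a <= x <= b -> f x = g x) -> Int a b f = Int a b g.
Proof.
move=> fg; apply: eq_Rintegral => x; rewrite inE/= in_itv/=; exact: fg.
Qed.

Lemma IntD (R : realType) (a b : R) (f g : R -> R) :
  continuous f -> continuous g ->
  Int a b (fun x => f x + g x) = Int a b f + Int a b g.
Proof. by move=> cf cg; apply: RintegralD => //; exact: continuous_integrable. Qed.

Lemma IntZ (R : realType) (a b k : R) (f : R -> R) :
  continuous f -> Int a b (fun x => k * f x) = k * Int a b f.
Proof. by move=> cf; apply: RintegralZl => //; exact: continuous_integrable. Qed.

Lemma IntB (R : realType) (a b : R) (f g : R -> R) :
  continuous f -> continuous g ->
  Int a b (fun x => f x - g x) = Int a b f - Int a b g.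
Proof. by move=> cf cg; apply: RintegralB => //; exact: continuous_integrable. Qed.

Lemma le_Int (R : realType) (a b : R) (f g : R -> R) :
  continuous f -> continuous g -> (forall x, a <= x <= b -> f x <= g x) ->
  Int a b f <= Int a b g.
Proof.
move=> cf cg fg; apply: le_Rintegral => //; try exact: continuous_integrable.
Qed.

Lemma Int_ge0 (R : realType) (a b : R) (f : R -> R) :
  (forall x, a <= x <= b -> 0 <= f x) -> 0 <= Int a b f.
Proof.
by move=> f0; apply: Rintegral_ge0 => x; rewrite /= in_itv/=; exact: f0.
Qed.

Lemma Int_le_norm (R : realType) (a b : R) (f g : R -> R) :
  continuous f -> continuous g -> (forall x, a <= x <= b -> `|f x| <= g x) ->
  `|Int a b f| <= Int a b g.
Proof.
move=> cf cg fg; apply: le_trans.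
  apply: le_normr_Rintegral => //; exact: continuous_integrable.
apply: le_Int => // x; exact: (continuous_comp (cf x) (@norm_continuous _ _ _)).
Qed.

Lemma FTC2 (R : realType) (a b : R) (F f : R -> R) : a <= b -> continuous f ->
  (forall x : R, is_derive x 1 F (f x)) -> Int a b f = F b - F a.
Proof.
rewrite le_eqVlt => /predU1P[-> cf dF|ab cf dF].
  by rewrite /Int set_itv1 Rintegral_set1 subrr.
have cF : continuous F.
  by move=> x; apply/differentiable_continuous/derivable1_diffP.
rewrite /Int /Rintegral (@continuous_FTC2 _ f F)//.
- exact: continuous_subspaceT.
- split=> [x _||]; [by case: (dF x)|apply: cvg_at_right_filter; exact: cF|apply: cvg_at_left_filter; exact: cF].
- by move=> x _; rewrite derive1E derive_val.
Qed.

Lemma Int_cst (R : realType) (a b k : R) :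
  a <= b -> Int a b (fun=> k) = k * (b - a).
Proof.
move=> ab; have dk (x : R) : is_derive x 1 (fun x => k * x) k.
  rewrite -[X in is_derive _ _ _ X]mulr1.
  exact: (@is_deriveZ _ _ _ id k x 1 1).
by rewrite (FTC2 ab _ dk) ?mulrBr// => x; exact: cvg_cst.
Qed.

Lemma Int_le_cst (R : realType) (a b : R) (f : R -> R) k : a <= b ->
  continuous f -> (forall x, a <= x <= b -> `|f x| <= k) ->
  `|Int a b f| <= k * (b - a).
Proof.
move=> ab cf fk; rewrite -Int_cst//; apply: Int_le_norm => // x; exact: cvg_cst.
Qed.

Lemma is_derive_Int_upper (R : realType) (a x : R) (f : R -> R) : a < x -> continuous f ->
  is_derive x 1 (fun x => Int a x f) (f x).
Proof.
move=> ax cf.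
have [||d e] := @continuous_FTC1_closed R f a x (x + 1) _ _ ax (cf x).
- by rewrite ltrDl.
- exact: continuous_integrable.
by apply: DeriveDef; [exact: d|rewrite -derive1E; exact: e].
Qed.

(** The base point [m] lies strictly to the left of [a] so that the primitive [Int m x f] has a
    two-sided derivative at the endpoint [a] too. *)
Lemma Int_split (R : realType) (m a b : R) (f : R -> R) : m < a -> a <= b ->
  continuous f -> Int a b f = Int m b f - Int m a f.
Proof.
move=> ma; rewrite le_eqVlt => /predU1P[-> cf|ab cf].
  by rewrite subrr /Int set_itv1 Rintegral_set1.
have dF x : a <= x <= b -> is_derive x 1 (fun x => Int m x f) (f x).
  by move=> /andP[ax _]; apply: is_derive_Int_upper => //; apply: lt_le_trans ax.
have cF x : a <= x <= b -> {for x, continuous (fun x => Int m x f)}.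
  by move=> /dF ?; apply/differentiable_continuous/derivable1_diffP.
rewrite {1}/Int /Rintegral (@continuous_FTC2 _ f (fun x => Int m x f))//.
- exact: continuous_subspaceT.
- split=> [x /[!in_itv]/= /andP[x1 x2]||].
  + by have := dF x; rewrite !ltW// => /(_ isT) [].
  + by apply: cvg_at_right_filter; apply: cF; rewrite lexx ltW.
  + by apply: cvg_at_left_filter; apply: cF; rewrite lexx ltW.
- move=> x /[!in_itv]/= /andP[x1 x2]; rewrite derive1E.
  by have := dF x; rewrite !ltW// => /(_ isT) [].
Qed.

(** Joint continuity along [t0] and compactness of the segment give one neighbourhood of [t0] on
    which [F t] is uniformly close to [F t0]. *)
Lemma continuous_Int (R : realType) (T : topologicalType) (F : T -> R -> R) (a b : R) (t0 : T) :
  (\forall t \near t0, continuous (F t)) ->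
  (forall x, {for (t0, x), continuous (fun p => F p.1 p.2)}) ->
  {for t0, continuous (fun t => Int a b (F t))}.
Proof.
move=> cF cj.
have [ab|ba] := leP a b; last first.
  rewrite /Int set_itv_ge -?leNgt ?bnd_simp ?leNgt ?ba//.
  rewrite (_ : (fun t => _) = cst 0); first exact: cvg_cst.
  by apply/funext => t; rewrite Rintegral_set0.
apply/cvgrPdist_le => /= e e0.
(* The [+ 1] keeps the denominator positive when [a = b]. *)
pose d := e / (b - a + 1).
have d0 : 0 < d by rewrite divr_gt0//; lra.
have : \forall t \near t0, `[a, b] `<=` (fun x => `|F t0 x - F t x| <= d).
  apply: (iffLR (compact_near_coveringP _) (@segment_compact R a b)) => x _.
  have d20 : 0 < d / 2 by rewrite divr_gt0.
  have /cvgrPdist_le/(_ _ d20) [/= -[A B]/= [nA nB] AB] := cj x.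
  exists (B, A) => //= -[y t]/= [By At].
  have /= h1 := AB (t, y) (conj At By).
  have /= h2 := AB (t0, y) (conj (nbhs_singleton nA) By).
  apply: le_trans (ler_distD (F t0 x) _ _) _; rewrite (distrC (F t0 y)).
  by rewrite (splitr d) lerD.
apply: filterS2 cF => t ct h.
have ct0 : continuous (F t0).
  move=> x; apply: (@continuous_comp _ _ _ (fun x => (t0, x)) (fun p => F p.1 p.2)) => //.
  by apply: continuous_pair; do ?[exact: cvg_cst|exact: cvg_id].
rewrite -IntB//; apply: (@le_trans _ _ (d * (b - a))).
  apply: Int_le_cst => //; first by move=> x; apply: cvgB; [exact: ct0|exact: ct].
by rewrite /d mulrAC ler_pdivrMr; last lra; rewrite ler_pM2l//; lra.
Qed.

(** For each [y] the mean value theorem turns the difference quotient into a value of [f] at an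
    intermediate point, and compactness of the segment makes these values uniformly close to
    [f x0 y]. *)
Lemma is_derive_Int (R : realType) (F f : R -> R -> R) (a b x0 : R) (J : set R) :
  open J -> J x0 ->
  (forall x, J x -> continuous (F x)) ->
  (forall x y, J x -> is_derive x 1 (F^~ y) (f x y)) ->
  (forall x y, J x -> {for (x, y), continuous (fun p => f p.1 p.2)}) ->
  is_derive x0 1 (fun x => Int a b (F x)) (Int a b (f x0)).
Proof.
move=> oJ Jx0 cF dF cf.
have cfx x : J x -> continuous (f x).
  move=> Jx y; apply: (@continuous_comp _ _ _ (fun y => (x, y)) (fun p => f p.1 p.2)) => //; last exact: cf.
  by apply: continuous_pair; do ?[exact: cvg_cst|exact: cvg_id].
have [ab|ba] := leP a b; last first.
  rewrite /Int set_itv_ge -?leNgt ?bnd_simp ?leNgt ?ba//.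
  rewrite (_ : (fun t => _) = cst 0); first by rewrite Rintegral_set0; exact: is_derive_cst.
  by apply/funext => t; rewrite Rintegral_set0.
suff h : (fun h => h^-1 *: (Int a b (F (h *: 1 + x0)) - Int a b (F x0))) @ 0^' --> Int a b (f x0).
  apply: DeriveDef; last by apply/cvg_lim.
  by apply/cvg_ex; eexists; exact: h.
apply/cvgrPdist_le => /= e e0.
pose d := e / (b - a + 1).
have d0 : 0 < d by rewrite divr_gt0//; lra.
have : \forall t \near x0, `[a, b] `<=` (fun x => `|f x0 x - f t x| <= d).
  apply: (iffLR (compact_near_coveringP _) (@segment_compact R a b) _ (nbhs x0) (fun t x => `|f x0 x - f t x| <= d) _) => x _.
  have d20 : 0 < d / 2 by rewrite divr_gt0.
  have /cvgrPdist_le/(_ _ d20) [/= -[A B]/= [nA nB] AB] := cf x0 x Jx0.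
  exists (B, A) => //= -[y t]/= [By At].
  have /= h1 := AB (t, y) (conj At By).
  have /= h2 := AB (x0, y) (conj (nbhs_singleton nA) By).
  apply: le_trans (ler_distD (f x0 x) _ _) _; rewrite (distrC (f x0 y)).
  by rewrite (splitr d) lerD.
have nJ : nbhs x0 J by exact: open_nbhs_nbhs.
move=> hd; have /nbhs_ballP[/= eta eta0 hb] :
  nbhs x0 ((fun t => `[a, b] `<=` (fun x => `|f x0 x - f t x| <= d)) `&` J).
  exact: filterI.
have hJ t : `|t - x0| < eta -> J t by move=> tx; apply: (hb t _).2; rewrite /ball/= distrC.
have hD t y : `|t - x0| < eta -> a <= y <= b -> `|f x0 y - f t y| <= d.
  by move=> tx aby; apply: (hb t _).1; [rewrite /ball/= distrC|rewrite /= in_itv].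
apply/nbhs_ballP; exists eta => //= h; rewrite /ball/= sub0r normrN => hh hn0.
have hE : h *: (1 : R) + x0 = x0 + h by rewrite -[h *: _]/(h * 1) mulr1 addrC.
rewrite hE -[_ *: _]/(h^-1 * (Int a b (F (x0 + h)) - Int a b (F x0))).
have hx0 : `|x0 - x0| < eta by rewrite subrr normr0.
have hhx : `|x0 + h - x0| < eta by rewrite addrAC subrr add0r.
have Jh : J (x0 + h) by apply: hJ.
have cFh := cF _ Jh; have cF0 := cF _ Jx0.
rewrite -IntB// -IntZ; last by move=> x; apply: cvgB; [exact: cFh|exact: cF0].
have chq : continuous (fun x => h^-1 * (F (x0 + h) x - F x0 x)).
  move=> x; apply: cvgM; first exact: cvg_cst.
  by apply: cvgB; [exact: cFh|exact: cF0].
rewrite -IntB//; last exact: cfx.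
apply: (@le_trans _ _ (d * (b - a))); last first.
  by rewrite /d mulrAC ler_pdivrMr; last lra; rewrite ler_pM2l//; lra.
apply: Int_le_cst => //; first by move=> x; apply: cvgB; [exact: (cfx _ Jx0)|exact: chq].
move=> y aby.
have mvt (p q : R) : p < q -> `|p - x0| < eta -> `|q - x0| < eta ->
    exists2 c, `|c - x0| < eta & F q y - F p y = f c y * (q - p).
  move=> pq hp hq.
  have dd z : p <= z <= q -> is_derive z 1 (F^~ y) (f z y).
    by move=> pzq; apply: dF; apply: hJ; move: hp hq; rewrite !ltr_norml; lra.
  have [||c] := @MVT R (F^~ y) (f^~ y) p q pq.
  - by move=> z; rewrite in_itv/= => /andP[? ?]; apply: dd; rewrite !ltW.
  - apply: derivable_within_continuous => z; rewrite in_itv/= => /dd; by case.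
  rewrite in_itv/= => cpq ->; exists c => //.
  by move: hp hq; rewrite !ltr_norml; lra.
have [h0|h0] := ltP 0 h.
  have [|c hc ->] := mvt x0 (x0 + h) _ hx0 hhx; first by rewrite ltrDl.
  by rewrite mulrC (addrC x0) addrK mulfK//; exact: hD.
have h00 : h < 0 by rewrite lt_neqAle hn0.
have [|c hc e1] := mvt (x0 + h) x0 _ hhx hx0; first by rewrite gtrDl.
have -> : F (x0 + h) y - F x0 y = - (F x0 y - F (x0 + h) y) by rewrite opprB.
rewrite e1.
have -> : h^-1 * - (f c y * (x0 - (x0 + h))) = f c y by field.
exact: hD.
Qed.

(** Fubini by differentiation: the inner integral taken up to a variable bound [x], then integrated
    over [[c, d]], is a primitive of [Int c d (f x)], and the left-hand side is its increment from
    [a] to [b]. *)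
Lemma Int_swap (R : realType) (f : R -> R -> R) (a b c d : R) :
  a <= b ->
  continuous (fun p : R * R => f p.1 p.2) ->
  Int a b (fun x => Int c d (f x)) = Int c d (fun y => Int a b (f^~ y)).
Proof.
move=> ab cf.
have c1 y : continuous (f^~ y).
  move=> x; apply: (@continuous_comp _ _ _ (fun x => (x, y)) (fun p => f p.1 p.2)) => //; last exact: cf.
  by apply: continuous_pair; do ?[exact: cvg_cst|exact: cvg_id].
have c2 x : continuous (f x).
  move=> y; apply: (@continuous_comp _ _ _ (fun y => (x, y)) (fun p => f p.1 p.2)) => //; last exact: cf.
  by apply: continuous_pair; do ?[exact: cvg_cst|exact: cvg_id].
pose m := a - 1.
have cm x : continuous (fun y => Int m x (f^~ y)).
  move=> y; apply: (@continuous_Int R R (fun y x => f x y)); first by near=> t; exact: c1.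
  move=> z; apply: (@continuous_comp _ _ _ (fun p : R * R => (p.2, p.1)) (fun p => f p.1 p.2)) => //=; last exact: cf.
  by apply: continuous_pair; [exact: cvg_snd|exact: cvg_fst].
have dI x : m < x -> is_derive x 1 (fun x => Int c d (fun y => Int m x (f^~ y))) (Int c d (f x)).
  move=> mx; apply: (@is_derive_Int R (fun x y => Int m x (f^~ y)) f c d x [set t | m < t]) => //.
  - by move=> t y mt; exact: is_derive_Int_upper.
  - by move=> t y _; exact: cf.
pose P x := Int c d (fun y => Int m x (f^~ y)).
have cI : continuous (fun x => Int c d (f x)).
  move=> x; apply: continuous_Int; first by near=> t; exact: c2.
  by move=> y; exact: cf.
have -> : Int a b (fun x => Int c d (f x)) = P b - P a.
  case: (ltgtP a b) ab => // [ab _|-> _]; last first.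
    by rewrite /Int set_itv1 Rintegral_set1 subrr.
  have dP x : a <= x -> is_derive x 1 P (Int c d (f x)).
    by move=> ax; apply: dI; rewrite /m; lra.
  have cP x : a <= x -> {for x, continuous P}.
    by move=> /dP ?; apply/differentiable_continuous/derivable1_diffP.
  rewrite {1}/Int /Rintegral (@continuous_FTC2 _ (fun x => Int c d (f x)) P)//.
  - exact: continuous_subspaceT.
  - split=> [x /[!in_itv]/= /andP[x1 x2]||].
    + by have := dP x; rewrite !ltW// => /(_ isT) [].
    + by apply: cvg_at_right_filter; apply: cP.
    + by apply: cvg_at_left_filter; apply: cP; rewrite ltW.
  - move=> x /[!in_itv]/= /andP[x1 x2]; rewrite derive1E.
    by have := dP x; rewrite !ltW// => /(_ isT) [].
rewrite /P -IntB//; apply: eq_Int => y _.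
rewrite (@Int_split R m a b)//; rewrite /m; lra.
Unshelve. all: by end_near. Qed.

(** * Pointwise differential calculus and geometric estimates *)

Section Pointwise.
Variable R : realType.
Implicit Types (f g : R -> R) (x k : R).

Lemma derD f g x (df dg : R) : is_derive x 1 f df -> is_derive x 1 g dg ->
  is_derive x 1 (fun t => f t + g t) (df + dg).
Proof. by move=> hf hg; exact: is_deriveD. Qed.

Lemma derB f g x (df dg : R) : is_derive x 1 f df -> is_derive x 1 g dg ->
  is_derive x 1 (fun t => f t - g t) (df - dg).
Proof. by move=> hf hg; exact: is_deriveB. Qed.

Lemma derN f x (df : R) : is_derive x 1 f df ->
  is_derive x 1 (fun t => - f t) (- df).
Proof. by move=> hf; exact: is_deriveN. Qed.

Lemma derM f g x (df dg : R) : is_derive x 1 f df -> is_derive x 1 g dg ->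
  is_derive x 1 (fun t => f t * g t) (df * g x + f x * dg).
Proof.
move=> hf hg; apply: (is_derive_eq (is_deriveM hf hg)).
by rewrite /GRing.scale/= addrC; congr (_ + _); rewrite mulrC.
Qed.

Lemma derZ k f x (df : R) : is_derive x 1 f df ->
  is_derive x 1 (fun t => k * f t) (k * df).
Proof. by move=> hf; exact: is_deriveZ. Qed.

Lemma der_cst k x : is_derive x 1 (fun=> k) (0 : R).
Proof. exact: is_derive_cst. Qed.

Lemma der_comp f g x (df dg : R) : is_derive (g x) 1 f df -> is_derive x 1 g dg ->
  is_derive x 1 (fun t => f (g t)) (df * dg).
Proof. by move=> hf hg; exact: is_derive1_comp. Qed.

Lemma derV f x (df : R) : f x != 0 -> is_derive x 1 f df ->
  is_derive x 1 (fun t => (f t)^-1) (- (f x) ^- 2 * df).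
Proof.
move=> fx0 hf; apply: DeriveDef; first by apply: derivableV => //; case: hf.
by rewrite deriveV//; first rewrite derive_val.
Qed.

Lemma derX f n x (df : R) : is_derive x 1 f df ->
  is_derive x 1 (fun t => f t ^+ n) (n%:R * f x ^+ n.-1 * df).
Proof.
move=> hf; elim: n => [|n IH].
  by under eq_fun do rewrite expr0; rewrite !mul0r; exact: der_cst.
under eq_fun do rewrite exprS.
apply: (is_derive_eq (derM hf IH)).
move: IH => _; case: n => [|n]; first by rewrite /= expr0; ring.
by rewrite /= !exprS -natr1; ring.
Qed.

Lemma der_continuous f x (df : R) : is_derive x 1 f df -> {for x, continuous f}.
Proof. by move=> ?; apply/differentiable_continuous/derivable1_diffP. Qed.

Lemma der_ext f g x (df : R) : (\forall y \near x, f y = g y) -> is_derive x 1 f df ->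
  is_derive x 1 g df.
Proof. by move=> fg; apply: near_eq_is_derive => //; rewrite oner_neq0. Qed.

Lemma der_MVT f f' a b : a < b -> (forall x, a <= x <= b -> is_derive x 1 f (f' x)) ->
  exists2 c, a < c < b & f b - f a = f' c * (b - a).
Proof.
move=> ab df; have [||c] := @MVT R f f' a b ab.
- by move=> x /[!in_itv]/= /andP[? ?]; apply: df; rewrite !ltW.
- apply: derivable_within_continuous => x; rewrite in_itv/= => /df; by case.
by rewrite in_itv/= => cab ->; exists c.
Qed.

Lemma der0_cst f a b : (forall x, a < x < b -> is_derive x 1 f 0) ->
  forall x y, a < x < b -> a < y < b -> f x = f y.
Proof.
move=> df x y; wlog xy : x y / x < y.
  move=> W hx hy; case: (ltgtP x y) => [xy|yx|->//]; first exact: W.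
  by apply/esym/W.
move=> /andP[ax xb] /andP[ay yb].
have [|c _] := @der_MVT f (fun=> 0) x y xy.
  by move=> z /andP[? ?]; apply: df; rewrite (lt_le_trans ax)//= (le_lt_trans _ yb).
by rewrite mul0r => /eqP; rewrite subr_eq0 => /eqP.
Qed.

Lemma bernoulli (q : R) n : 0 <= q -> 1 + n%:R * (q - 1) <= q ^+ n.
Proof.
move=> q0; elim: n => [|n IH]; first by rewrite mul0r addr0 expr0.
rewrite exprS; have [h|h] := leP 0 (1 + n%:R * (q - 1)).
  apply: le_trans (ler_wpM2l q0 IH).
  rewrite -natr1 -subr_ge0 (_ : _ - _ = n%:R * (q - 1) ^+ 2); last ring.
  by rewrite mulr_ge0// sqr_ge0.
have [q1|q1] := leP 1 q.
  by move: h; rewrite ltNge => /negP[]; rewrite addr_ge0// mulr_ge0// subr_ge0.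
have : 1 + n.+1%:R * (q - 1) <= 0 by rewrite -natr1; lra.
by move/le_trans; apply; rewrite mulr_ge0// exprn_ge0.
Qed.

Lemma expr_unbounded (q C : R) : 1 < q -> exists n, C < q ^+ n.
Proof.
move=> q1; pose n := (Num.Def.truncn (Num.max 0 (C / (q - 1)))).+1.
exists n; apply: lt_le_trans (bernoulli n _); last exact: le_trans (ltW q1).
have : C / (q - 1) < n%:R.
  by apply: le_lt_trans (truncnS_gt _); rewrite le_max lexx orbT.
rewrite ltr_pdivrMr ?subr_gt0// => h; lra.
Qed.

Lemma expr_small (q C e : R) : 0 <= q < 1 -> 0 < e -> exists n0, forall n, (n0 <= n)%N -> C * q ^+ n < e.
Proof.
move=> /andP[q0 q1] e0; have [C0|C0] := leP C 0.
  by exists 0%N => n _; apply: le_lt_trans e0; rewrite mulr_le0_ge0// exprn_ge0.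
move: q0; rewrite le_eqVlt => /predU1P[<-|q0].
  by exists 1%N => -[//|n] _; rewrite expr0n mulr0.
have qV1 : 1 < q^-1 by rewrite invf_gt1.
have [n0 h] := expr_unbounded (C / e) qV1.
exists n0 => n n0n.
have : C / e < q^-1 ^+ n.
  apply: lt_le_trans h _; apply: ler_weXn2l => //; by rewrite invf_ge1// ltW.
by rewrite exprVn ltr_pdivrMr// mulrC ltr_pdivlMr ?exprn_gt0.
Qed.

(** The way limits are taken below: an inequality that holds up to an error [C * q ^+ n] for every
    [n] holds exactly. *)
Lemma le0_of_geometric (x C q : R) : 0 <= q < 1 -> (forall n, x <= C * q ^+ n) -> x <= 0.
Proof.
move=> q01 h; rewrite leNgt; apply/negP => x0.
have [n hn] := expr_small C q01 x0.
by have := le_lt_trans (h n) (hn n (leqnn n)); rewrite ltxx.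
Qed.

Lemma sum_geometric_le (q : R) m n : 0 <= q < 1 ->
  \sum_(m <= i < n) q ^+ i <= q ^+ m / (1 - q).
Proof.
move=> /andP[q0 q1]; have d : 0 < 1 - q by rewrite subr_gt0.
have [mn|nm] := leqP m n; last first.
  by rewrite big_geq ?(ltnW nm)// divr_ge0 ?exprn_ge0// ltW.
rewrite ler_pdivlMr// -(subnK mn).
elim: (n - m)%N => [|k IH]; first by rewrite add0n big_geq// mul0r exprn_ge0.
have -> : \sum_(m <= i < k.+1 + m) q ^+ i = (q ^+ m - q ^+ (k.+1 + m)) / (1 - q).
  elim: k.+1 => [|j IHj]; first by rewrite add0n big_geq// subrr mul0r.
  rewrite addSn big_nat_recr ?leq_addl//= IHj exprS.
  by field; rewrite gt_eqF.
by rewrite divfK ?gt_eqF// gerBl exprn_ge0.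
Qed.

(** The tail bound comes with the sum, so that later arguments handle finite sums and explicit
    errors only. *)
Lemma geometric_series_limit (u : nat -> R) (K q : R) : 0 <= q < 1 ->
  (forall n, `|u n| <= K * q ^+ n) ->
  exists l, forall m, `|l - \sum_(0 <= i < m) u i| <= K * q ^+ m / (1 - q).
Proof.
move=> q01 hu; have /andP[q0 q1] := q01; have d : 0 < 1 - q by rewrite subr_gt0.
have K0 : 0 <= K by have := hu 0%N; rewrite expr0 mulr1; apply: le_trans.
have tail m n : (m <= n)%N ->
    `|\sum_(0 <= i < n) u i - \sum_(0 <= i < m) u i| <= K * q ^+ m / (1 - q).
  move=> mn; rewrite (@big_cat_nat _ _ _ m)//= addrAC subrr add0r.
  apply: le_trans (ler_norm_sum _ _ _) _; apply: (@le_trans _ _ (\sum_(m <= i < n) K * q ^+ i)).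
    by apply: ler_sum => i _; exact: hu.
  by rewrite -mulr_sumr -mulrA ler_wpM2l// sum_geometric_le.
have cv : cvgn (series u).
  apply: normed_cvg; apply: (@series_le_cvg _ _ (geometric K q)).
  - by move=> n; exact: normr_ge0.
  - by move=> n; rewrite /geometric/= mulr_ge0// exprn_ge0.
  - by move=> n; exact: hu.
  - by apply: is_cvg_geometric_series; rewrite ger0_norm.
exists (limn (series u)) => m.
have h : `|series u n - series u m| @[n --> \oo] --> `|limn (series u) - series u m|.
  by apply: cvg_norm; apply: cvgB => //; exact: cvg_cst.
rewrite -[X in _ - X]/(series u m) -(cvg_lim (@Rhausdorff R) h).
apply: limr_le; first by apply/cvg_ex; eexists; exact: h.
by near=> n; apply: tail; near: n; exact: nbhs_infty_ge.
Unshelve. all: by end_near. Qed.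

Lemma geometric_uniform_continuous (T : topologicalType) (f : T -> R) (F : nat -> T -> R) (C q : R) :
  0 <= q < 1 -> (forall m, continuous (F m)) ->
  (forall m (x : T), `|f x - F m x| <= C * q ^+ m) -> continuous f.
Proof.
move=> q01 cF h x; apply/cvgrPdist_le => /= e e0.
have e30 : 0 < e / 3 by rewrite divr_gt0.
have [n hn] := expr_small C q01 e30; have {}hn := hn n (leqnn n).
have /cvgrPdist_le/(_ _ e30) := cF n x; apply: filterS => y hy.
have h1 := le_trans (h n x) (ltW hn); have h2 := le_trans (h n y) (ltW hn).
have -> : f x - f y = (f x - F n x) + (F n x - F n y) + - (f y - F n y) by ring.
apply: le_trans (ler_normD _ _) _; rewrite normrN.
have := ler_normD (f x - F n x) (F n x - F n y).
lra.
Qed.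

Lemma Int_le_sub (a b c : R) f : continuous f -> a <= c <= b ->
  (forall x, a <= x <= b -> 0 <= f x) -> Int a c f <= Int a b f.
Proof.
move=> cf /andP[ac cb] f0; have ma : a - 1 < a by rewrite ltrBlDr ltrDl.
rewrite (Int_split ma ac)// (Int_split ma (le_trans ac cb))//.
rewrite -subr_ge0 opprB addrA subrK.
rewrite -(Int_split (lt_le_trans ma ac) cb)//.
by apply: Int_ge0 => x /andP[cx xb]; rewrite f0// (le_trans ac).
Qed.

End Pointwise.

(** * Legendre polynomials *)

Section Legendre.
Variable R : realType.
Implicit Types (n m : nat) (x : R).

(** The pair of degrees [n] and [n + 1] makes the three-term Bonnet recurrence a structural
    recursion. *)
Fixpoint legendre_pair n : {poly R} * {poly R} :=
  if n is n'.+1 then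
    let: (p, q) := legendre_pair n' in
    (q, (n'.+2%:R : R)^-1 *: ((2 * n' + 3)%:R *: ('X * q) - n'.+1%:R *: p))
  else (1, 'X).

Definition legendre n : {poly R} := (legendre_pair n).1.

Lemma legendre0 : legendre 0 = 1. Proof. by []. Qed.
Lemma legendre1 : legendre 1 = 'X. Proof. by []. Qed.

Lemma legendreSS n : n.+2%:R *: legendre n.+2 =
  (2 * n + 3)%:R *: ('X * legendre n.+1) - n.+1%:R *: legendre n.
Proof.
rewrite /legendre /=; case: (legendre_pair n) => p q /=.
by rewrite scalerA divff ?scale1r// pnatr_eq0.
Qed.

(** The two ladder identities are proved together because the inductive step of each uses both;
    eliminating the neighbouring degree between them gives the Legendre equation. *)
Lemma deriv_legendre_rec n :
  (legendre n.+1)^`() = 'X * (legendre n)^`() + n.+1%:R *: legendre n /\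
  'X * (legendre n.+1)^`() = (legendre n)^`() + n.+1%:R *: legendre n.+1.
Proof.
elim: n => [|n [IHa IHb]].
  by rewrite legendre0 legendre1 derivX derivC !scale1r mulr0 mulr1 !add0r.
have e := legendreSS n.
have de : n.+2%:R *: (legendre n.+2)^`() =
    (2 * n + 3)%:R *: (legendre n.+1 + 'X * (legendre n.+1)^`())
    - n.+1%:R *: (legendre n)^`().
  by rewrite -derivZ e derivB !derivZ derivM derivX mul1r.
have n2 : (n.+2%:R : R) != 0 by rewrite pnatr_eq0.
have ha : (legendre n.+2)^`() = 'X * (legendre n.+1)^`() + n.+2%:R *: legendre n.+1.
  apply: (scalerI n2); rewrite de.
  have -> : (legendre n)^`() = 'X * (legendre n.+1)^`() - n.+1%:R *: legendre n.+1.
    by rewrite IHb addrK.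
  rewrite -!mul_polyC !polyC_natr; ring.
split=> //; rewrite ha mulrDr.
have -> : 'X * ('X * (legendre n.+1)^`()) =
    (legendre n.+1)^`() + n.+1%:R *: ('X * legendre n.+1 - legendre n).
  rewrite IHb mulrDr.
  have -> : 'X * (legendre n)^`() = (legendre n.+1)^`() - n.+1%:R *: legendre n.
    by rewrite IHa addrK.
  by rewrite scalerBr scalerAr; ring.
rewrite e -!mul_polyC !polyC_natr; ring.
Qed.

Lemma legendre_ode n : ((1 - 'X^2) * (legendre n)^`())^`() = - ((n * n.+1)%:R *: legendre n).
Proof.
case: n => [|n]; first by rewrite legendre0 derivC mulr0 mul0n scale0r derivC oppr0.
have [a b] := deriv_legendre_rec n.
have -> : (1 - 'X^2) * (legendre n.+1)^`() = n.+1%:R *: (legendre n - 'X * legendre n.+1).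
  have := congr1 (fun p => 'X * p) b; rewrite mulrDr.
  have -> : 'X * (legendre n)^`() = (legendre n.+1)^`() - n.+1%:R *: legendre n.
    by rewrite a addrK.
  rewrite mulrA -expr2 => b'; rewrite mulrBl mul1r b' scalerBr scalerAr; ring.
rewrite derivZ derivB derivM derivX mul1r b.
rewrite natrM -scalerA -scalerN; congr (_ *: _).
rewrite -!mul_polyC !polyC_natr; ring.
Qed.

Lemma horner_legendre1 n : (legendre n).[1] = 1.
Proof.
suff : (legendre n).[1] = 1 /\ (legendre n.+1).[1] = 1 by case.
elim: n => [|n [h0 h1]]; first by rewrite legendre0 legendre1 hornerC hornerX.
split=> //; have n2 : (n.+2%:R : R) != 0 by rewrite pnatr_eq0.
apply: (mulfI n2); rewrite -hornerZ legendreSS hornerD hornerN !hornerZ hornerM hornerX h0 h1; ring.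
Qed.

Lemma horner_legendreN1 n : (legendre n).[-1] = (-1) ^+ n.
Proof.
suff : (legendre n).[-1] = (-1) ^+ n /\ (legendre n.+1).[-1] = (-1) ^+ n.+1 by case.
elim: n => [|n [h0 h1]]; first by rewrite legendre0 legendre1 hornerC hornerX.
split=> //; have n2 : (n.+2%:R : R) != 0 by rewrite pnatr_eq0.
apply: (mulfI n2); rewrite -hornerZ legendreSS hornerD hornerN !hornerZ hornerM hornerX h0 h1 !exprS; ring.
Qed.

Lemma size_legendre n : size (legendre n) = n.+1.
Proof.
suff : size (legendre n) = n.+1 /\ size (legendre n.+1) = n.+2 by case.
elim: n => [|n [h0 h1]]; first by rewrite legendre0 legendre1 size_poly1 size_polyX.
split=> //; have n2 : (n.+2%:R : R) != 0 by rewrite pnatr_eq0.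
rewrite -(size_scale _ n2) legendreSS.
have sX : size ((2 * n + 3)%:R *: ('X * legendre n.+1)) = n.+3.
  rewrite size_scale ?pnatr_eq0 ?addnS// mulrC size_mulX ?h1//.
  by rewrite -size_poly_eq0 h1.
rewrite size_polyDl ?sX// size_polyN size_scale ?pnatr_eq0// h0.
exact: leqnSn.
Qed.

Lemma horner_nondecreasing (p : {poly R}) (a b : R) : a <= b ->
  (forall x, a <= x <= b -> 0 <= (p^`()).[x]) -> p.[a] <= p.[b].
Proof.
rewrite le_eqVlt => /predU1P[->//|ab hp].
have [|c /[!in_itv]/= /andP[ac cb] e] := @MVT R (horner p) (horner p^`()) a b ab.
  exact/continuous_subspaceT/continuous_horner.
by rewrite -subr_ge0 e mulr_ge0// ?subr_ge0 ?(ltW ab)// hp// !ltW.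
Qed.

(** Sonin's argument: with l = n (n + 1), the function F = l P^2 + (1 - x^2) P'^2 has derivative 2 x
    P'^2 by the Legendre equation. It is thus largest at the ends -1 and 1, where it equals l, and
    it dominates l P^2. *)
Lemma legendre_le1 n x : -1 <= x <= 1 -> `|(legendre n).[x]| <= 1.
Proof.
case: n => [|n] /andP[x1 x2]; first by rewrite legendre0 hornerC normr1.
set P := legendre n.+1; pose l : R := (n.+1 * n.+2)%:R.
have l0 : 0 < l by rewrite ltr0n muln_gt0.
have hode := legendre_ode n.+1; rewrite -/P -/l in hode.
pose F := l *: P ^+ 2 + (1 - 'X^2) * P^`() ^+ 2.
have dF : F^`() = 2 *: ('X * P^`() ^+ 2).
  have e1 : (1 - 'X^2) * P^`()^`() = 2 *: ('X * P^`()) - l *: P.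
    move: hode; rewrite derivM derivB derivC derivXn/= sub0r expr1 => hode.
    rewrite -[- (l *: P)]hode.
    by rewrite -!mul_polyC !polyC_natr; ring.
  rewrite expr2 in e1; rewrite /F !expr2 derivD derivZ !derivM derivB !derivM derivC derivX.
  have -> : (1 - 'X * 'X) * (P^`()^`() * P^`() + P^`() * P^`()^`()) =
      ((1 - 'X * 'X) * P^`()^`()) * P^`() *+ 2 by ring.
  by rewrite e1 -!mul_polyC !polyC_natr; ring.
have FE y : F.[y] = l * P.[y] ^+ 2 + (1 - y ^+ 2) * (P^`()).[y] ^+ 2.
  by rewrite /F !hornerE.
have F1 : F.[1] = l by rewrite FE /P horner_legendre1 expr1n subrr mul0r addr0 mulr1.
have FN1 : F.[-1] = l.
  by rewrite FE /P horner_legendreN1 exprAC sqrrN !expr1n subrr mul0r addr0 mulr1.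
have Fx : F.[x] <= l.
  have [x0|x0] := leP 0 x.
    rewrite -F1; apply: horner_nondecreasing => // y /andP[xy y1].
    have -> : (F^`()).[y] = 2 * (y * (P^`()).[y] ^+ 2).
      by rewrite dF hornerZ hornerM hornerX horner_exp.
    by rewrite mulr_ge0// mulr_ge0 ?sqr_ge0//; exact: le_trans xy.
  rewrite -FN1 -[F.[x]]opprK -[F.[-1]]opprK lerN2 -!hornerN.
  apply: horner_nondecreasing => // y /andP[y1 yx].
  have -> : ((- F)^`()).[y] = - (2 * (y * (P^`()).[y] ^+ 2)).
    by rewrite derivN dF hornerN hornerZ hornerM hornerX horner_exp.
  rewrite oppr_ge0 mulr_ge0_le0// mulr_le0_ge0 ?sqr_ge0//.
  exact: le_trans yx (ltW x0).
have : l * P.[x] ^+ 2 <= l.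
  apply: le_trans Fx; rewrite FE lerDl mulr_ge0 ?sqr_ge0// subr_ge0.
  by rewrite -[leRHS](expr1n _ 2) -real_normK ?num_real// lerXn2r ?nnegrE// ler_norml x1.
rewrite -{2}[l]mulr1 ler_pM2l// => h.
by rewrite -(expr_le1 (n:=2))// real_normK ?num_real.
Qed.

(** The slope of P_n on [0, 1[ is at most n (n + 1): the function (1 - x^2) P' vanishes at 1 and has
    derivative - n (n + 1) P, so the mean value theorem bounds (1 - y) (1 + y) P'(y) by n (n + 1) (1
    - y), and 1 + y is at least 1. *)
Lemma legendre_ge n x : 0 <= x <= 1 -> 1 - (n * n.+1)%:R * (1 - x) <= (legendre n).[x].
Proof.
move=> /andP[x0]; rewrite le_eqVlt => /predU1P[->|x1].
  by rewrite subrr mulr0 subr0 horner_legendre1.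
set P := legendre n; pose l : R := (n * n.+1)%:R.
have l0 : 0 <= l by rewrite ler0n.
have dP (y : R) : 0 <= y -> y < 1 -> `|(P^`()).[y]| <= l.
  move=> y0 y1.
  pose G := (1 - 'X^2) * P^`().
  have [|c /[!in_itv]/= /andP[yc c1] e] := @MVT R (horner G) (horner G^`()) y 1 y1.
  exact/continuous_subspaceT/continuous_horner.
  have G1 : G.[1] = 0 by rewrite /G !hornerE expr1n subrr mul0r.
  have Gy : G.[y] = (1 - y) * (1 + y) * (P^`()).[y] by rewrite /G !hornerE; ring.
  have dG : (G^`()).[c] = - (l * P.[c]) by rewrite /G legendre_ode hornerN hornerZ.
  move: e; rewrite G1 Gy dG sub0r mulNr => /oppr_inj e.
  have e2 : (1 + y) * (P^`()).[y] = l * P.[c].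
    have y1' : 1 - y != 0 by rewrite subr_eq0 gt_eqF.
    by apply: (mulfI y1'); rewrite mulrA e mulrC.
  have hc : `|l * P.[c]| <= l.
    rewrite normrM ger0_norm// ler_piMr// legendre_le1// (ltW c1) andbT.
    by apply: le_trans (ltW yc); apply: le_trans y0; rewrite oppr_le0.
  rewrite -e2 normrM in hc; apply: le_trans hc.
  by rewrite ler_peMl// ger0_norm ?lerDl// addr_ge0.
have [|c /[!in_itv]/= /andP[xc c1] e] := @MVT R (horner P) (horner P^`()) x 1 x1.
  exact/continuous_subspaceT/continuous_horner.
have P1 : P.[1] = 1 by rewrite /P horner_legendre1.
have : (P^`()).[c] * (1 - x) <= l * (1 - x).
  apply: ler_wpM2r; first by rewrite subr_ge0 ltW.
  apply: le_trans (ler_norm _) (dP _ _ c1); exact: le_trans (ltW xc).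
by rewrite -e P1 -/l; lra.
Qed.

End Legendre.

(** * Orthogonality and completeness of the Legendre polynomials in the polar angle *)

Section Completeness.
Variable R : realType.
Implicit Types (g : R -> R) (x : R) (n m : nat) (p q : {poly R}).

Definition legcos n (al : R) : R := (legendre R n).[cos al].

Lemma continuous_polycos p : continuous (fun al : R => p.[cos al]).
Proof.
move=> x; apply: (@continuous_comp _ _ _ (@cos R) (horner p)).
  exact: continuous_cos.
exact: continuous_horner.
Qed.

Lemma der_polycos p (al : R) : is_derive al 1 (fun al : R => p.[cos al]) (- sin al * (p^`()).[cos al]).
Proof.
apply: (is_derive_eq (der_comp (is_derive_poly p (cos al)) (is_derive_cos al))).
by rewrite mulrC.
Qed.

Lemma Int_polycos_sin p q : q^`() = p ->
  Int 0 pi (fun al => p.[cos al] * sin al) = q.[1] - q.[-1].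
Proof.
move=> qp; have c : continuous (fun al : R => p.[cos al] * sin al).
  by move=> x; apply: cvgM; [exact: continuous_polycos|exact: continuous_sin].
have d (al : R) : is_derive al 1 (fun al : R => - q.[cos al]) (p.[cos al] * sin al).
  apply: (is_derive_eq (derN (der_polycos q al))); rewrite qp; ring.
by rewrite (FTC2 (pi_ge0 R) c d) cospi cos0; ring.
Qed.

(** The Wronskian-like polynomial (1 - x^2) (P' Q - P Q') is a primitive of a nonzero multiple of P
    Q and vanishes at both ends. *)
Lemma legcos_orthogonal n m : n != m ->
  Int 0 pi (fun al => legcos n al * legcos m al * sin al) = 0.
Proof.
move=> nm; set P := legendre R n; set Q := legendre R m.
pose l : R := (n * n.+1)%:R; pose k : R := (m * m.+1)%:R.
have kl : k - l != 0.
  rewrite subr_eq0 eqr_nat; apply: contra nm => /eqP h.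
  case: (ltngtP n m) h => // nm h.
    have : (n * n.+1 < m * m.+1)%N by apply: ltn_mul.
    by rewrite h ltnn.
  have : (m * m.+1 < n * n.+1)%N by apply: ltn_mul.
  by rewrite h ltnn.
pose q := ((1 - 'X^2) * P^`()) * Q - P * ((1 - 'X^2) * Q^`()).
have dq : q^`() = (k - l) *: (P * Q).
  rewrite /q derivB [in LHS]derivM [X in _ - X]derivM !legendre_ode -/P -/Q -/l -/k.
  rewrite -!mul_polyC polyCB; ring.
have e := Int_polycos_sin dq.
have c : continuous (fun al => legcos n al * legcos m al * sin al).
  move=> x; apply: cvgM; last exact: continuous_sin.
  by apply: cvgM; exact: continuous_polycos.
apply: (mulfI kl); rewrite mulr0 -(@IntZ _ _ _ (k - l))//.
rewrite (@eq_Int _ _ _ _ (fun al => ((k - l) *: (P * Q)).[cos al] * sin al)); last first.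
  by move=> x _; rewrite hornerZ hornerM /legcos; ring.
have h1 (x : R) : (1 - 'X^2).[x] = 1 - x ^+ 2 by rewrite hornerD hornerN hornerXn hornerC.
have qE (x : R) : q.[x] = (1 - x ^+ 2) * (P^`().[x] * Q.[x] - P.[x] * Q^`().[x]).
  by rewrite /q hornerD hornerN !hornerM !h1; ring.
by rewrite e !qE; ring.
Qed.

Definition legnorm n : R := Int 0 pi (fun al => legcos n al * legcos n al * sin al).

Lemma legcos_le1 n (al : R) : `|legcos n al| <= 1.
Proof. by apply: legendre_le1; rewrite cos_geN1 cos_le1. Qed.

(** The exact value is 2 / (2 n + 1). This weaker bound needs only the polar cap where cos al is at
    least 1 - 1 / (2 (n + 1)^2): there P_n is at least 1/2 by [legendre_ge], and the integral of sin
    al / 4 over the cap is the stated constant. *)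
Lemma legnorm_ge n : (8 * n.+1%:R ^+ 2)^-1 <= legnorm n.
Proof.
pose L : R := n.+1%:R ^+ 2; rewrite -/L.
have L1 : 1 <= L by rewrite exprn_ege1// ler1n.
have L0 : 0 < L by rewrite (lt_le_trans ltr01).
pose mu : R := 1 - (2 * L)^-1.
have mu0 : 0 <= mu.
  by rewrite subr_ge0 invf_le1 ?mulr_gt0//; lra.
have mu1 : mu < 1 by rewrite ltrBlDr ltrDl invr_gt0 mulr_gt0.
have muI : mu \in `[(-1), 1] by rewrite in_itv/=; apply/andP; split; lra.
pose c := acos mu.
have c0 : 0 <= c by apply: acos_ge0; apply/andP; split; lra.
have cpi : c <= pi by apply: acos_lepi; apply/andP; split; lra.
have cc : cos c = mu by apply: acosK.
have cont : continuous (fun al => legcos n al * legcos n al * sin al).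
  move=> x; apply: cvgM; last exact: continuous_sin.
  by apply: cvgM; exact: continuous_polycos.
have cs4 : continuous (fun al : R => 4^-1 * sin al).
  by move=> x; apply: cvgM; [exact: cvg_cst|exact: continuous_sin].
have ds (al : R) : is_derive al 1 (fun al : R => - (4^-1 * cos al)) (4^-1 * sin al).
  by apply: (is_derive_eq (derN (derZ _ (is_derive_cos al)))); ring.
have h1 : Int 0 c (fun al : R => 4^-1 * sin al) = (8 * L)^-1.
  rewrite (FTC2 c0 cs4 ds) cc cos0 /mu; field; exact: lt0r_neq0.
rewrite -h1 /legnorm; apply: le_trans; last first.
  apply: (@Int_le_sub _ 0 pi c); rewrite ?c0// => x x0pi.
  by rewrite -expr2 mulr_ge0 ?sqr_ge0// sin_ge0_pi.
apply: le_Int => // x /andP[x0 xc].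
have xpi : x <= pi by exact: le_trans cpi.
have xI : x \in `[0, pi] by rewrite in_itv/= x0.
have cI : c \in `[0, pi] by rewrite in_itv/= c0.
have mux : mu <= cos x.
  rewrite -cc leNgt; apply/negP => h.
  by move: h; rewrite ltr_cos// ltNge xc.
apply: ler_wpM2r; first by rewrite sin_ge0_pi// x0.
have hx : 2^-1 <= legcos n x.
  apply: (@le_trans _ _ (1 - (n * n.+1)%:R * (1 - cos x))); last first.
    by apply: legendre_ge; rewrite (le_trans mu0)// cos_le1.
  have : (n * n.+1)%:R * (1 - cos x) <= L * (2 * L)^-1.
    apply: ler_pM; rewrite ?ler0n ?subr_ge0 ?cos_le1//.
      by rewrite /L -natrX ler_nat expnS expn1 leq_mul.
    by move: mux; rewrite /mu; lra.
  have -> : L * (2 * L)^-1 = 2^-1 by field; exact: lt0r_neq0.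
  lra.
have -> : (4^-1 : R) = 2^-1 * 2^-1 by field.
by apply: ler_pM.
Qed.

Lemma Int_legcos_sin_poly g : continuous g ->
  (forall n, Int 0 pi (fun al => g al * legcos n al * sin al) = 0) ->
  forall p, Int 0 pi (fun al => g al * p.[cos al] * sin al) = 0.
Proof.
move=> cg h p; have [n] := ubnP (size p); elim: n p => // n IH p.
have cgp (r : {poly R}) : continuous (fun al => g al * r.[cos al] * sin al).
  move=> x; apply: cvgM; last exact: continuous_sin.
  by apply: cvgM; [exact: cg|exact: continuous_polycos].
rewrite ltnS leq_eqVlt => /predU1P[sp|]; last by move=> ?; exact: IH.
case: n IH sp => [IH /eqP|n IH sp].
  rewrite size_poly_eq0 => /eqP ->.
  rewrite (@eq_Int _ _ _ _ (fun=> 0)) ?Int_cst ?pi_ge0 ?mul0r// => x _.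
  by rewrite horner0 mulr0 mul0r.
pose P := legendre R n.
have lP : lead_coef P != 0.
  by rewrite lead_coef_eq0 -size_poly_eq0 size_legendre.
pose k := lead_coef p / lead_coef P; pose q := p - k *: P.
have k0 : k != 0.
  by rewrite mulf_neq0 ?invr_eq0// lead_coef_eq0 -size_poly_eq0 sp.
have sq : (size q < n.+1)%N.
  rewrite ltnS; apply/leq_sizeP => j; rewrite leq_eqVlt => /predU1P[<-|nj].
    rewrite coefB coefZ /k.
    have -> : p`_n = lead_coef p by rewrite lead_coefE sp.
    have -> : P`_n = lead_coef P by rewrite lead_coefE size_legendre.
    by rewrite divfK// subrr.
  by rewrite coefB coefZ !nth_default ?mulr0 ?subr0// ?sp ?size_legendre.
rewrite (@eq_Int _ _ _ _ (fun al => g al * q.[cos al] * sin al + k * (g al * legcos n al * sin al))).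
  rewrite IntD; [|exact: cgp|]; last first.
    by move=> x; apply: cvgM; [exact: cvg_cst|exact: cgp].
  by rewrite IntZ ?h ?mulr0 ?addr0 ?IH//; exact: cgp.
by move=> x _; rewrite /q hornerD hornerN hornerZ /legcos; ring.
Qed.

(** If [g 0 > 0], test [g] against powers of Q(cos al) = 1 + (cos al - cos d) / 2. This weight lies
    in [0, 1] beyond the angle [d] and is at least some [q > 1] near the pole, so the integral near
    the pole grows geometrically while the rest stays bounded, although the total is zero. *)
Lemma legendre_complete_le g : continuous g ->
  (forall n, Int 0 pi (fun al => g al * legcos n al * sin al) = 0) -> g 0 <= 0.
Proof.
move=> cg h; rewrite leNgt; apply/negP => g0.
have hp := Int_legcos_sin_poly cg h.
have g20 : 0 < g 0 / 2 by rewrite divr_gt0.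
have /cvgrPdist_lt/(_ _ g20)/nbhs_ballP[/= e0 e00 he0] := cg 0.
pose d : R := Num.min (e0 / 2) 1.
have d0 : 0 < d by rewrite lt_min divr_gt0//=.
have d1 : d <= 1 by rewrite ge_min lexx orbT.
have de : d < e0.
  by apply: (@le_lt_trans _ _ (e0 / 2)); [rewrite ge_min lexx|lra].
have hd x : 0 <= x <= d -> g 0 / 2 <= g x.
  move=> /andP[x0 xd]; have := he0 x; rewrite /ball/= sub0r normrN ger0_norm//.
  by move=> /(_ (le_lt_trans xd de)); rewrite ltr_norml; lra.
have pi2 := @pi_ge2 R.
have dpi : d <= pi by lra.
have dI : d \in `[0, pi] by rewrite in_itv/= ltW.
pose Q : {poly R} := 2^-1 *: ('X + (2 - cos d)%:P).
have QE x : Q.[x] = 1 + (x - cos d) / 2.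
  by rewrite /Q hornerZ hornerD hornerX hornerC; field.
have [B0 B0pi hB] := @EVT_max R (fun x => `|g x|) 0 pi (pi_ge0 R)
  (continuous_subspaceT (fun x => continuous_comp (cg x) (@norm_continuous _ _ _))).
pose B : R := `|g B0|.
have gB x : 0 <= x <= pi -> `|g x| <= B by move=> x0; apply: hB; rewrite in_itv.
have Bge0 : 0 <= B by exact: normr_ge0.
pose c := d / 2.
have c0 : 0 < c by rewrite divr_gt0.
have cd : c < d by rewrite /c; lra.
have cI : c \in `[0, pi] by rewrite in_itv/=; apply/andP; split; lra.
have cdc : cos d < cos c by rewrite ltr_cos.
pose q := 1 + (cos c - cos d) / 2.
have q1 : 1 < q by rewrite ltrDl divr_gt0// subr_gt0.
have Qpos x : 0 <= Q.[cos x].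
  by rewrite QE; have := cos_geN1 x; have := cos_le1 d; lra.
have Qle1 x : d <= x <= pi -> Q.[cos x] <= 1.
  move=> /andP[dx xpi]; rewrite QE gerDl pmulr_lle0 ?invr_gt0// subr_le0.
  have xI : x \in `[0, pi] by rewrite in_itv/= xpi andbT; lra.
  by rewrite leNgt; apply/negP; rewrite ltr_cos// ltNge dx.
have Qgeq x : 0 <= x <= c -> q <= Q.[cos x].
  move=> /andP[x0 xc]; rewrite QE lerD2l ler_pM2r ?invr_gt0// lerD2r.
  have xI : x \in `[0, pi] by rewrite in_itv/= x0; lra.
  by rewrite leNgt; apply/negP; rewrite ltr_cos// ltNge xc.
have cgQ n : continuous (fun al => g al * (Q ^+ n).[cos al] * sin al).
  move=> x; apply: cvgM; last exact: continuous_sin.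
  by apply: cvgM; [exact: cg|exact: continuous_polycos].
have cgQB n : continuous (fun al => g al * (Q ^+ n).[cos al] * sin al + B).
  by move=> x; apply: cvgD; [exact: cgQ|exact: cvg_cst].
(* Adding the constant [B], a bound of [|g|], makes the integrand nonnegative on the whole of
   [[0, pi]], so that the domain may be cut down to [[0, c]]; this produces the bound [B * pi]. *)
have key n : g 0 / 2 * q ^+ n * (1 - cos c) <= B * pi.
  have -> : B * pi = Int 0 pi (fun al => g al * (Q ^+ n).[cos al] * sin al + B).
    rewrite IntD ?hp; [|exact: cgQ|by move=> x; exact: cvg_cst].
    by rewrite Int_cst ?pi_ge0// add0r subr0.
  pose k := g 0 / 2 * q ^+ n; rewrite -/k.
  have k0 : 0 <= k by rewrite mulr_ge0 ?(ltW g20)// exprn_ge0// ltW// (lt_trans ltr01).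
  have cks : continuous (fun al : R => k * sin al).
    by move=> x; apply: cvgM; [exact: cvg_cst|exact: continuous_sin].
  have dks (al : R) : is_derive al 1 (fun al : R => - (k * cos al)) (k * sin al).
    by apply: (is_derive_eq (derN (derZ _ (is_derive_cos al)))); ring.
  have -> : k * (1 - cos c) = Int 0 c (fun al : R => k * sin al).
    by rewrite (FTC2 (ltW c0) cks dks) cos0; ring.
  have h1 x : 0 <= x <= d -> 0 <= g x * (Q ^+ n).[cos x] * sin x.
    move=> x0d; have /andP[x0 xd] := x0d.
    rewrite mulr_ge0 ?sin_ge0_pi ?x0 ?(le_trans xd)// mulr_ge0//.
      by apply: le_trans (hd x x0d); exact: ltW.
    by rewrite horner_exp exprn_ge0.
  have hsub : Int 0 c (fun al => g al * (Q ^+ n).[cos al] * sin al + B) <=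
      Int 0 pi (fun al => g al * (Q ^+ n).[cos al] * sin al + B).
    apply: (Int_le_sub (cgQB n)); first by apply/andP; split; lra.
    move=> x /andP[x0 xpi]; have [xd|dx] := leP x d.
      by rewrite addr_ge0// h1// x0.
    suff : `|g x * (Q ^+ n).[cos x] * sin x| <= B by rewrite ler_norml; lra.
    rewrite !normrM -[leRHS]mulr1 -[B]mulr1.
    apply: ler_pM; [by rewrite mulr_ge0|by []| |exact: sin_max].
    apply: ler_pM => //; first by apply: gB; rewrite x0.
    by rewrite horner_exp ger0_norm ?exprn_ge0// exprn_ile1// Qle1// ltW.
  apply: le_trans hsub; apply: le_Int => // x /andP[x0 xc].
  apply: (@le_trans _ _ (g x * (Q ^+ n).[cos x] * sin x)); last by rewrite lerDl.
  apply: ler_wpM2r; first by rewrite sin_ge0_pi// x0//=; lra.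
  have q0 : 0 <= q by rewrite ltW// (lt_trans ltr01).
  apply: ler_pM; [exact: ltW|exact: exprn_ge0| |].
    by apply: hd; rewrite x0//=; lra.
  by rewrite horner_exp; apply: lerXn2r; rewrite ?nnegrE// Qgeq// x0.
have k0 : 0 < g 0 / 2 * (1 - cos c).
  rewrite mulr_gt0// subr_gt0 -(@cos0 R) ltr_cos// in_itv/= lexx pi_ge0//.
have [n] := expr_unbounded (B * pi / (g 0 / 2 * (1 - cos c))) q1.
rewrite ltr_pdivrMr// => hn; have := lt_le_trans hn (_ : _ <= B * pi).
rewrite ltxx (_ : q ^+ n * _ = g 0 / 2 * q ^+ n * (1 - cos c)); last by ring.
by rewrite key => /(_ isT).
Qed.

Lemma legendre_complete g : continuous g ->
  (forall n, Int 0 pi (fun al => g al * legcos n al * sin al) = 0) -> g 0 = 0.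
Proof.
move=> cg h; apply/eqP; rewrite eq_le legendre_complete_le//= -oppr_le0.
apply: (@legendre_complete_le (fun x => - g x)); first by move=> x; apply: cvgN; exact: cg.
move=> n; rewrite (@eq_Int _ _ _ _ (fun al => -1 * (g al * legcos n al * sin al))).
  rewrite IntZ ?h ?mulr0// => x; apply: cvgM; last exact: continuous_sin.
  by apply: cvgM; [exact: cg|exact: continuous_polycos].
by move=> x _; ring.
Qed.

(** The series with coefficients [b n] converges uniformly to some S because [legcos] is bounded by
    1. By orthogonality g and S have the same Legendre coefficients, so completeness identifies
    their values at the pole, where each [legcos n] is 1. *)
Lemma legendre_expansion g (K q : R) : continuous g -> 0 <= q < 1 ->
  let b n := Int 0 pi (fun al => g al * legcos n al * sin al) / legnorm n in
  (forall n, `|b n| <= K * q ^+ n) ->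
  forall m, `|g 0 - \sum_(0 <= i < m) b i| <= K * q ^+ m / (1 - q).
Proof.
move=> cg q01 b hb; have /andP[q0 q1] := q01.
have d : 0 < 1 - q by rewrite subr_gt0.
have hbx n x : `|b n * legcos n x| <= K * q ^+ n.
  rewrite normrM; apply: le_trans (hb n).
  by rewrite ler_piMr// legcos_le1.
have [S hS] := choice (fun x => geometric_series_limit q01 (hbx ^~ x)).
pose F m (x : R) := \sum_(0 <= i < m) b i * legcos i x.
have cl i : continuous (legcos i) by exact: continuous_polycos.
have cF m : continuous (F m).
  move=> x; rewrite /F; elim: m => [|m IH].
    under eq_fun do rewrite big_geq//; exact: cvg_cst.
  under eq_fun do rewrite big_nat_recr//=.
  by apply: cvgD => //; apply: cvgM; [exact: cvg_cst|exact: cl].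
have hSF m x : `|S x - F m x| <= K / (1 - q) * q ^+ m by rewrite mulrAC; exact: hS.
have cS : continuous S by exact: (geometric_uniform_continuous q01 cF hSF).
have cD : continuous (fun x => g x - S x).
  by move=> x; apply: cvgB; [exact: cg|exact: cS].
have cp (f : R -> R) n : continuous f -> continuous (fun al => f al * legcos n al * sin al).
  move=> cf x; apply: cvgM; last exact: continuous_sin.
  by apply: cvgM; [exact: cf|exact: cl].
have N0 n : legnorm n != 0.
  rewrite gt_eqF//; apply: lt_le_trans (legnorm_ge n).
  by rewrite invr_gt0 mulr_gt0// exprn_gt0// ltr0n.
suff : g 0 - S 0 = 0.
  move/eqP; rewrite subr_eq0 => /eqP -> m.
  have := hS 0 m; under eq_bigr do rewrite /legcos cos0 horner_legendre1 mulr1.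
  by [].
apply: (@legendre_complete (fun x => g x - S x)) => // n.
rewrite (@eq_Int _ _ _ _ (fun al => g al * legcos n al * sin al - S al * legcos n al * sin al)); last first.
  by move=> x _; ring.
rewrite IntB; [|exact: cp|exact: cp].
have FE m : (n < m)%N -> Int 0 pi (fun al => F m al * legcos n al * sin al) = b n * legnorm n.
  have hF k : Int 0 pi (fun al => F k al * legcos n al * sin al) =
      \sum_(0 <= i < k) (if i == n then b n * legnorm n else 0).
    elim: k => [|k IH].
      rewrite big_geq// (@eq_Int _ _ _ _ (fun=> 0)) ?Int_cst ?pi_ge0 ?mul0r// => x _.
      by rewrite /F big_geq// !mul0r.
    rewrite big_nat_recr//= -IH.
    rewrite (@eq_Int _ _ _ _ (fun al => F k al * legcos n al * sin al + b k * (legcos k al * legcos n al * sin al))).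
      rewrite IntD; [|exact: cp|]; last first.
        by move=> x; apply: cvgM; [exact: cvg_cst|exact: cp].
      rewrite IntZ; last exact: cp.
      congr (_ + _); case: eqVneq => [->//|kn].
      by rewrite legcos_orthogonal ?mulr0.
    by move=> x _; rewrite /F big_nat_recr//=; ring.
  move=> nm; rewrite hF -big_mkcond/= big_nat1_eq//.
  by rewrite nm.
have -> : Int 0 pi (fun al => g al * legcos n al * sin al) = b n * legnorm n.
  by rewrite /b divfK.
apply/eqP; rewrite -normr_le0.
have K0 : 0 <= K by have := hb 0%N; rewrite expr0 mulr1; apply: le_trans.
apply: (@le0_of_geometric _ _ (K / (1 - q) * pi) q q01) => m.
(* The truncation index exceeds [n], so the partial sum already has the exact [n]-th coefficient,
   while its uniform distance to S is geometric in [m]. *)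
rewrite -(FE (n.+1 + m)%N) ?ltn_addr// -IntB; [|exact: cp|exact: cp].
apply: le_trans.
  apply: (@Int_le_cst _ 0 pi _ (K / (1 - q) * q ^+ m)); first exact: pi_ge0.
    by move=> x; apply: cvgB; exact: cp.
  move=> x x0pi.
  have -> : F (n.+1 + m)%N x * legcos n x * sin x - S x * legcos n x * sin x =
      - ((S x - F (n.+1 + m)%N x) * (legcos n x * sin x)) by ring.
  rewrite normrN normrM -[leRHS]mulr1; apply: ler_pM => //.
    apply: le_trans (hSF _ _) _; rewrite ler_wpM2l ?divr_ge0 ?(ltW d)//.
    by apply: ler_wiXn2l; rewrite ?(ltW q1)// leq_addl.
  by rewrite normrM mulr_ile1// ?legcos_le1// sin_max.
by rewrite subr0 mulrAC.
Qed.

End Completeness.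

(** * Spherical means of Helmholtz solutions *)

Section ChainRule.
Variables (R : realType) (n : nat).
Implicit Types (u : 'rV[R]_n -> R) (U : set 'rV[R]_n) (x v h : 'rV[R]_n).

Notation partial u i := ('D_('e_ i) u).

Lemma der_line u x v (s : R) : derivable u (x + s *: v) v ->
  is_derive s 1 (fun s => u (x + s *: v)) ('D_v u (x + s *: v)).
Proof.
move=> du; have e : (fun h : R => h^-1 *: (((fun s => u (x + s *: v)) \o shift s) (h *: 1) - u (x + s *: v))) =
   (fun h : R => h^-1 *: ((u \o shift (x + s *: v)) (h *: v) - u (x + s *: v))).
  apply/funext => h /=; congr (_ *: (u _ - _)).
  by rewrite [h *: 1]mulr1 scalerDl addrCA.
by apply: DeriveDef; rewrite /derivable /derive e.
Qed.

Definition box x h : set 'rV[R]_n := [set z | forall j, `|z 0 j - x 0 j| <= `|h 0 j|].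

(** The increment is split into steps along one coordinate at a time, through the truncations [tr k]
    of [h], with the mean value theorem on each step; the intermediate points stay in the box
    spanned by [h]. *)
Lemma partial_increment u x h : (forall z, box x h z -> forall i, derivable u z ('e_ i)) ->
  exists z : 'I_n -> 'rV[R]_n, (forall i, box x h (z i)) /\
    u (x + h) - u x = \sum_i h 0 i * partial u i (z i).
Proof.
move=> du.
pose tr (k : nat) : 'rV[R]_n := \row_i (if (i < k)%N then h 0 i else 0).
have step (i : 'I_n) : exists z, box x h z /\
    u (x + tr i.+1) - u (x + tr i) = h 0 i * partial u i z.
  pose y := x + tr i.
  have trS : x + tr i.+1 = y + h 0 i *: 'e_ i.
    rewrite /y -addrA; congr (_ + _); apply/rowP => j; rewrite !mxE /=.
    rewrite ltnS leq_eqVlt; have [->|ji] := eqVneq j i.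
      by rewrite eqxx ltnn /= add0r mulr1.
    rewrite (negbTE (_ : nat_of_ord j != i))//= mulr0 addr0.
    by case: ifP.
  have boxy (s : R) : `|s| <= `|h 0 i| -> box x h (y + s *: 'e_ i).
    move=> sh j; rewrite /y !mxE /=; have [->|ji] := eqVneq j i.
      by rewrite ltnn addr0 mulr1 addrAC subrr add0r.
    by rewrite mulr0 addr0 addrAC subrr add0r; case: ifP => // _; rewrite normr0.
  have dl (s : R) : `|s| <= `|h 0 i| ->
      is_derive s 1 (fun s => u (y + s *: 'e_ i)) (partial u i (y + s *: 'e_ i)).
    by move=> sh; apply: der_line; apply: du; exact: boxy.
  have y0 : y + 0 *: 'e_ i = y by rewrite scale0r addr0.
  have [h0|h0|h0] := ltgtP 0 (h 0 i).
  - have [|c /andP[c0 ch] e] := der_MVT h0 (f := fun s => u (y + s *: 'e_ i)) (f' := fun s => partial u i (y + s *: 'e_ i)).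
      by move=> s /andP[s0 sh]; apply: dl; rewrite !ger0_norm// ltW.
    exists (y + c *: 'e_ i); split; first by apply: boxy; rewrite !ger0_norm// ltW.
    by rewrite y0 in e; rewrite trS e subr0 mulrC.
  - have [|c /andP[c0 ch] e] := der_MVT h0 (f := fun s => u (y + s *: 'e_ i)) (f' := fun s => partial u i (y + s *: 'e_ i)).
      by move=> s /andP[s0 sh]; apply: dl; rewrite !ler0_norm ?lerN2// ltW.
    exists (y + c *: 'e_ i); split; first by apply: boxy; rewrite !ler0_norm ?lerN2// ltW.
    by rewrite y0 in e; rewrite trS -[LHS]opprB e sub0r mulrN opprK mulrC.
  - exists y; split; first by rewrite -y0; apply: boxy; rewrite normr0.
    by rewrite trS -h0 y0 subrr mul0r.
have [z hz] := choice step.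
exists z; split=> [i|]; first by have [] := hz i.
have tr0 : x + tr 0%N = x.
  by rewrite (_ : tr _ = 0) ?addr0//; apply/rowP => j; rewrite !mxE.
have trn : x + tr n = x + h.
  by congr (_ + _); apply/rowP => j; rewrite !mxE ltn_ord.
rewrite -trn -[in X in _ - X]tr0 -(telescope_sumr (fun k => u (x + tr k)) (leq0n n)).
by rewrite big_mkord; apply: eq_bigr => i _; have [] := hz i.
Qed.

Lemma cvg_sumr (T : Type) (F : set_system T) (FF : Filter F) (I : finType) (f : I -> T -> R) (l : I -> R) :
  (forall i, f i x @[x --> F] --> l i) ->
  \sum_i f i x @[x --> F] --> \sum_i l i.
Proof.
move=> h; suff H (s : seq I) : \sum_(i <- s) f i x @[x --> F] --> \sum_(i <- s) l i.
  exact: H (index_enum I).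
elim: s => [|i s IH].
  rewrite big_nil; have -> : (fun x : T => \sum_(i <- [::]) f i x) = cst 0.
    by apply/funext => x; rewrite big_nil.
  exact: cvg_cst.
rewrite big_cons.
have -> : (fun x : T => \sum_(i <- i :: s) f i x) = (fun x : T => f i x + \sum_(i <- s) f i x).
  by apply/funext => x; rewrite big_cons.
exact: cvgD.
Qed.

(** The intermediate points of [partial_increment] tend to [c t], so continuity of the partial
    derivatives gives the limit of the difference quotient directly. *)
Lemma der_curve U u (c : R -> 'rV[R]_n) (t : R) (d : 'I_n -> R) :
  open U -> class_C 1 U u -> U (c t) ->
  (forall i, is_derive t 1 (fun s => c s 0 i) (d i)) ->
  is_derive t 1 (fun s => u (c s)) (\sum_i partial u i (c t) * d i).
Proof.
move=> oU [_ hu] Uct dc; set x := c t.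
have : nbhs x U by exact: open_nbhs_nbhs.
move=> /nbhs_ballP[/= r r0 rU].
have boxU h : (forall j, `|h 0 j| < r) -> box x h `<=` U.
  move=> hr z zb; apply: rU; split=> // i j; rewrite ord1 /ball/= distrC.
  exact: le_lt_trans (zb j) (hr j).
(* The box lies in [U] only for small [h]; for other [h] the points default to [x], so that a choice
   function exists for all [h]. *)
have ex h : exists z : 'I_n -> 'rV[R]_n, (forall i, box x h (z i)) /\
    ((forall j, `|h 0 j| < r) -> u (x + h) - u x = \sum_i h 0 i * partial u i (z i)).
  have [hr|nhr] := pselect (forall j, `|h 0 j| < r).
    have [z [z1 z2]] := @partial_increment u x h (fun z zb i => (hu i).1 z (boxU h hr z zb)).
    by exists z.
  exists (fun=> x); split=> // i j; by rewrite subrr normr0.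
have [z hz] := choice ex.
have dcc i : (fun s => c s 0 i) @ t --> c t 0 i by exact: der_continuous (dc i).
pose k (h : R) := c (h + t) - x.
have kc i : k h 0 i @[h --> 0^'] --> (0 : R).
  have ht : h + t @[h --> 0^'] --> t.
    have : h + t @[h --> 0^'] --> (0 : R) + t by apply: cvgD; [exact: cvg_within|exact: cvg_cst].
    by rewrite add0r.
  have : c (h + t) 0 i - x 0 i @[h --> 0^'] --> c t 0 i - x 0 i.
    apply: cvgB; last exact: cvg_cst.
    exact: (cvg_comp _ _ ht (dcc i)).
  rewrite subrr; have -> : (fun h : R => k h 0 i) = (fun h : R => c (h + t) 0 i - x 0 i).
    by apply/funext => h; rewrite /k !mxE.
  by [].
have knear : \forall h \near 0^', forall j, `|k h 0 j| < r.
  apply: filter_forall => j; have /cvgrPdist_lt/(_ _ r0) := kc j.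
  by apply: filterS => h; rewrite sub0r normrN.
have qc i : partial u i (z (k h) i) @[h --> 0^'] --> partial u i x.
  have zc : z (k h) i @[h --> 0^'] --> x.
    apply/cvg_ballP => e e0.
    have : \forall h \near 0^', forall j, `|k h 0 j| < e.
      apply: filter_forall => j; have /cvgrPdist_lt/(_ _ e0) := kc j.
      by apply: filterS => h; rewrite sub0r normrN.
    apply: filterS => h hk; split=> // a j; rewrite ord1 /ball/= distrC.
    exact: le_lt_trans ((hz (k h)).1 i j) (hk j).
  exact: (cvg_comp _ _ zc ((hu i).2.1 x Uct)).
have dq i : h^-1 * k h 0 i @[h --> 0^'] --> d i.
  have [dv de] := dc i; rewrite -de.
  have -> : (fun h : R => h^-1 * k h 0 i) = (fun h : R => h^-1 *: (((fun s => c s 0 i) \o shift t) (h *: 1) - c t 0 i)).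
    by apply/funext => h /=; rewrite /k !mxE [h *: 1]mulr1.
  exact: dv.
suff H : (fun h : R => h^-1 *: (((fun s => u (c s)) \o shift t) (h *: 1) - u (c t))) @ 0^' -->
    \sum_i partial u i x * d i.
  by apply: DeriveDef; [apply/cvg_ex; eexists; exact: H|exact/cvg_lim].
have H1 : \sum_i partial u i (z (k h) i) * (h^-1 * k h 0 i) @[h --> 0^'] --> \sum_i partial u i x * d i.
  by apply: cvg_sumr => i; exact: cvgM.
apply: cvg_trans H1; apply: near_eq_cvg; apply: filterS knear => h hk.
rewrite /= [h *: 1]mulr1.
have -> : c (h + t) = x + k h by rewrite /k addrCA subrr addr0.
rewrite (hz (k h)).2// [RHS]/(_ *: _) /= mulr_sumr; apply: eq_bigr => i _.
by rewrite mulrCA (mulrC (k h 0 i)).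
Qed.

Lemma is_derive_line (u : 'rV[R]_n -> R) x v (D : R) :
  is_derive (0 : R) 1 (fun s : R => u (x + s *: v)) D -> is_derive x v u D.
Proof.
have e : (fun h : R => h^-1 *: (((fun s => u (x + s *: v)) \o shift 0) (h *: 1) - u (x + 0 *: v))) =
   (fun h : R => h^-1 *: ((u \o shift x) (h *: v) - u x)).
  by apply/funext => h /=; rewrite scale0r !addr0 [h *: 1]mulr1 (addrC x).
case=> H1 H2; apply: DeriveDef; first by move: H1; rewrite /derivable e.
by rewrite -H2 /derive e.
Qed.

Lemma derive_partial U u x v : open U -> class_C 1 U u -> U x ->
  is_derive x v u (\sum_i partial u i x * v 0 i).
Proof.
move=> oU hu Ux; apply: is_derive_line.
have := @der_curve U u (fun s => x + s *: v) 0 (fun i => v 0 i) oU hu.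
rewrite scale0r addr0; apply => // i.
apply: (@der_ext _ (fun s => x 0 i + s * v 0 i)); first by near=> s; rewrite !mxE.
apply: (is_derive_eq (derD (der_cst _ _) (derM (is_derive_id _ _) (der_cst _ _)))).
by rewrite mulr0 addr0 mul1r add0r.
Unshelve. all: by end_near. Qed.

End ChainRule.

(** * Iterated integrals over longitude and colatitude *)

Section DoubleIntegral.
Variable R : realType.
Implicit Types (f g : R -> R -> R).

(** The Jacobian [sin al] of the sphere is not included here; it is carried by the integrands. *)
Definition dblInt f : R := Int 0 (pi *+ 2) (fun ph => Int 0 pi (f ph)).

Definition jcont f := continuous (fun p : R * R => f p.1 p.2).

Lemma jcont_r f (ph : R) : jcont f -> continuous (f ph).
Proof.
move=> cf al; apply: (@continuous_comp _ _ _ (fun y => (ph, y)) (fun p => f p.1 p.2)); last exact: cf.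
by apply: continuous_pair; [exact: cvg_cst|exact: cvg_id].
Qed.

Lemma jcont_l f (al : R) : jcont f -> continuous (f^~ al).
Proof.
move=> cf ph; apply: (@continuous_comp _ _ _ (fun y => (y, al)) (fun p => f p.1 p.2)); last exact: cf.
by apply: continuous_pair; [exact: cvg_id|exact: cvg_cst].
Qed.

Lemma jcont_Int f (x y : R) : jcont f -> continuous (fun ph => Int x y (f ph)).
Proof.
move=> cf ph; apply: continuous_Int; first by near=> t; exact: jcont_r.
by move=> al; exact: cf.
Unshelve. all: by end_near. Qed.

Lemma pi2_ge0 : 0 <= pi *+ 2 :> R.
Proof. by rewrite mulrn_wge0// pi_ge0. Qed.

Lemma eq_dblInt f g : (forall ph al, f ph al = g ph al) -> dblInt f = dblInt g.
Proof. by move=> fg; congr dblInt; apply/funext => ph; apply/funext => al. Qed.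

Lemma dblIntD f g : jcont f -> jcont g ->
  dblInt (fun ph al => f ph al + g ph al) = dblInt f + dblInt g.
Proof.
move=> cf cg; rewrite /dblInt -IntD; [|exact: jcont_Int|exact: jcont_Int].
by apply: eq_Int => ph _; rewrite IntD//; exact: jcont_r.
Qed.

Lemma dblIntZ (k : R) f : jcont f -> dblInt (fun ph al => k * f ph al) = k * dblInt f.
Proof.
move=> cf; rewrite /dblInt -IntZ; last exact: jcont_Int.
by apply: eq_Int => ph _; rewrite IntZ//; exact: jcont_r.
Qed.

Lemma dblInt_swap f : jcont f ->
  dblInt f = Int 0 pi (fun al => Int 0 (pi *+ 2) (f^~ al)).
Proof. by move=> cf; apply: Int_swap => //; exact: pi2_ge0. Qed.

Lemma dblInt_le f (K : R) : jcont f ->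
  (forall ph al, 0 <= al <= pi -> `|f ph al| <= K) -> `|dblInt f| <= K * pi * (pi *+ 2).
Proof.
move=> cf h; rewrite -[X in _ * X]subr0; apply: Int_le_cst; [exact: pi2_ge0|exact: jcont_Int|].
move=> ph _; rewrite -[X in _ * X]subr0; apply: Int_le_cst; [exact: pi_ge0|exact: jcont_r|].
by move=> al; exact: h.
Qed.

Lemma jcontM f g : jcont f -> jcont g -> jcont (fun ph al => f ph al * g ph al).
Proof. by move=> cf cg p; apply: cvgM; [exact: cf|exact: cg]. Qed.
Lemma jcontD f g : jcont f -> jcont g -> jcont (fun ph al => f ph al + g ph al).
Proof. by move=> cf cg p; apply: cvgD; [exact: cf|exact: cg]. Qed.
Lemma jcontB f g : jcont f -> jcont g -> jcont (fun ph al => f ph al - g ph al).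
Proof. by move=> cf cg p; apply: cvgB; [exact: cf|exact: cg]. Qed.
Lemma jcont_cst (k : R) : jcont (fun _ _ => k).
Proof. by move=> p; exact: cvg_cst. Qed.
Lemma jcont_fst (h : R -> R) : continuous h -> jcont (fun ph _ => h ph).
Proof. by move=> ch p; apply: (@continuous_comp _ _ _ fst h); [exact: cvg_fst|exact: ch]. Qed.
Lemma jcont_snd (h : R -> R) : continuous h -> jcont (fun _ al => h al).
Proof. by move=> ch p; apply: (@continuous_comp _ _ _ snd h); [exact: cvg_snd|exact: ch]. Qed.

Lemma der_dblInt (F f : R -> R -> R -> R) (J : set R) (r0 : R) : open J -> J r0 ->
  (forall r, J r -> jcont (F r)) ->
  (forall r ph al, J r -> is_derive r 1 (fun r => F r ph al) (f r ph al)) ->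
  (forall p : R * R * R, J p.1.1 -> {for p, continuous (fun p => f p.1.1 p.1.2 p.2)}) ->
  is_derive r0 1 (fun r => dblInt (F r)) (dblInt (f r0)).
Proof.
move=> oJ Jr0 cF dF cf.
have cfr r : J r -> jcont (f r).
  move=> Jr p; apply: (@continuous_comp _ _ _ (fun p : R * R => (r, p.1, p.2)) (fun p => f p.1.1 p.1.2 p.2)); last exact: cf.
  apply: continuous_pair; last exact: cvg_snd.
  by apply: continuous_pair; [exact: cvg_cst|exact: cvg_fst].
apply: (@is_derive_Int R (fun r ph => Int 0 pi (F r ph)) (fun r ph => Int 0 pi (f r ph)) _ _ r0 J) => //.
- by move=> r Jr; apply: jcont_Int; exact: cF.
- move=> r ph Jr; apply: (@is_derive_Int R (fun r al => F r ph al) (fun r al => f r ph al) _ _ r J) => //.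
  + by move=> r' Jr'; apply: jcont_r; exact: cF.
  + move=> r' al Jr'; apply: (@continuous_comp _ _ _ (fun p : R * R => (p.1, ph, p.2)) (fun p => f p.1.1 p.1.2 p.2)); last exact: cf.
    apply: continuous_pair; last exact: cvg_snd.
    by apply: continuous_pair; [exact: cvg_fst|exact: cvg_cst].
- move=> r ph Jr.
  apply: (@continuous_Int R (R * R)%type (fun q al => f q.1 q.2 al)).
    have : nbhs (r, ph) (fun q : R * R => J q.1).
      exists (J, setT); last by move=> q [].
      by split; [exact: open_nbhs_nbhs|exact: filterT].
    by apply: filterS => q Jq; apply: jcont_r; exact: cfr.
  move=> al; apply: (@continuous_comp _ _ _ id (fun p : R * R * R => f p.1.1 p.1.2 p.2)); last exact: cf.
  exact: cvg_id.
Qed.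

End DoubleIntegral.

(** * The radial equation of a Legendre mode *)

Section Spherical.
Variables (R : realType) (U : set 'rV[R]_3) (u : 'rV[R]_3 -> R) (kappa : R).
Hypotheses (oU : open U) (cu : class_C 2 U u).
Hypothesis helm : forall x, U x ->
  \sum_i 'D_('e_ i) ('D_('e_ i) u) x = - kappa ^+ 2 * u x.
Variables (c a b e : 'rV[R]_3).
Hypothesis frame : forall i j : 'I_3,
  a 0 i * a 0 j + b 0 i * b 0 j + e 0 i * e 0 j = (i == j)%:R.

Implicit Types r ph al : R.

(** Polar coordinates with pole [e]: [sphN] is the outward normal, [sphT] its derivative in the
    colatitude [al], and [sphM] the unit tangent in the longitude [ph]. *)
Definition sphN (ph al : R) : 'rV[R]_3 :=
  (sin al * cos ph) *: a + (sin al * sin ph) *: b + cos al *: e.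
Definition sphT (ph al : R) : 'rV[R]_3 :=
  (cos al * cos ph) *: a + (cos al * sin ph) *: b - sin al *: e.
Definition sphM (ph : R) : 'rV[R]_3 := - sin ph *: a + cos ph *: b.
Definition sphX (r ph al : R) : 'rV[R]_3 := c + r *: sphN ph al.

Definition grd (v x : 'rV[R]_3) : R := \sum_i 'D_('e_ i) u x * v 0 i.
Definition hess (v w x : 'rV[R]_3) : R :=
  \sum_i (\sum_j 'D_('e_ j) ('D_('e_ i) u) x * v 0 j) * w 0 i.

Lemma sphN_coord ph al i : sphN ph al 0 i =
  sin al * cos ph * a 0 i + sin al * sin ph * b 0 i + cos al * e 0 i.
Proof. by rewrite !mxE. Qed.
Lemma sphT_coord ph al i : sphT ph al 0 i =
  cos al * cos ph * a 0 i + cos al * sin ph * b 0 i - sin al * e 0 i.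
Proof. by rewrite !mxE. Qed.
Lemma sphM_coord ph i : sphM ph 0 i = - sin ph * a 0 i + cos ph * b 0 i.
Proof. by rewrite !mxE. Qed.
Lemma sphX_coord r ph al i : sphX r ph al 0 i = c 0 i + r * sphN ph al 0 i.
Proof. by rewrite !mxE. Qed.

Lemma sph_frame ph al i j : sphN ph al 0 i * sphN ph al 0 j +
  sphT ph al 0 i * sphT ph al 0 j + sphM ph 0 i * sphM ph 0 j = (i == j)%:R.
Proof.
rewrite -frame !sphN_coord !sphT_coord !sphM_coord.
have h1 := cos2Dsin2 al; have h2 := cos2Dsin2 ph.
transitivity ((cos al ^+ 2 + sin al ^+ 2) * (cos ph ^+ 2 * (a 0 i * a 0 j) + sin ph ^+ 2 * (b 0 i * b 0 j)
   + cos ph * sin ph * (a 0 i * b 0 j + a 0 j * b 0 i) + e 0 i * e 0 j) +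
   sin ph ^+ 2 * (a 0 i * a 0 j) + cos ph ^+ 2 * (b 0 i * b 0 j) - cos ph * sin ph * (a 0 i * b 0 j + a 0 j * b 0 i)); first ring.
rewrite h1 mul1r.
transitivity ((cos ph ^+ 2 + sin ph ^+ 2) * (a 0 i * a 0 j + b 0 i * b 0 j) + e 0 i * e 0 j); first ring.
by rewrite h2 mul1r.
Qed.

(** The Laplacian is the trace of the Hessian, which can be computed in any orthonormal frame, here
    the moving one of the sphere. *)
Lemma hess_trace x ph al : U x ->
  hess (sphN ph al) (sphN ph al) x + hess (sphT ph al) (sphT ph al) x
   + hess (sphM ph) (sphM ph) x = - kappa ^+ 2 * u x.
Proof.
move=> Ux; rewrite -helm// /hess -!big_split/=; apply: eq_bigr => i _.
rewrite !mulr_suml -!big_split/= (bigD1 i)//= big1 ?addr0 => [|j ji].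
  by rewrite -!mulrA -!mulrDr sph_frame eqxx mulr1.
by rewrite -!mulrA -!mulrDr sph_frame (negbTE ji) mulr0.
Qed.

Lemma der_u_curve (g : R -> 'rV[R]_3) (t : R) (d : 'rV[R]_3) : U (g t) ->
  (forall i, is_derive t 1 (fun s => g s 0 i) (d 0 i)) ->
  is_derive t 1 (fun s => u (g s)) (grd d (g t)).
Proof.
move=> Ug dg; apply: (@der_curve _ _ U u g t (fun i => d 0 i)) => //.
case: cu => h1 h2; split=> // i; have [h3 h4] := h2 i; split=> //.
by have [h5 _] := h4; split.
Qed.

Lemma der_grd_curve (g v : R -> 'rV[R]_3) (t : R) (d w : 'rV[R]_3) : U (g t) ->
  (forall i, is_derive t 1 (fun s => g s 0 i) (d 0 i)) ->
  (forall i, is_derive t 1 (fun s => v s 0 i) (w 0 i)) ->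
  is_derive t 1 (fun s => grd (v s) (g s)) (hess d (v t) (g t) + grd w (g t)).
Proof.
move=> Ug dg dv; rewrite /grd /hess -big_split/=.
have hi i : is_derive t 1 (fun s => 'D_('e_ i) u (g s) * v s 0 i)
   ((\sum_j 'D_('e_ j) ('D_('e_ i) u) (g t) * d 0 j) * v t 0 i + 'D_('e_ i) u (g t) * w 0 i).
  apply: derM (dv i).
  apply: (@der_curve _ _ U _ g t (fun j => d 0 j)) => //.
  by have [_ /(_ i)[]] := cu.
rewrite (_ : (fun s => _) = \sum_(i < 3) (fun s => 'D_('e_ i) u (g s) * v s 0 i)).
  exact: is_derive_sum.
by apply/funext => s; rewrite fct_sumE.
Qed.

Lemma grd_lin (k l : R) v w x : grd (k *: v + l *: w) x = k * grd v x + l * grd w x.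
Proof.
rewrite /grd !mulr_sumr -big_split/=; apply: eq_bigr => i _; rewrite !mxE; ring.
Qed.
Lemma grd0 x : grd 0 x = 0.
Proof. by rewrite /grd big1// => i _; rewrite mxE mulr0. Qed.
Lemma grdZ (k : R) v x : grd (k *: v) x = k * grd v x.
Proof. by rewrite /grd !mulr_sumr; apply: eq_bigr => i _; rewrite !mxE; ring. Qed.
Lemma hessZ (k : R) v w x : hess (k *: v) w x = k * hess v w x.
Proof.
rewrite /hess !mulr_sumr; apply: eq_bigr => i _; rewrite mulrA; congr (_ * _).
by rewrite mulr_sumr; apply: eq_bigr => j _; rewrite !mxE; ring.
Qed.

Lemma der_sphX_r r ph al i : is_derive r 1 (fun s => sphX s ph al 0 i) (sphN ph al 0 i).
Proof.
apply: (@der_ext _ (fun s => c 0 i + s * sphN ph al 0 i)); first by near=> s; rewrite sphX_coord.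
apply: (is_derive_eq (derD (der_cst _ _) (derM (is_derive_id _ _) (der_cst _ _)))).
by rewrite mulr0 addr0 mul1r add0r.
Unshelve. all: by end_near. Qed.

Lemma der_sphN_al ph al i : is_derive al 1 (fun s => sphN ph s 0 i) (sphT ph al 0 i).
Proof.
apply: (@der_ext _ (fun s => sin s * (cos ph * a 0 i + sin ph * b 0 i) + cos s * e 0 i)).
  by near=> s; rewrite sphN_coord; ring.
apply: (is_derive_eq (derD (derM (is_derive_sin _) (der_cst _ _)) (derM (is_derive_cos _) (der_cst _ _)))).
rewrite sphT_coord; ring.
Unshelve. all: by end_near. Qed.

Lemma der_sphT_al ph al i : is_derive al 1 (fun s => sphT ph s 0 i) ((- sphN ph al) 0 i).
Proof.
apply: (@der_ext _ (fun s => cos s * (cos ph * a 0 i + sin ph * b 0 i) - sin s * e 0 i)).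
  by near=> s; rewrite sphT_coord; ring.
apply: (is_derive_eq (derB (derM (is_derive_cos _) (der_cst _ _)) (derM (is_derive_sin _) (der_cst _ _)))).
rewrite mxE sphN_coord; ring.
Unshelve. all: by end_near. Qed.

Lemma der_sphX_al r ph al i : is_derive al 1 (fun s => sphX r ph s 0 i) ((r *: sphT ph al) 0 i).
Proof.
apply: (@der_ext _ (fun s => c 0 i + r * sphN ph s 0 i)); first by near=> s; rewrite sphX_coord.
apply: (is_derive_eq (derD (der_cst _ _) (derZ _ (der_sphN_al _ _ _)))).
by rewrite [RHS]mxE add0r.
Unshelve. all: by end_near. Qed.

Lemma der_sphX_ph r ph al i :
  is_derive ph 1 (fun s => sphX r s al 0 i) (((r * sin al) *: sphM ph) 0 i).
Proof.
apply: (@der_ext _ (fun s => (c 0 i + r * cos al * e 0 i) + ((r * sin al * a 0 i) * cos s + (r * sin al * b 0 i) * sin s))).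
  by near=> s; rewrite sphX_coord sphN_coord; ring.
apply: (is_derive_eq (derD (der_cst _ _) (derD (derZ _ (is_derive_cos _)) (derZ _ (is_derive_sin _))))).
rewrite mxE sphM_coord; ring.
Unshelve. all: by end_near. Qed.

(** The derivative is the inward horizontal vector, independent of [al]. It is written in the frame
    at colatitude [al] so that it recombines with the normal and tangential derivatives there. *)
Lemma der_sphM_ph ph al i : is_derive ph 1 (fun s => sphM s 0 i)
  ((- sin al *: sphN ph al + - cos al *: sphT ph al) 0 i).
Proof.
apply: (@der_ext _ (fun s => b 0 i * cos s - a 0 i * sin s)).
  by near=> s; rewrite sphM_coord; ring.
apply: (is_derive_eq (derB (derZ _ (is_derive_cos _)) (derZ _ (is_derive_sin _)))).
rewrite !mxE.
transitivity (- (cos al ^+ 2 + sin al ^+ 2) * (cos ph * a 0 i + sin ph * b 0 i)); last ring.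
by rewrite cos2Dsin2; ring.
Unshelve. all: by end_near. Qed.

Lemma der_u_r r ph al : U (sphX r ph al) ->
  is_derive r 1 (fun s => u (sphX s ph al)) (grd (sphN ph al) (sphX r ph al)).
Proof. by move=> Ux; apply: der_u_curve => // i; exact: der_sphX_r. Qed.

Lemma der_grd_r r ph al : U (sphX r ph al) ->
  is_derive r 1 (fun s => grd (sphN ph al) (sphX s ph al))
    (hess (sphN ph al) (sphN ph al) (sphX r ph al)).
Proof.
move=> Ux; apply: is_derive_eq.
  apply: (@der_grd_curve (fun s => sphX s ph al) (fun=> sphN ph al) r (sphN ph al) 0) => // i.
    exact: der_sphX_r.
  by rewrite [X in is_derive _ _ _ X]mxE; exact: der_cst.
by rewrite grd0 addr0.
Qed.

Lemma der_u_al r ph al : U (sphX r ph al) ->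
  is_derive al 1 (fun s => u (sphX r ph s)) (r * grd (sphT ph al) (sphX r ph al)).
Proof.
by move=> Ux; rewrite -grdZ; apply: der_u_curve => // i; exact: der_sphX_al.
Qed.

Lemma der_grd_al r ph al : U (sphX r ph al) ->
  is_derive al 1 (fun s => grd (sphT ph s) (sphX r ph s))
    (r * hess (sphT ph al) (sphT ph al) (sphX r ph al) - grd (sphN ph al) (sphX r ph al)).
Proof.
move=> Ux; apply: is_derive_eq.
  apply: (@der_grd_curve (sphX r ph) (sphT ph) al (r *: sphT ph al) (- sphN ph al)) => // i.
    exact: der_sphX_al.
  exact: der_sphT_al.
by rewrite hessZ -scaleN1r grdZ mulN1r.
Qed.

Lemma der_grd_ph r ph al : U (sphX r ph al) ->
  is_derive ph 1 (fun s => grd (sphM s) (sphX r s al))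
    (r * sin al * hess (sphM ph) (sphM ph) (sphX r ph al)
     - sin al * grd (sphN ph al) (sphX r ph al) - cos al * grd (sphT ph al) (sphX r ph al)).
Proof.
move=> Ux; apply: is_derive_eq.
  apply: (@der_grd_curve (fun s => sphX r s al) sphM ph ((r * sin al) *: sphM ph)
    (- sin al *: sphN ph al + - cos al *: sphT ph al)) => // i.
    exact: der_sphX_ph.
  exact: der_sphM_ph.
by rewrite hessZ grd_lin; ring.
Qed.


Variable J : set R.
Hypotheses (oJ : open J) (JU : forall r ph al, J r -> U (sphX r ph al)).
Variable l : nat.

Lemma continuous_sphX : continuous (fun p : R * R * R => sphX p.1.1 p.1.2 p.2).
Proof.
have c1 : continuous (fun p : R * R * R => p.1.1).
  by move=> p; apply: (@continuous_comp _ _ _ fst fst); exact: cvg_fst.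
have c2 : continuous (fun p : R * R * R => p.1.2).
  by move=> p; apply: (@continuous_comp _ _ _ fst snd); [exact: cvg_fst|exact: cvg_snd].
have c3 : continuous (fun p : R * R * R => p.2) by move=> p; exact: cvg_snd.
have cs (h : R * R * R -> R) : continuous h -> continuous (fun p => sin (h p)).
  by move=> ch p; apply: continuous_comp; [exact: ch|exact: continuous_sin].
have cc (h : R * R * R -> R) : continuous h -> continuous (fun p => cos (h p)).
  by move=> ch p; apply: continuous_comp; [exact: ch|exact: continuous_cos].
move=> p; apply: cvgD; first exact: cvg_cst.
apply: cvgZ; first exact: c1.
apply: cvgD; last by apply: cvgZr_tmp; exact: cc.
by apply: cvgD; apply: cvgZr_tmp; apply: cvgM; [exact: cs|exact: cc|exact: cs|exact: cs].
Qed.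

Lemma continuous_sphN i : continuous (fun p : R * R * R => sphN p.1.2 p.2 0 i).
Proof.
have c2 : continuous (fun p : R * R * R => p.1.2).
  by move=> p; apply: (@continuous_comp _ _ _ fst snd); [exact: cvg_fst|exact: cvg_snd].
have c3 : continuous (fun p : R * R * R => p.2) by move=> p; exact: cvg_snd.
have cs (h : R * R * R -> R) : continuous h -> continuous (fun p => sin (h p)).
  by move=> ch p; apply: continuous_comp; [exact: ch|exact: continuous_sin].
have cc (h : R * R * R -> R) : continuous h -> continuous (fun p => cos (h p)).
  by move=> ch p; apply: continuous_comp; [exact: ch|exact: continuous_cos].
under eq_fun do rewrite sphN_coord.
move=> p; apply: cvgD.
  by apply: cvgD; apply: cvgM; do ?exact: cvg_cst; apply: cvgM; [exact: cs|exact: cc|exact: cs|exact: cs].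
by apply: cvgM; [exact: cc|exact: cvg_cst].
Qed.

Lemma continuous_at_grd (T : topologicalType) (x v : T -> 'rV[R]_3) (p : T) :
  U (x p) -> {for p, continuous x} -> (forall i, {for p, continuous (fun p => v p 0 i)}) ->
  {for p, continuous (fun p => grd (v p) (x p))}.
Proof.
move=> Ux cx cv; apply: cvg_sumr => i; apply: cvgM; last exact: cv.
by have [_ /(_ i)[_ [h _]]] := cu; exact: (cvg_comp _ _ cx (h _ Ux)).
Qed.

Lemma continuous_at_hess (T : topologicalType) (x v w : T -> 'rV[R]_3) (p : T) :
  U (x p) -> {for p, continuous x} -> (forall i, {for p, continuous (fun p => v p 0 i)}) ->
  (forall i, {for p, continuous (fun p => w p 0 i)}) ->
  {for p, continuous (fun p => hess (v p) (w p) (x p))}.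
Proof.
move=> Ux cx cv cw; apply: cvg_sumr => i; apply: cvgM; last exact: cw.
apply: cvg_sumr => j; apply: cvgM; last exact: cv.
by have [_ /(_ i)[_ [_ /(_ j)[_ [h _]]]]] := cu; exact: (cvg_comp _ _ cx (h _ Ux)).
Qed.

Let w (al : R) : R := legcos l al * sin al.

(** Integrands of the [l]-th mode of [u] and of its first two radial derivatives. The weight [w]
    carries the Jacobian [sin al] but no power of [r], so the mode also makes sense at [r = 0] and
    for negative [r]. *)
Definition sphA0 r ph al := u (sphX r ph al) * w al.
Definition sphA1 r ph al := grd (sphN ph al) (sphX r ph al) * w al.
Definition sphA2 r ph al := hess (sphN ph al) (sphN ph al) (sphX r ph al) * w al.

Let cw : continuous w.
Proof. by move=> x; apply: cvgM; [exact: continuous_polycos|exact: continuous_sin]. Qed.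

Let cw3 : continuous (fun p : R * R * R => w p.2).
Proof. by move=> p; apply: (@continuous_comp _ _ _ snd w); [exact: cvg_snd|exact: cw]. Qed.

Let cA0 (p : R * R * R) : J p.1.1 -> {for p, continuous (fun p => sphA0 p.1.1 p.1.2 p.2)}.
Proof.
move=> Jp; have h := @continuous_comp _ _ _ (fun p : R * R * R => sphX p.1.1 p.1.2 p.2) u p
  (@continuous_sphX p) (cu.1 _ (JU p.1.2 p.2 Jp)).
by apply: cvgM; [exact: h|exact: cw3].
Qed.

Let cA1 (p : R * R * R) : J p.1.1 -> {for p, continuous (fun p => sphA1 p.1.1 p.1.2 p.2)}.
Proof.
move=> Jp; have h := @continuous_at_grd _ (fun p : R * R * R => sphX p.1.1 p.1.2 p.2)
  (fun p => sphN p.1.2 p.2) p (JU p.1.2 p.2 Jp) (@continuous_sphX p)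
  (fun i => @continuous_sphN i p).
by apply: cvgM; [exact: h|exact: cw3].
Qed.

Let cA2 (p : R * R * R) : J p.1.1 -> {for p, continuous (fun p => sphA2 p.1.1 p.1.2 p.2)}.
Proof.
move=> Jp; have h := @continuous_at_hess _ (fun p : R * R * R => sphX p.1.1 p.1.2 p.2)
  (fun p => sphN p.1.2 p.2) (fun p => sphN p.1.2 p.2) p (JU p.1.2 p.2 Jp) (@continuous_sphX p)
  (fun i => @continuous_sphN i p) (fun i => @continuous_sphN i p).
by apply: cvgM; [exact: h|exact: cw3].
Qed.

Lemma jcont_slice (f : R -> R -> R -> R) r : J r ->
  (forall p : R * R * R, J p.1.1 -> {for p, continuous (fun p => f p.1.1 p.1.2 p.2)}) ->
  jcont (f r).
Proof.
move=> Jr cf p; apply: (@continuous_comp _ _ _ (fun p : R * R => (r, p.1, p.2)) (fun p => f p.1.1 p.1.2 p.2)); last exact: cf.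
apply: continuous_pair; last exact: cvg_snd.
by apply: continuous_pair; [exact: cvg_cst|exact: cvg_fst].
Qed.

Lemma der_sphA0 r : J r -> is_derive r 1 (fun r => dblInt (sphA0 r)) (dblInt (sphA1 r)).
Proof.
move=> Jr; apply: (@der_dblInt _ sphA0 sphA1 J) => //.
- by move=> s Js; apply: jcont_slice Js cA0.
- move=> s ph al Js; apply: (is_derive_eq (derM (der_u_r (JU _ _ Js)) (der_cst _ _))).
by rewrite mulr0 addr0.
Qed.

Lemma der_sphA1 r : J r -> is_derive r 1 (fun r => dblInt (sphA1 r)) (dblInt (sphA2 r)).
Proof.
move=> Jr; apply: (@der_dblInt _ sphA1 sphA2 J) => //.
- by move=> s Js; apply: jcont_slice Js cA1.
- move=> s ph al Js; apply: (is_derive_eq (derM (der_grd_r (JU _ _ Js)) (der_cst _ _))).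
by rewrite mulr0 addr0.
Qed.

(** Replace the second normal derivative by the two tangential ones through [hess_trace]. The
    longitude part is an exact derivative of a periodic function; the colatitude part, integrated by
    parts twice against P_l, gives the eigenvalue l (l + 1) by the Legendre equation. *)
Lemma sphA_ode r : J r -> r ^+ 2 * dblInt (sphA2 r) =
  ((l * l.+1)%:R - kappa ^+ 2 * r ^+ 2) * dblInt (sphA0 r) - 2 * r * dblInt (sphA1 r).
Proof.
move=> Jr.
pose X ph al := sphX r ph al.
have UX ph al : U (X ph al) by exact: JU.
pose lam : R := (l * l.+1)%:R.
pose gN ph al := grd (sphN ph al) (X ph al).
pose gT ph al := grd (sphT ph al) (X ph al).
pose hT ph al := hess (sphT ph al) (sphT ph al) (X ph al).
pose hM ph al := hess (sphM ph) (sphM ph) (X ph al).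
(* [P] is the [ph]-derivative of [r * grd sphM], and [D] the [al]-derivative of [sin al * (r * gT)].
   Their sum is [sin al * (r ^+ 2 * (hT + hM) - 2 * r * gN)], so nothing has to be divided by
   [sin al]. *)
pose P ph al := r * (r * sin al * hM ph al - sin al * gN ph al - cos al * gT ph al).
pose D ph al := cos al * (r * gT ph al) + sin al * (r * (r * hT ph al - gN ph al)).
have cX : continuous (fun p : R * R => X p.1 p.2).
  move=> p; apply: (@continuous_comp _ _ _ (fun p : R * R => (r, p.1, p.2)) (fun p => sphX p.1.1 p.1.2 p.2)); last exact: continuous_sphX.
  apply: continuous_pair; last exact: cvg_snd.
  by apply: continuous_pair; [exact: cvg_cst|exact: cvg_fst].
have js := jcont_snd (@continuous_sin R); have jc := jcont_snd (@continuous_cos R).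
have jsp := jcont_fst (@continuous_sin R); have jcp := jcont_fst (@continuous_cos R).
have jN i : jcont (fun ph al => sphN ph al 0 i).
  rewrite /jcont; under eq_fun do rewrite sphN_coord.
  apply: (@jcontD _ (fun ph al => sin al * cos ph * a 0 i + sin al * sin ph * b 0 i) (fun ph al => cos al * e 0 i)).
    apply: (@jcontD _ (fun ph al => sin al * cos ph * a 0 i) (fun ph al => sin al * sin ph * b 0 i)).
      by apply: jcontM; [exact: jcontM|exact: jcont_cst].
    by apply: jcontM; [exact: jcontM|exact: jcont_cst].
  by apply: jcontM => //; exact: jcont_cst.
have jT i : jcont (fun ph al => sphT ph al 0 i).
  rewrite /jcont; under eq_fun do rewrite sphT_coord.
  apply: (@jcontB _ (fun ph al => cos al * cos ph * a 0 i + cos al * sin ph * b 0 i) (fun ph al => sin al * e 0 i)).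
    apply: (@jcontD _ (fun ph al => cos al * cos ph * a 0 i) (fun ph al => cos al * sin ph * b 0 i)).
      by apply: jcontM; [exact: jcontM|exact: jcont_cst].
    by apply: jcontM; [exact: jcontM|exact: jcont_cst].
  by apply: jcontM => //; exact: jcont_cst.
have jM i : jcont (fun ph al => sphM ph 0 i).
  rewrite /jcont; under eq_fun do rewrite sphM_coord mulNr mulrC [_ * b _ _]mulrC addrC.
  apply: (@jcontB _ (fun ph al => b 0 i * cos ph) (fun ph al => a 0 i * sin ph)).
    by apply: jcontM => //; exact: jcont_cst.
  by apply: jcontM => //; exact: jcont_cst.
have jgN : jcont gN.
  move=> p; apply: (@continuous_at_grd _ (fun p : R * R => X p.1 p.2) (fun p => sphN p.1 p.2) p) => [||i].
  - exact: UX.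
  - exact: cX.
  - exact: (jN i p).
have jgT : jcont gT.
  move=> p; apply: (@continuous_at_grd _ (fun p : R * R => X p.1 p.2) (fun p => sphT p.1 p.2) p) => [||i].
  - exact: UX.
  - exact: cX.
  - exact: (jT i p).
have jhT : jcont hT.
  move=> p; apply: (@continuous_at_hess _ (fun p : R * R => X p.1 p.2) (fun p => sphT p.1 p.2) (fun p => sphT p.1 p.2) p) => [||i|i].
  - exact: UX.
  - exact: cX.
  - exact: (jT i p).
  - exact: (jT i p).
have jhM : jcont hM.
  move=> p; apply: (@continuous_at_hess _ (fun p : R * R => X p.1 p.2) (fun p => sphM p.1) (fun p => sphM p.1) p) => [||i|i].
  - exact: UX.
  - exact: cX.
  - exact: (jM i p).
  - exact: (jM i p).
have jk (k : R) := @jcont_cst R k.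
have jP : jcont P.
  apply: jcontM => //; apply: jcontB; last exact: jcontM.
  apply: jcontB; last exact: jcontM.
  by apply: jcontM => //; apply: jcontM.
have jD : jcont D.
  apply: jcontD; apply: jcontM => //; apply: jcontM => //.
  by apply: jcontB => //; apply: jcontM.
have jL : jcont (fun _ al => legcos l al) by apply: jcont_snd; exact: continuous_polycos.
have jA0 : jcont (sphA0 r) by exact: jcont_slice Jr cA0.
have jA1 : jcont (sphA1 r) by exact: jcont_slice Jr cA1.
have jA2 : jcont (sphA2 r) by exact: jcont_slice Jr cA2.
have hD : dblInt (fun ph al => D ph al * legcos l al + lam * sphA0 r ph al) = 0.
  rewrite /dblInt -[RHS](mulr0 (0 : R)) -{2}(subr0 (0 : R)).
  rewrite (@eq_Int _ _ _ _ (fun=> 0)) ?Int_cst ?mul0r ?subr0//; first exact: pi2_ge0.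
  move=> ph _.
  pose q : {poly R} := (1 - 'X^2) * (legendre R l)^`().
  have dq al : is_derive al 1 (fun al => q.[cos al]) (sin al * (lam * legcos l al)).
    apply: (is_derive_eq (der_polycos q al)).
    by rewrite /q legendre_ode hornerN hornerZ -/lam /legcos; ring.
  have qE al : q.[cos al] = sin al ^+ 2 * ((legendre R l)^`()).[cos al].
    by rewrite /q hornerM hornerD hornerN hornerXn hornerC sin2cos2.
  (* Explicit primitive for both integrations by parts at once: the mixed terms cancel because
     [q.[cos al]] is [sin al ^+ 2] times the derivative of P_l, and every term vanishes at both
     poles. *)
  pose Z al := sin al * (r * gT ph al) * legcos l al + u (X ph al) * q.[cos al].
  have dZ al : is_derive al 1 Z (D ph al * legcos l al + lam * sphA0 r ph al).
    apply: (is_derive_eq (derD (derM (derM (is_derive_sin _) (derZ r (der_grd_al (UX ph al)))) (der_polycos _ _))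
      (derM (der_u_al (UX ph al)) (dq al)))).
    by rewrite qE /D /sphA0 /w /legcos -/(gT ph al) -/(hT ph al) -/(gN ph al) -/(X ph al); ring.
  rewrite (FTC2 (pi_ge0 R) _ dZ).
    by rewrite /Z !qE sinpi sin0; ring.
  apply: (@jcont_r _ (fun ph al => D ph al * legcos l al + lam * sphA0 r ph al)).
  by apply: jcontD; apply: jcontM.
have hP : dblInt (fun ph al => P ph al * legcos l al) = 0.
  rewrite dblInt_swap; last exact: jcontM.
  rewrite (@eq_Int _ _ _ _ (fun=> 0)) ?Int_cst ?mul0r ?pi_ge0//.
  move=> al _.
  have dP ph : is_derive ph 1 (fun ph => r * legcos l al * grd (sphM ph) (X ph al)) (P ph al * legcos l al).
    apply: (is_derive_eq (derZ (r * legcos l al) (der_grd_ph (UX ph al)))).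
    by rewrite /P -/(gT ph al) -/(hM ph al) -/(gN ph al); ring.
  rewrite (FTC2 (pi2_ge0 R) _ dP); last first.
    by apply: (@jcont_l _ (fun ph al => P ph al * legcos l al)); exact: jcontM.
  have -> : sphM (pi *+ 2) = sphM 0 by rewrite /sphM cos2pi sin2pi cos0 sin0.
  have -> : X (pi *+ 2) al = X 0 al by rewrite /X /sphX /sphN cos2pi sin2pi cos0 sin0.
  by rewrite subrr.
have key : dblInt (fun ph al => r ^+ 2 * sphA2 r ph al + (2 * r) * sphA1 r ph al) =
    dblInt (fun ph al => (lam - kappa ^+ 2 * r ^+ 2) * sphA0 r ph al +
      (- 1 * (D ph al * legcos l al + lam * sphA0 r ph al) + -1 * (P ph al * legcos l al))).
  apply: eq_dblInt => ph al.
  have h := hess_trace ph al (UX ph al).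
  have -> : sphA2 r ph al = (- kappa ^+ 2 * u (X ph al) - hT ph al - hM ph al) * w al.
    by rewrite -h /sphA2 /hT /hM -/(X ph al); ring.
  by rewrite /D /P /sphA1 /sphA0 /w -/(X ph al) -/(gN ph al); ring.
move: key; rewrite dblIntD; [|exact: jcontM|exact: jcontM].
rewrite dblIntZ// dblIntZ// dblIntD; last first.
- by apply: jcontD; apply: jcontM => //; [apply: jcontD; apply: jcontM|apply: jcontM].
- exact: jcontM.
rewrite dblIntZ// dblIntD; last first.
- by apply: jcontM => //; apply: jcontM.
- by apply: jcontM => //; apply: jcontD; apply: jcontM.
rewrite dblIntZ; last by apply: jcontD; apply: jcontM.
rewrite dblIntZ; last by apply: jcontM.
rewrite hD hP -/lam => e1; apply: (addIr (2 * r * dblInt (sphA1 r))).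
by rewrite e1; ring.
Qed.

End Spherical.

(** * Germs of power series *)

Section Germs.
Variable R : realType.
Implicit Types (f g : R -> R) (a b : nat -> R) (A B C s t d : R) (N m : nat).

Definition psum a N t : R := \sum_(0 <= m < N) a m * t ^+ m.

(* [f] agrees on ]0, d] with the sum of the power series of coefficients [a]. *)
Definition germ f a A s d : Prop :=
  [/\ 0 <= A, 0 < s, s * d <= 2^-1, (forall m, `|a m| <= A * s ^+ m)
    & forall N t, 0 < t <= d -> `|f t - psum a N t| <= A * (s * t) ^+ N].

Definition agerm f d : Prop := exists a A s, germ f a A s d.

Lemma agerm_sub f d d' : d' <= d -> agerm f d -> agerm f d'.
Proof.
move=> dd [a [A [s [A0 s0 sd ha hf]]]]; exists a, A, s; split=> //.
  by apply: le_trans sd; rewrite ler_pM2l.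
by move=> N t /andP[t0 td]; apply: hf; rewrite t0 (le_trans td).
Qed.

Lemma agerm_ext f g d : (forall t, 0 < t <= d -> f t = g t) -> agerm f d -> agerm g d.
Proof.
move=> fg [a [A [s [A0 s0 sd ha hf]]]]; exists a, A, s; split=> // N t td.
by rewrite -fg// hf.
Qed.

Lemma agermD f g d : 0 < d -> agerm f d -> agerm g d -> agerm (fun t => f t + g t) d.
Proof.
move=> d0 [a [A [s [A0 s0 sd ha hf]]]] [b [B [r [B0 r0 rd hb hg]]]].
pose q := Num.max s r.
have sq : s <= q by rewrite le_max lexx.
have rq : r <= q by rewrite le_max lexx orbT.
have q0 : 0 < q by apply: lt_le_trans sq.
exists (fun m => a m + b m), (A + B), q; split=> //.
- by rewrite addr_ge0.
- by rewrite /q /Num.max; case: ifP.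
- move=> m; rewrite mulrDl; apply: le_trans (ler_normD _ _) _; apply: lerD.
    by apply: le_trans (ha m) _; rewrite ler_wpM2l// lerXn2r// nnegrE ltW.
  by apply: le_trans (hb m) _; rewrite ler_wpM2l// lerXn2r// nnegrE ltW.
- move=> N t /andP[t0 td].
  have -> : f t + g t - psum (fun m => a m + b m) N t = (f t - psum a N t) + (g t - psum b N t).
    rewrite /psum; under [X in _ - X]eq_bigr do rewrite mulrDl.
    by rewrite big_split/=; ring.
  rewrite mulrDl; apply: le_trans (ler_normD _ _) _; apply: lerD.
    apply: le_trans (hf N t _) _; first by rewrite t0.
    by rewrite ler_wpM2l// lerXn2r// ?nnegrE ?ler_pM2r// ltW// mulr_gt0.
  apply: le_trans (hg N t _) _; first by rewrite t0.
  by rewrite ler_wpM2l// lerXn2r// ?nnegrE ?ler_pM2r// ltW// mulr_gt0.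
Qed.

Lemma agermZ k f d : agerm f d -> agerm (fun t => k * f t) d.
Proof.
move=> [a [A [s [A0 s0 sd ha hf]]]]; exists (fun m => k * a m), (`|k| * A), s; split=> //.
- by rewrite mulr_ge0.
- by move=> m; rewrite normrM -mulrA ler_wpM2l.
- move=> N t td; have -> : psum (fun m => k * a m) N t = k * psum a N t.
    by rewrite /psum mulr_sumr; apply: eq_bigr => i _; rewrite mulrA.
  by rewrite -mulrBr normrM -mulrA ler_wpM2l// hf.
Qed.

Lemma agermB f g d : 0 < d -> agerm f d -> agerm g d -> agerm (fun t => f t - g t) d.
Proof.
move=> d0 hf /(agermZ (-1)) hg; have := agermD d0 hf hg.
by apply: agerm_ext => t _; rewrite mulN1r.
Qed.

Lemma psum_le a A s d N t : 0 <= A -> 0 < s -> s * d <= 2^-1 ->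
  (forall m, `|a m| <= A * s ^+ m) -> 0 < t <= d -> `|psum a N t| <= 2 * A.
Proof.
move=> A0 s0 sd ha /andP[t0 td].
have x0 : 0 <= s * t by rewrite mulr_ge0// ltW.
have x2 : s * t <= 2^-1 by apply: le_trans sd; rewrite ler_pM2l.
rewrite /psum; apply: le_trans (ler_norm_sum _ _ _) _.
apply: (@le_trans _ _ (\sum_(0 <= m < N) A * (s * t) ^+ m)).
  apply: ler_sum => m _; rewrite normrM exprMn mulrA (ger0_norm (exprn_ge0 _ (ltW t0))).
  by rewrite ler_wpM2r// exprn_ge0// ltW.
rewrite -mulr_sumr mulrC ler_wpM2r//.
apply: le_trans (sum_geometric_le 0 N (_ : 0 <= s * t < 1)) _.
  by rewrite x0/=; lra.
rewrite expr0 mul1r -[2]invrK lef_pV2 ?posrE ?invr_gt0//; lra.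
Qed.

(** Cauchy product. Its [m]-th coefficient has [m + 1] terms, and bounding [m + 1] by [2 ^ m]
    doubles the rate [s] and so halves the interval. *)
Lemma agermM f g d : 0 < d -> agerm f d -> agerm g d -> agerm (fun t => f t * g t) (d / 2).
Proof.
move=> d0 hf hg.
have [a [A [s1 [A0 s10 s1d ha1 hf1]]]] := hf.
have [b [B [s2 [B0 s20 s2d hb2 hg2]]]] := hg.
pose s := Num.max s1 s2.
have s1s : s1 <= s by rewrite le_max lexx.
have s2s : s2 <= s by rewrite le_max lexx orbT.
have s0 : 0 < s by apply: lt_le_trans s1s.
have sd : s * d <= 2^-1 by rewrite /s /Num.max; case: ifP.
have ha m : `|a m| <= A * s ^+ m.
  by apply: le_trans (ha1 m) _; rewrite ler_wpM2l// lerXn2r// nnegrE ltW.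
have hb m : `|b m| <= B * s ^+ m.
  by apply: le_trans (hb2 m) _; rewrite ler_wpM2l// lerXn2r// nnegrE ltW.
have hfN N t : 0 < t <= d -> `|f t - psum a N t| <= A * (s * t) ^+ N.
  move=> td; have /andP[t0 _] := td; apply: le_trans (hf1 N t td) _.
  by rewrite ler_wpM2l// lerXn2r// ?nnegrE ?ler_pM2r// ltW// mulr_gt0.
have hgN N t : 0 < t <= d -> `|g t - psum b N t| <= B * (s * t) ^+ N.
  move=> td; have /andP[t0 _] := td; apply: le_trans (hg2 N t td) _.
  by rewrite ler_wpM2l// lerXn2r// ?nnegrE ?ler_pM2r// ltW// mulr_gt0.
pose c m := \sum_(i < m.+1) a i * b (m - i)%N.
have AB0 : 0 <= A * B by rewrite mulr_ge0.
have hprod (p q : nat -> R) m : (forall m, `|p m| <= A * s ^+ m) -> (forall m, `|q m| <= B * s ^+ m) ->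
    `|\sum_(i < m.+1) p i * q (m - i)%N| <= A * B * (2 * s) ^+ m.
  move=> hp hq; apply: le_trans (ler_norm_sum _ _ _) _.
  apply: (@le_trans _ _ (\sum_(i < m.+1) A * B * s ^+ m)).
    apply: ler_sum => i _; rewrite normrM.
    have -> : A * B * s ^+ m = (A * s ^+ i) * (B * s ^+ (m - i)).
      by rewrite mulrACA -exprD subnKC// -ltnS.
    exact: ler_pM.
  rewrite sumr_const card_ord -[leLHS]mulr_natr exprMn -[leLHS]mulrA ler_wpM2l// mulrC.
  rewrite ler_wpM2r ?exprn_ge0 ?(ltW s0)//.
  by rewrite -natrX ler_nat ltn_expl.
exists c, (7 * (A * B)), (2 * s); split.
- by rewrite mulr_ge0.
- by rewrite mulr_gt0.
- by have -> : 2 * s * (d / 2) = s * d by field.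
- move=> m; apply: le_trans (hprod _ _ m ha hb) _.
  by rewrite ler_wpM2r ?exprn_ge0 ?mulr_ge0 ?(ltW s0)//; lra.
move=> N t /andP[t0 td2].
have td : 0 < t <= d by rewrite t0/=; lra.
pose x := s * t.
have x0 : 0 < x by rewrite mulr_gt0.
have x4 : x <= 4^-1.
  apply: (@le_trans _ _ (s * d / 2)); last by lra.
  by rewrite -mulrA ler_pM2l.
pose P : {poly R} := \poly_(i < N) a i; pose Q : {poly R} := \poly_(i < N) b i.
have PE : P.[t] = psum a N t by rewrite horner_poly /psum big_mkord.
have QE : Q.[t] = psum b N t by rewrite horner_poly /psum big_mkord.
have Pc m : `|P`_m| <= A * s ^+ m.
  by rewrite coef_poly; case: ifP => // _; rewrite normr0 mulr_ge0// exprn_ge0// ltW.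
have Qc m : `|Q`_m| <= B * s ^+ m.
  by rewrite coef_poly; case: ifP => // _; rewrite normr0 mulr_ge0// exprn_ge0// ltW.
have PQc m : `|(P * Q)`_m| <= A * B * (2 * s) ^+ m by rewrite coefM; exact: hprod.
have cPQ m : (m < N)%N -> (P * Q)`_m = c m.
  move=> mN; rewrite coefM; apply: eq_bigr => i _.
  have iN : (i < N)%N by apply: leq_ltn_trans mN; rewrite -ltnS ltn_ord.
  have miN : (m - i < N)%N by apply: leq_ltn_trans mN; exact: leq_subr.
  by rewrite !coef_poly iN miN.
have tail : `|psum a N t * psum b N t - psum c N t| <= 2 * (A * B) * (2 * x) ^+ N.
  have sPQ : (size (P * Q)%R <= N + N)%N.
    apply: leq_trans (size_polyMleq _ _) _; apply: leq_trans (leq_pred _) _.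
    by apply: leq_add; exact: size_poly.
  rewrite -PE -QE -hornerM (horner_coef_wide _ sPQ) -(big_mkord xpredT (fun i => (P * Q)`_i * t ^+ i)).
  rewrite (@big_cat_nat _ _ _ N) ?leq_addr//=.
  have -> : psum c N t = \sum_(0 <= i < N) (P * Q)`_i * t ^+ i.
    by apply: eq_big_nat => i /andP[_ iN]; rewrite cPQ.
  rewrite addrAC subrr add0r; apply: le_trans (ler_norm_sum _ _ _) _.
  apply: (@le_trans _ _ (\sum_(N <= i < N + N) A * B * (2 * x) ^+ i)).
    apply: ler_sum => i _; rewrite normrM (ger0_norm (exprn_ge0 _ (ltW t0))).
    rewrite /x mulrA exprMn mulrA ler_wpM2r// exprn_ge0// ltW//.
  rewrite -mulr_sumr.
  have -> : 2 * (A * B) * (2 * x) ^+ N = (A * B) * ((2 * x) ^+ N * 2).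
    by rewrite [2 * (A * B)]mulrC -[LHS]mulrA [2 * _ ^+ N]mulrC.
  apply: ler_wpM2l => //.
  apply: le_trans (sum_geometric_le _ _ (_ : 0 <= 2 * x < 1)) _.
    by rewrite mulr_ge0 ?(ltW x0)//=; lra.
  apply: ler_wpM2l; first by rewrite exprn_ge0// mulr_ge0// ltW.
  rewrite -[leRHS]invrK lef_pV2 ?posrE ?invr_gt0//; lra.
have pb := psum_le N A0 s0 sd ha td; have qb := psum_le N B0 s0 sd hb td.
have fN := hfN N t td; have gN := hgN N t td.
have xN1 : x ^+ N <= 1 by apply: exprn_ile1; [exact: ltW|lra].
have xN0 : 0 <= x ^+ N by rewrite exprn_ge0 ?ltW.
have x2N : x ^+ N <= (2 * x) ^+ N.
  apply: lerXn2r; [exact: ltW|by rewrite nnegrE mulr_ge0// ltW|].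
  by rewrite ler_peMl ?(ltW x0)// ler1n.
have gb : `|g t| <= 3 * B.
  have -> : g t = (g t - psum b N t) + psum b N t by rewrite subrK.
  apply: le_trans (ler_normD _ _) _; have : B * x ^+ N <= B * 1 by rewrite ler_wpM2l.
  by move: gN qb; rewrite -/x; lra.
have -> : f t * g t - psum c N t = (f t - psum a N t) * g t
   + psum a N t * (g t - psum b N t) + (psum a N t * psum b N t - psum c N t) by ring.
apply: le_trans (ler_normD _ _) _.
have h1 : `|(f t - psum a N t) * g t + psum a N t * (g t - psum b N t)| <= 5 * (A * B) * x ^+ N.
  apply: le_trans (ler_normD _ _) _; rewrite !normrM.
  have e1 : `|f t - psum a N t| * `|g t| <= (A * x ^+ N) * (3 * B) by apply: ler_pM.
  have e2 : `|psum a N t| * `|g t - psum b N t| <= (2 * A) * (B * x ^+ N) by apply: ler_pM.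
  apply: le_trans (lerD e1 e2) _; rewrite le_eqVlt; apply/orP; left; apply/eqP; ring.
have h2 : 5 * (A * B) * x ^+ N <= 5 * (A * B) * (2 * x) ^+ N.
  by rewrite ler_wpM2l// mulr_ge0.
have -> : 2 * s * t = 2 * x by rewrite /x mulrA.
apply: le_trans (lerD (le_trans h1 h2) tail) _.
move: ((2 * x) ^+ N) => y; rewrite le_eqVlt; apply/orP; left; apply/eqP; ring.
Qed.

Lemma germ_coef0 f a A s d N : 0 < d -> germ f a A s d ->
  (forall m, (m < N)%N -> a m = 0) ->
  forall t, 0 < t <= d -> `|f t| <= A * (s * t) ^+ N.
Proof.
move=> d0 [A0 s0 sd ha hf] a0 t td; have := hf N t td.
by rewrite /psum big_nat big1 ?subr0// => m /andP[_ /a0 ->]; rewrite mul0r.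
Qed.

Lemma germ_eq0 f a A s d : 0 < d -> germ f a A s d -> (forall m, a m = 0) ->
  forall t, 0 < t <= d -> f t = 0.
Proof.
move=> d0 h a0 t td; have [A0 s0 sd _ _] := h; have /andP[t0 td'] := td.
apply/eqP; rewrite -normr_le0; apply: (@le0_of_geometric _ _ A (s * t)).
  rewrite mulr_ge0 ?ltW//=; apply: (@le_lt_trans _ _ 2^-1); last lra.
  by apply: le_trans sd; rewrite ler_pM2l.
by move=> n; apply: (germ_coef0 d0 h).
Qed.

Lemma germ_lead f a A s d N : 0 < d -> germ f a A s d ->
  (forall m, (m < N)%N -> a m = 0) ->
  forall t, 0 < t <= d -> `|f t - a N * t ^+ N| <= A * s ^+ N.+1 * t ^+ N.+1.
Proof.
move=> d0 [A0 s0 sd ha hf] a0 t td; have := hf N.+1 t td.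
rewrite /psum big_nat_recr//= big_nat big1 ?add0r; last by move=> m /andP[_ /a0 ->]; rewrite mul0r.
by rewrite exprMn mulrA.
Qed.

(** The first nonzero coefficient would dominate the remainder for small [t]. Vanishing near 0 thus
    kills every coefficient, and then the function on the whole of ]0, d]. *)
Lemma agerm_unique f d e : 0 < d -> 0 < e -> agerm f d ->
  (forall t, 0 < t < e -> f t = 0) -> forall t, 0 < t <= d -> f t = 0.
Proof.
move=> d0 e0 [a [A [s h]]] f0; have [A0 s0 sd _ _] := h.
apply: (germ_eq0 d0 h) => m; have [n] := ubnP m; elim: n m => // n IH m.
rewrite ltnS => mn.
have am j : (j < m)%N -> a j = 0 by move=> jm; apply: IH; exact: leq_trans jm mn.
apply/eqP; rewrite -normr_le0 leNgt; apply/negP => an0.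
pose C := A * s ^+ m.+1.
have C0 : 0 <= C by rewrite mulr_ge0// exprn_ge0// ltW.
pose t := Num.min (Num.min (e / 2) d) (`|a m| / (C + 1) / 2).
have C10 : 0 < C + 1 by lra.
have t0 : 0 < t by rewrite !lt_min !divr_gt0//= d0.
have te : t < e by apply: (@le_lt_trans _ _ (e / 2)); [rewrite !ge_min lexx|lra].
have td : t <= d by rewrite !ge_min lexx orbT.
have ta : t * (C + 1) < `|a m|.
  apply: (@le_lt_trans _ _ (`|a m| / 2)); last lra.
  rewrite -ler_pdivlMr// mulrAC; by rewrite ge_min lexx orbT.
have := germ_lead d0 h am (t := t); rewrite t0 td f0 ?t0// => /(_ isT).
rewrite sub0r normrN normrM (ger0_norm (exprn_ge0 _ (ltW t0))) -/C exprS mulrA.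
rewrite ler_pM2r ?exprn_gt0// leNgt => /negP; apply.
by apply: le_lt_trans ta; rewrite mulrC ler_pM2l//; lra.
Qed.

(** The pair stands for one complex series: [n] is the first index at which either real coefficient
    is nonzero. *)
Lemma germ_pair_lead f g d : 0 < d -> agerm f d -> agerm g d ->
  (forall t, 0 < t <= d -> f t = 0 /\ g t = 0) \/
  exists n al be K, [/\ (al, be) != (0, 0), 0 <= K &
    forall t, 0 < t <= d -> `|f t - al * t ^+ n| <= K * t ^+ n.+1 /\
       `|g t - be * t ^+ n| <= K * t ^+ n.+1].
Proof.
move=> d0 [a [A [s ha]]] [b [B [r hb]]].
have [/existsNP[m hm]|h] := pselect (~ forall m, (a m == 0) && (b m == 0)); last first.
  left=> t td; move/contrapT: h => h; split.
    by apply: (germ_eq0 d0 ha) => // m; have /andP[/eqP] := h m.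
  by apply: (germ_eq0 d0 hb) => // m; have /andP[_ /eqP] := h m.
right; have ex : exists m, ~~ ((a m == 0) && (b m == 0)) by exists m; apply/negP.
case: (ex_minnP ex) => n hn nmin.
have [A0 s0 _ _ _] := ha; have [B0 r0 _ _ _] := hb.
have low j : (j < n)%N -> a j = 0 /\ b j = 0.
  move=> jn; have [/andP[/eqP -> /eqP ->]//|] := boolP ((a j == 0) && (b j == 0)).
  by move=> /nmin; rewrite leqNgt jn.
exists n, (a n), (b n), (A * s ^+ n.+1 + B * r ^+ n.+1); split.
- by rewrite xpair_eqE.
- by rewrite addr_ge0// mulr_ge0// exprn_ge0// ltW.
move=> t td; have /andP[t0 _] := td; split.
  apply: le_trans (germ_lead d0 ha (fun j jn => (low j jn).1) td) _.
  by rewrite ler_wpM2r ?exprn_ge0 ?(ltW t0)// lerDl mulr_ge0// exprn_ge0// ltW.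
apply: le_trans (germ_lead d0 hb (fun j jn => (low j jn).2) td) _.
by rewrite ler_wpM2r ?exprn_ge0 ?(ltW t0)// lerDr mulr_ge0// exprn_ge0// ltW.
Qed.

(** The weights 2^-l make each column of coefficients summable. Only finite sums are exchanged; the
    number [L] of summed terms then disappears through [le0_of_geometric], so the constant [C]
    leaves no trace in the result. *)
Lemma germ_series (F : nat -> R -> R) (c : nat -> nat -> R) f A C s d :
  0 <= A -> 0 < s -> s * d <= 2^-1 ->
  (forall l m, `|c l m| <= A * 2^-1 ^+ l * s ^+ m) ->
  (forall l N t, 0 < t <= d -> `|F l t - psum (c l) N t| <= A * 2^-1 ^+ l * (s * t) ^+ N) ->
  (forall L t, 0 < t <= d -> `|f t - \sum_(0 <= l < L) F l t| <= C * 2^-1 ^+ L) ->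
  exists a, germ f a (2 * A) s d.
Proof.
move=> A0 s0 sd hc hF hf.
have h20 : (0 : R) <= 2^-1 by lra.
have h21 : (2^-1 : R) < 1 by lra.
have q01 : 0 <= (2^-1 : R) < 1 by apply/andP; split.
have hc' m l : `|c l m| <= (A * s ^+ m) * 2^-1 ^+ l by rewrite mulrAC.
have [a ha] := choice (fun m => geometric_series_limit q01 (hc' m)).
have i2 : (1 - 2^-1 : R)^-1 = 2 by field.
have {}ha m L : `|a m - \sum_(0 <= l < L) c l m| <= 2 * A * s ^+ m * 2^-1 ^+ L.
  by apply: le_trans (ha m L) _; rewrite i2 le_eqVlt; apply/orP; left; apply/eqP; ring.
exists a; split=> //; first by rewrite mulr_ge0.
  by move=> m; have := ha m 0%N; rewrite big_geq// subr0 expr0 mulr1.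
move=> N t td; have /andP[t0 td'] := td.
have x0 : 0 <= s * t by rewrite mulr_ge0// ltW.
have x2 : s * t <= 2^-1 by apply: le_trans sd; rewrite ler_pM2l.
rewrite -subr_le0; apply: (@le0_of_geometric _ _ (C + 4 * A) 2^-1) => // L.
rewrite lerBlDr.
have -> : f t - psum a N t = (f t - \sum_(0 <= l < L) F l t) +
   \sum_(0 <= l < L) (F l t - psum (c l) N t) -
   \sum_(0 <= m < N) (a m - \sum_(0 <= l < L) c l m) * t ^+ m.
  rewrite sumrB; 
  have -> : \sum_(0 <= m < N) (a m - \sum_(0 <= l < L) c l m) * t ^+ m =
     psum a N t - \sum_(0 <= l < L) psum (c l) N t.
    rewrite /psum exchange_big/= -sumrB; apply: eq_bigr => m _.
    by rewrite mulrBl mulr_suml.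
  by rewrite /psum; ring.
apply: le_trans (ler_normB _ _) _.
have h3 : `|\sum_(0 <= m < N) (a m - \sum_(0 <= l < L) c l m) * t ^+ m| <= 4 * A * 2^-1 ^+ L.
  apply: le_trans (ler_norm_sum _ _ _) _.
  apply: (@le_trans _ _ (\sum_(0 <= m < N) 2 * A * 2^-1 ^+ L * (s * t) ^+ m)).
    apply: ler_sum => m _; rewrite normrM (ger0_norm (exprn_ge0 _ (ltW t0))) exprMn mulrA.
    by rewrite ler_wpM2r ?exprn_ge0 ?(ltW t0)// [leRHS]mulrAC.
  rewrite -mulr_sumr.
  have g : \sum_(0 <= m < N) (s * t) ^+ m <= 2.
    apply: le_trans (sum_geometric_le 0 N (_ : 0 <= s * t < 1)) _.
      by rewrite x0/=; lra.
    rewrite expr0 mul1r -[leRHS]invrK lef_pV2 ?posrE ?invr_gt0//; lra.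
  have -> : 4 * A * 2^-1 ^+ L = 2 * A * 2^-1 ^+ L * 2 by ring.
  by rewrite ler_wpM2l// !mulr_ge0// exprn_ge0.
have h2 : `|\sum_(0 <= l < L) (F l t - psum (c l) N t)| <= 2 * A * (s * t) ^+ N.
  apply: le_trans (ler_norm_sum _ _ _) _.
  apply: (@le_trans _ _ (\sum_(0 <= l < L) A * (s * t) ^+ N * 2^-1 ^+ l)).
    by apply: ler_sum => l _; rewrite mulrAC; exact: hF.
  rewrite -mulr_sumr.
  have g := sum_geometric_le 0 L q01; rewrite expr0 mul1r i2 in g.
  have -> : 2 * A * (s * t) ^+ N = A * (s * t) ^+ N * 2 by ring.
  by rewrite ler_wpM2l// mulr_ge0// exprn_ge0.
have h1 := hf L t td.
have := ler_normD (f t - \sum_(0 <= l < L) F l t) (\sum_(0 <= l < L) (F l t - psum (c l) N t)).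
rewrite mulrDl; lra.
Qed.

(** Let [sg] be the supremum of the points up to which [f] vanishes. Expansions reach only to the
    right of their centre, so one starts at a centre [c] in ]sg - d, sg[: its interval of length
    [2 * d] overlaps the zero set on the left and passes [sg + d]. This is why a common length is
    required for all centres near a point. *)
Lemma germ_propagate f (al be p q : R) : al <= p -> p < q -> q <= be ->
  (forall x, al < x < be -> exists2 d, 0 < d &
     forall c, `|c - x| < d -> agerm (fun t => f (c + t)) (2 * d)) ->
  (forall x, p < x < q -> f x = 0) -> forall x, p < x < be -> f x = 0.
Proof.
move=> alp pq qbe hf f0.
pose S := [set x | p < x <= be /\ forall y, p < y < x -> f y = 0].
have Sq : S q by split; [rewrite pq qbe|exact: f0].
have ubS : ubound S be by move=> x [/andP[]].
have hS : has_sup S by split; [exists q|exists be].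
pose sg := sup S.
have qs : q <= sg by apply: ub_le_sup => //; exists be.
have sb : sg <= be by apply: ge_sup => //; exists q.
have fs y : p < y < sg -> f y = 0.
  move=> /andP[py ys]; have sy : 0 < sg - y by rewrite subr_gt0.
  have [z [_ h] yz] := sup_adherent sy hS.
  by apply: h; rewrite py/=; move: yz; rewrite -/sg; lra.
have [sbe|] := leP be sg.
  by move=> x /andP[px xb]; apply: fs; rewrite px (lt_le_trans xb).
move=> sbe; exfalso.
have sgI : al < sg < be by rewrite sbe andbT; lra.
have [d d0 hd] := hf sg sgI.
pose m := Num.max p (sg - d).
have mp : p <= m by rewrite le_max lexx.
have md : sg - d <= m by rewrite le_max lexx orbT.
have ms : m < sg by rewrite gt_max; lra.
pose c := (m + sg) / 2.
have cs : c < sg by rewrite /c; lra.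
have mc : m < c by rewrite /c; lra.
have z t : 0 < t <= 2 * d -> f (c + t) = 0.
  have g : agerm (fun t => f (c + t)) (2 * d) by apply: hd; rewrite ltr_norml; lra.
  apply: (agerm_unique _ _ g (e := sg - c)); [lra|lra|].
  by move=> y hy; apply: fs; lra.
pose y := Num.min be (sg + d).
have ys : sg < y by rewrite lt_min sbe; lra.
have : S y.
  split; first by rewrite ge_min lexx/= andbT; lra.
  move=> x /andP[px xy]; have xd : x < sg + d by apply: lt_le_trans xy _; rewrite ge_min lexx orbT.
  have [xc|cx] := leP x c; first by apply: fs; lra.
  have -> : x = c + (x - c) by ring.
  by apply: z; lra.
move=> /(ub_le_sup (_ : has_ubound S)); rewrite -/sg leNgt ys => /(_ _)/negP[]//.
by exists be.
Qed.

End Germs.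

(** * Spherical Hankel polynomials *)

Section HankelPolynomials.
Variables (R : realType) (kappa : R) (l : nat).
Hypothesis k0 : 0 < kappa.

(** The ratio of consecutive coefficients of p_l is [i * hstep m], as forced by the radial equation.
    It vanishes at [m = l], which ends the series. *)
Definition hstep (m : nat) : R :=
  ((l * l.+1)%:R - (m * m.+1)%:R) / (2 * kappa * m.+1%:R).

(* The real and imaginary parts of the coefficients of the polynomial p for
   which [exp (i kappa r) * p (1 / r) / r] solves the radial equation. *)
Fixpoint hcoef (m : nat) : R * R :=
  if m is m'.+1 then
    let: (x, y) := hcoef m' in (- hstep m' * y, hstep m' * x)
  else (1, 0).

(** The modulus of the complex coefficient [hcoef m], by [hcoef_sqr]. *)
Fixpoint habs (m : nat) : R := if m is m'.+1 then hstep m' * habs m' else 1.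

Definition hP : {poly R} := \poly_(i < l.+1) (hcoef i).1.
Definition hQ : {poly R} := \poly_(i < l.+1) (hcoef i).2.

Lemma hcoefS m : hcoef m.+1 = (- hstep m * (hcoef m).2, hstep m * (hcoef m).1).
Proof. by rewrite /=; case: (hcoef m). Qed.

Lemma hstepl : hstep l = 0.
Proof. by rewrite /hstep subrr mul0r. Qed.

Lemma hstep_gt0 m : (m < l)%N -> 0 < hstep m.
Proof.
move=> ml; rewrite /hstep divr_gt0//; last by rewrite !mulr_gt0// ltr0n.
by rewrite subr_gt0 ltr_nat ltn_mul.
Qed.

Lemma habs_gt0 m : (m <= l)%N -> 0 < habs m.
Proof.
elim: m => [|m IH] //= ml; rewrite mulr_gt0 ?hstep_gt0//; exact/IH/ltnW.
Qed.

Lemma hcoef_sqr m : (hcoef m).1 ^+ 2 + (hcoef m).2 ^+ 2 = habs m ^+ 2.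
Proof.
elim: m => [|m IH]; first by rewrite /= expr1n expr0n addr0.
by rewrite hcoefS /= [RHS]exprMn -IH; ring.
Qed.

Lemma hcoef_le m : (m <= l)%N -> `|(hcoef m).1| <= habs m /\ `|(hcoef m).2| <= habs m.
Proof.
move=> ml; have h := hcoef_sqr m; have b0 := ltW (habs_gt0 ml).
split; rewrite -(ger0_norm b0) -ler_sqr ?nnegrE ?normr_ge0// !real_normK ?num_real// -h.
  by rewrite lerDl sqr_ge0.
by rewrite lerDr sqr_ge0.
Qed.

Lemma hcoef_gt m : (l < m)%N -> hcoef m = (0, 0).
Proof.
elim: m => // m IH; rewrite ltnS leq_eqVlt => /predU1P[<-|/IH h].
  by rewrite hcoefS hstepl oppr0 !mul0r.
by rewrite hcoefS h !mulr0.
Qed.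

Lemma coef_hP m : hP`_m = (hcoef m).1.
Proof. by rewrite coef_poly; case: ltnP => // h; rewrite hcoef_gt. Qed.

Lemma coef_hQ m : hQ`_m = (hcoef m).2.
Proof. by rewrite coef_poly; case: ltnP => // h; rewrite hcoef_gt. Qed.

Let lam : R := (l * l.+1)%:R.

Lemma coef_deriv_X2_deriv (p : {poly R}) m : (('X^2 * p^`())^`())`_m = (m * m.+1)%:R * p`_m.
Proof.
rewrite coef_deriv coefXnM; case: m => [|m]; first by rewrite mul0r mul0rn.
by rewrite ltnS/= subSS subn1/= coef_deriv -mulrnA mulr_natl.
Qed.

Lemma hstepE m : 2 * kappa * m.+1%:R * hstep m = lam - (m * m.+1)%:R.
Proof.
rewrite /hstep mulrC divfK// gt_eqF// !mulr_gt0// ltr0n.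
Qed.

Lemma hP_ode : ('X^2 * hP^`())^`() + (2 * kappa) *: hQ^`() = lam *: hP.
Proof.
apply/polyP => m; rewrite coefD !coefZ coef_deriv_X2_deriv coef_deriv !coef_hP coef_hQ hcoefS /=.
have -> : 2 * kappa * (hstep m * (hcoef m).1 *+ m.+1) =
    (2 * kappa * m.+1%:R * hstep m) * (hcoef m).1 by ring.
by rewrite hstepE; ring.
Qed.

Lemma hQ_ode : ('X^2 * hQ^`())^`() - (2 * kappa) *: hP^`() = lam *: hQ.
Proof.
apply/polyP => m; rewrite coefB !coefZ coef_deriv_X2_deriv coef_deriv !coef_hQ coef_hP hcoefS /=.
have -> : 2 * kappa * (- hstep m * (hcoef m).2 *+ m.+1) =
    - ((2 * kappa * m.+1%:R * hstep m) * (hcoef m).2) by ring.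
by rewrite hstepE; ring.
Qed.

Lemma deriv_eq0 (p : {poly R}) : p^`() = 0 -> p = (p`_0)%:P.
Proof.
move=> h; apply/polyP => -[|m]; rewrite coefC//=.
have := congr1 (fun q : {poly R} => q`_m) h; rewrite coef_deriv coef0 => /eqP.
by rewrite mulrn_eq0/= => /eqP.
Qed.

(** In the variable t = 1/r, constancy of the Wronskian of the outgoing solution and its conjugate:
    the two equations make the derivative vanish, and the constant is read at t = 0. *)
Lemma hwronskian : kappa *: (hP ^+ 2 + hQ ^+ 2) - 'X^2 * (hP * hQ^`() - hP^`() * hQ) = kappa%:P.
Proof.
set S := LHS.
have dS : S^`() = 0.
  rewrite /S mulrBr.
  have -> : 'X^2 * (hP * hQ^`()) = hP * ('X^2 * hQ^`()) by ring.
  have -> : 'X^2 * (hP^`() * hQ) = ('X^2 * hP^`()) * hQ by ring.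
  have e1 : ('X^2 * hP^`())^`() = lam *: hP - (2 * kappa) *: hQ^`() by rewrite -hP_ode addrK.
  have e2 : ('X^2 * hQ^`())^`() = lam *: hQ + (2 * kappa) *: hP^`() by rewrite -hQ_ode subrK.
  rewrite derivB derivZ derivD !expr2 (derivM hP hP) (derivM hQ hQ) derivB.
  rewrite -expr2 (derivM hP) (derivM _ hQ) e1 e2 -!mul_polyC !polyCM.
  have -> : (2 : R)%:P = 2 by rewrite polyC_natr.
  ring.
rewrite (deriv_eq0 dS) -horner_coef0 /S hornerD hornerN hornerZ hornerD !horner_exp hornerM hornerXn.
by rewrite !horner_coef0 coef_hP coef_hQ /=; congr (_%:P); ring.
Qed.

Definition hY : {poly R} := hP ^+ 2 + hQ ^+ 2.

(** The third-order equation of products of two solutions, here for |p_l|^2. On coefficients it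
    links degree m + 2 to degree m alone, with a factor 4 l (l + 1) - m (m + 2) that is nonnegative
    for m at most 2 l; this makes the positivity of the coefficients visible. *)
Lemma hY_ode : (4 * kappa ^+ 2) *: hY^`() =
  (2 * lam) *: ('X^2 * hY)^`() + (2 * lam) *: ('X^2 * hY^`()) - ('X^2 * ('X^2 * hY^`())^`())^`().
Proof.
have e1 : ('X^2 * hP^`())^`() = lam *: hP - (2 * kappa) *: hQ^`() by rewrite -hP_ode addrK.
have e2 : ('X^2 * hQ^`())^`() = lam *: hQ + (2 * kappa) *: hP^`() by rewrite -hQ_ode subrK.
have dY : hY^`() = 2 *: (hP * hP^`() + hQ * hQ^`()).
  rewrite /hY derivD !expr2 (derivM hP) (derivM hQ) -!mul_polyC polyC_natr; ring.
pose W := hP * hQ^`() - hP^`() * hQ.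
have XW : 'X^2 * W = kappa *: hY - kappa%:P.
  by rewrite -hwronskian /hY opprB addrCA subrr addr0.
pose T := 'X^2 * (hP^`() ^+ 2 + hQ^`() ^+ 2).
have dz : ('X^2 * hY^`())^`() = (2 * lam) *: hY - (4 * kappa) *: W + 2 *: T.
  have -> : 'X^2 * hY^`() = 2 *: (hP * ('X^2 * hP^`()) + hQ * ('X^2 * hQ^`())).
    by rewrite dY -!mul_polyC polyC_natr; ring.
  rewrite derivZ derivD (derivM hP) (derivM hQ) e1 e2 /hY /W /T -!mul_polyC !polyCM !polyC_natr.
  ring.
have d4 : ('X^2 * T)^`() = lam *: ('X^2 * hY^`()).
  have -> : 'X^2 * T = ('X^2 * hP^`()) ^+ 2 + ('X^2 * hQ^`()) ^+ 2 by rewrite /T; ring.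
  rewrite derivD 2!expr2 (derivM ('X^2 * hP^`())) (derivM ('X^2 * hQ^`())) e1 e2 dY.
  rewrite -!mul_polyC !polyCM !polyC_natr; ring.
rewrite dz.
have -> : 'X^2 * ((2 * lam) *: hY - (4 * kappa) *: W + 2 *: T) =
    (2 * lam) *: ('X^2 * hY) - (4 * kappa) *: (kappa *: hY - kappa%:P) + 2 *: ('X^2 * T).
  by rewrite -XW -!mul_polyC; ring.
have dlin (A B Z : {poly R}) : ((2 * lam) *: A - (4 * kappa) *: (kappa *: B - kappa%:P) + 2 *: Z)^`() =
    (2 * lam) *: A^`() - (4 * kappa ^+ 2) *: B^`() + 2 *: Z^`().
  rewrite derivD derivB !derivZ derivB derivZ derivC subr0 scalerA.
  by congr (_ - _ *: _ + _); ring.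
rewrite dlin d4 -!mul_polyC !polyCM !polyC_natr; ring.
Qed.

Lemma coef_hY m : 4 * kappa ^+ 2 * m.+2%:R * hY`_m.+2 =
  m.+1%:R * (4 * lam - (m * m.+2)%:R) * hY`_m.
Proof.
have := congr1 (fun q : {poly R} => q`_m.+1) hY_ode.
rewrite coefB coefD !coefZ !coef_deriv !coefXnM /= !subSS !subn0 !coef_deriv.
rewrite coefXnM.
case: m => [|m].
  rewrite /= !mulr1n ?subn1 /= ?subnn => e.
  by rewrite [LHS](_ : _ = 4 * kappa ^+ 2 * (hY`_2 *+ 2)); [rewrite e|]; ring.
rewrite /= ?subSS ?subn0 ?subn1 /= ?coef_deriv => e.
by rewrite [LHS](_ : _ = 4 * kappa ^+ 2 * (hY`_m.+3 *+ m.+3)); [rewrite e|]; ring.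
Qed.

Lemma coef_hY1 : hY`_1 = 0.
Proof.
have := congr1 (fun q : {poly R} => q`_0) hY_ode.
rewrite coefB coefD !coefZ !coef_deriv !coefXnM /= => e.
have : 4 * kappa ^+ 2 * hY`_1 = 0.
  by rewrite [LHS](_ : _ = 4 * kappa ^+ 2 * (hY`_1 *+ 1)); [rewrite e|]; ring.
by move/eqP; rewrite mulf_eq0 gt_eqF ?mulr_gt0 ?exprn_gt0//= => /eqP.
Qed.

Lemma hY_coef_ge0 m : (m <= l.*2)%N -> 0 <= hY`_m.
Proof.
elim/ltn_ind: m => -[|[|m]] IH ml.
- by rewrite /hY coefD !expr2 !coefM !big_ord_recl !big_ord0 addr_ge0// addr0 -expr2 sqr_ge0.
- by rewrite coef_hY1.
have h : 0 <= 4 * kappa ^+ 2 * m.+2%:R * hY`_m.+2.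
  rewrite coef_hY mulr_ge0//; last by apply: IH; rewrite // ltnW// ltnW.
  rewrite mulr_ge0// subr_ge0 /lam -natrM ler_nat.
  have : (m <= (l.*2).-2)%N by rewrite -!subn1; lia.
  rewrite -muln2 => ml'; nia.
by move: h; rewrite pmulr_rge0// !mulr_gt0 ?exprn_gt0// ltr0n.
Qed.

Lemma hY_coef_top : hY`_(l.*2) = habs l ^+ 2.
Proof.
have top (p : {poly R}) : (forall m, (l < m)%N -> p`_m = 0) -> (p ^+ 2)`_(l.*2) = p`_l ^+ 2.
  move=> hp; rewrite expr2 coefM.
  have ll : (l < l.*2.+1)%N by rewrite ltnS -addnn leq_addr.
  rewrite (bigD1 (Ordinal ll))//= big1 ?addr0.
    by rewrite -addnn addnK.
  move=> i il; have [h|h] := ltnP l i; first by rewrite hp// mul0r.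
  have {}h : (i < l)%N by rewrite ltn_neqAle h andbT.
  have li : (l < l.*2 - i)%N by lia.
  by rewrite (hp _ li) mulr0.
rewrite /hY coefD !top ?coef_hP ?coef_hQ ?hcoef_sqr//.
  by move=> m lm; rewrite coef_hQ hcoef_gt.
by move=> m lm; rewrite coef_hP hcoef_gt.
Qed.

(** All coefficients of |p_l|^2 up to degree 2 l are nonnegative and there are none beyond, so the
    top term alone is a lower bound for t at least 0. *)
Lemma hY_ge t : 0 <= t -> (habs l * t ^+ l) ^+ 2 <= hP.[t] ^+ 2 + hQ.[t] ^+ 2.
Proof.
move=> t0; have -> : hP.[t] ^+ 2 + hQ.[t] ^+ 2 = hY.[t] by rewrite /hY hornerD !horner_exp.
have sY : (size hY <= l.*2.+1)%N.
  apply/leq_sizeP => m; elim/ltn_ind: m => m IH lm.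
  have hPm j : (l < j)%N -> hP`_j = 0 by move=> lj; rewrite coef_hP hcoef_gt.
  have hQm j : (l < j)%N -> hQ`_j = 0 by move=> lj; rewrite coef_hQ hcoef_gt.
  rewrite /hY coefD !expr2 !coefM !big1 ?addr0// => i _.
    have [h|h] := ltnP l i; first by rewrite hQm// mul0r.
    by rewrite [X in _ * X]hQm ?mulr0//; lia.
  have [h|h] := ltnP l i; first by rewrite hPm// mul0r.
  by rewrite [X in _ * X]hPm ?mulr0//; lia.
rewrite (horner_coef_wide _ sY) big_ord_recr/= hY_coef_top.
have -> : (habs l * t ^+ l) ^+ 2 = habs l ^+ 2 * t ^+ l.*2.
  by rewrite exprMn -exprM muln2.
rewrite lerDr; apply: sumr_ge0 => i _; rewrite mulr_ge0 ?exprn_ge0//.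
by apply: hY_coef_ge0; rewrite ltnW.
Qed.

(** Since l (l + 1) - m (m + 1) = (l - m) (l + m + 1) is at least 2 (m + 1) (l - m) for m < l, each
    step satisfies kappa * hstep m >= l - m. Going down from degree l multiplies these factors into
    a factorial. *)
Lemma habs_ratio j : (j <= l)%N -> habs (l - j) * j`!%:R <= habs l * kappa ^+ j.
Proof.
elim: j => [|j IH] jl; first by rewrite subn0 fact0 !mulr1.
have lj : (l - j = (l - j.+1).+1)%N by lia.
have := IH (ltnW jl); rewrite lj /= => {}IH.
set m := (l - j.+1)%N in IH *.
have ml : (m < l)%N by rewrite /m; lia.
have b0 := habs_gt0 (ltnW ml).
have h : habs m * j.+1%:R <= kappa * (hstep m * habs m).
  rewrite mulrA mulrC ler_pM2r//.
  rewrite -(ler_pM2l (_ : 0 < 2 * m.+1%:R)); last by rewrite mulr_gt0// ltr0n.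
  have -> : 2 * m.+1%:R * (kappa * hstep m) = lam - (m * m.+1)%:R by rewrite -hstepE; ring.
  rewrite /lam -natrB ?leq_mul ?(ltnW ml) ?ltnS ?(ltnW ml)// -!natrM ler_nat.
  have -> : j.+1 = (l - m)%N by rewrite /m; lia.
  nia.
rewrite factS natrM mulrA; apply: (@le_trans _ _ (kappa * (hstep m * habs m) * j`!%:R)).
  by rewrite ler_wpM2r.
by rewrite exprS [leRHS]mulrCA -[leLHS]mulrA ler_pM2l.
Qed.

End HankelPolynomials.

(** * Regular radial solutions *)

Section Bessel.
Variables (R : realType) (kappa : R) (l : nat).
Hypothesis k0 : 0 < kappa.

(* Coefficients of the solution [r ^+ l * (1 + ...)] of the radial equation. *)
Fixpoint bcoef (m : nat) : R :=
  if m is m'.+1 then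
    if m' is m''.+1 then - kappa ^+ 2 / (m''.+2%:R * (2 * l + m'' + 3)%:R) * bcoef m''
    else 0
  else 1.

Lemma bcoefSS m : m.+2%:R * (2 * l + m + 3)%:R * bcoef m.+2 = - kappa ^+ 2 * bcoef m.
Proof.
rewrite /= mulrA [_ * (_ / _)]mulrC divfK// mulf_neq0// pnatr_eq0//.
Qed.

Arguments bcoef : simpl never.

(** The bound does not depend on [l], which is what allows the modes to be summed over [l]. *)
Lemma bcoef_le m : `|bcoef m| <= (kappa / 2) ^+ m.
Proof.
have k2 : 0 <= kappa / 2 by rewrite divr_ge0// ltW.
elim/ltn_ind: m => -[|[|m]] IH; first by rewrite normr1 expr0.
  by rewrite normr0 exprn_ge0.
have {IH}h := IH m (leqnSn _).
have e : m.+2%:R * (2 * l + m + 3)%:R * `|bcoef m.+2| = kappa ^+ 2 * `|bcoef m|.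
  have := congr1 (fun x => `|x|) (bcoefSS m).
  by rewrite !normrM normrN !normr_nat normrX (gtr0_norm k0).
have e4 : 4 * `|bcoef m.+2| <= kappa ^+ 2 * `|bcoef m|.
  rewrite -e ler_wpM2r// -natrM ler_nat; nia.
have : kappa ^+ 2 * `|bcoef m| <= kappa ^+ 2 * (kappa / 2) ^+ m by rewrite ler_wpM2l// exprn_ge0// ltW.
have -> : (kappa / 2) ^+ m.+2 = kappa ^+ 2 * (kappa / 2) ^+ m / 4.
  by rewrite !exprS; field.
lra.
Qed.

Definition bpoly N : {poly R} := \sum_(0 <= m < N) bcoef m *: 'X^(l + m).

Let lam : R := (l * l.+1)%:R.

Lemma horner_bpoly N r : (bpoly N).[r] = r ^+ l * psum bcoef N r.
Proof.
rewrite /bpoly horner_sum /psum mulr_sumr; apply: eq_bigr => m _.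
by rewrite hornerZ hornerXn exprD; ring.
Qed.

Lemma deriv_X2_derivXn n : ('X^2 * ('X^n)^`())^`() = (n * n.+1)%:R *: ('X^n : {poly R}).
Proof.
by apply/polyP => m; rewrite coef_deriv_X2_deriv coefZ coefXn; case: eqVneq => [->|]; rewrite ?mulr0.
Qed.

(** Truncation leaves two uncancelled terms, of high degree; they are the defect that drives the
    Wronskian [w] below. *)
Lemma bpoly_ode N : ('X^2 * (bpoly N.+2)^`())^`() - lam *: bpoly N.+2 + kappa ^+ 2 *: ('X^2 * bpoly N.+2) =
  (kappa ^+ 2 * bcoef N) *: 'X^(l + N + 2) + (kappa ^+ 2 * bcoef N.+1) *: 'X^(l + N + 3).
Proof.
pose Lop (p : {poly R}) := ('X^2 * p^`())^`() - lam *: p + kappa ^+ 2 *: ('X^2 * p).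
have LD p q : Lop (p + q) = Lop p + Lop q.
  by rewrite /Lop derivD mulrDr derivD mulrDr !scalerDr; ring.
have LX m : Lop (bcoef m *: 'X^(l + m)) = (bcoef m * (m * (2 * l + m + 1))%:R) *: 'X^(l + m) +
     (kappa ^+ 2 * bcoef m) *: 'X^(l + m + 2).
  rewrite /Lop derivZ -scalerAr derivZ deriv_X2_derivXn -scalerAr -exprD !scalerA.
  have -> : (2 + (l + m) = l + m + 2)%N by lia.
  by rewrite -scalerBl; congr (_ *: _ + _); rewrite /lam; ring.
rewrite -/(Lop _); elim: N => [|N IH].
  rewrite /bpoly !big_nat_recr//= big_geq// add0r LD !LX mul0n mulr0 scale0r add0r.
  by rewrite !mul0r scale0r add0r mulr0 !scale0r !addr0 addn0.
have -> : bpoly N.+3 = bpoly N.+2 + bcoef N.+2 *: 'X^(l + N.+2).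
  by rewrite /bpoly big_nat_recr.
rewrite LD IH LX.
have -> : bcoef N.+2 * (N.+2 * (2 * l + N.+2 + 1))%:R = - kappa ^+ 2 * bcoef N.
  rewrite -bcoefSS mulrC natrM; congr (_ * _%:R * _); lia.
have -> : (l + N.+2 = l + N + 2)%N by lia.
have -> : (l + N + 2 + 2 = l + N.+1 + 3)%N by lia.
have -> : (l + N.+1 + 2 = l + N + 3)%N by lia.
by rewrite -!mul_polyC mulNr polyCN; ring.
Qed.

(** Keeps the truncated solutions away from zero, so that [A] can be divided by them. *)
Lemma bpsum_ge N r : 0 <= r -> kappa * r <= 2^-1 -> 2^-1 <= psum bcoef N.+1 r.
Proof.
move=> r0 kr; rewrite /psum big_nat_recl//= expr0 mulr1.
have -> : bcoef 0 = 1 by [].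
pose q := kappa * r / 2.
have q0 : 0 <= q by rewrite divr_ge0// mulr_ge0// ltW.
have q4 : q <= 4^-1 by rewrite /q; lra.
have h : `|\sum_(0 <= i < N) bcoef i.+1 * r ^+ i.+1| <= q / (1 - q).
  apply: le_trans (ler_norm_sum _ _ _) _.
  apply: (@le_trans _ _ (\sum_(1 <= i < N.+1) q ^+ i)).
    rewrite big_add1/=; apply: ler_sum => i _.
    rewrite normrM (ger0_norm (exprn_ge0 _ r0)) /q mulrAC exprMn.
    by rewrite ler_wpM2r ?exprn_ge0// bcoef_le.
  apply: le_trans (sum_geometric_le _ _ _) _; last by rewrite expr1.
  by rewrite q0/=; lra.
have h2 : q / (1 - q) <= 2^-1 by rewrite ler_pdivrMr; lra.
by move: (le_trans h h2); rewrite ler_norml; lra.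
Qed.

Variables (A A1 A2 : R -> R) (r0 M e0 : R).
Hypotheses (r00 : 0 < r0) (kr0 : kappa * r0 <= 2^-1) (e00 : 0 < e0).
Hypothesis dA : forall r, 0 < r <= r0 -> is_derive r 1 A (A1 r).
Hypothesis dA1 : forall r, 0 < r <= r0 -> is_derive r 1 A1 (A2 r).
Hypothesis ode : forall r, 0 < r <= r0 ->
  r ^+ 2 * A2 r = (lam - kappa ^+ 2 * r ^+ 2) * A r - 2 * r * A1 r.
Hypothesis AM : forall r, 0 < r <= r0 -> `|A r| <= M.
Hypothesis A1M : forall r, 0 < r <= e0 -> `|A1 r| <= M.

(** The Wronskian r^2 (A j' - A' j) of the given solution [A] and the truncated regular solution j;
    its derivative is [A] times the truncation defect. *)
Let w N r := A r * ('X^2 * (bpoly N)^`()).[r] - r ^+ 2 * A1 r * (bpoly N).[r].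

Let dw N r : 0 < r <= r0 -> is_derive r 1 (w N)
  (A r * (('X^2 * (bpoly N)^`())^`() - lam *: bpoly N + kappa ^+ 2 *: ('X^2 * bpoly N)).[r]).
Proof.
move=> hr.
apply: (is_derive_eq (derB (derM (dA hr) (is_derive_poly _ _))
  (derM (derM (derX 2 (is_derive_id _ _)) (dA1 hr)) (is_derive_poly _ _)))).
have -> : 2 * r ^+ 2.-1 * 1 * A1 r + r ^+ 2 * A2 r = (lam - kappa ^+ 2 * r ^+ 2) * A r.
  by rewrite ode//= expr1; ring.
rewrite hornerD hornerD hornerN !hornerZ !hornerM !hornerX; ring.
Qed.

Let M0 : 0 <= M.
Proof. by apply: le_trans (AM (_ : 0 < r0 <= r0)); rewrite ?r00/=. Qed.

(** Regularity at the origin enters here: since [A] and [A1] are bounded near 0, the boundary term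
    of the Wronskian vanishes there, which excludes solutions behaving like r^(-l-1). *)
Let w_small N : exists2 C, 0 <= C & forall r, 0 < r <= Num.min e0 r0 -> `|w N r| <= C * r.
Proof.
have [B1 hB1] : exists B, forall r, 0 <= r <= r0 -> `|(bpoly N).[r]| <= B.
  have [c _ hc] := @EVT_max R (fun x => `|(bpoly N).[x]|) 0 r0 (ltW r00)
    (continuous_subspaceT (fun x => continuous_comp (@continuous_horner _ (bpoly N) x) (@norm_continuous _ _ _))).
  by exists `|(bpoly N).[c]| => r hr; apply: hc; rewrite in_itv.
have [B2 hB2] : exists B, forall r, 0 <= r <= r0 -> `|((bpoly N)^`()).[r]| <= B.
  have [c _ hc] := @EVT_max R (fun x => `|((bpoly N)^`()).[x]|) 0 r0 (ltW r00)
    (continuous_subspaceT (fun x => continuous_comp (@continuous_horner _ ((bpoly N)^`()) x) (@norm_continuous _ _ _))).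
  by exists `|((bpoly N)^`()).[c]| => r hr; apply: hc; rewrite in_itv.
have B10 : 0 <= B1 by apply: le_trans (hB1 0 _); rewrite ?lexx ?(ltW r00).
have B20 : 0 <= B2 by apply: le_trans (hB2 0 _); rewrite ?lexx ?(ltW r00).
exists (r0 * (M * B2 + M * B1)); first by rewrite mulr_ge0 ?addr_ge0 ?mulr_ge0// ltW.
move=> r /andP[r_0]; rewrite le_min => /andP[re rr].
have hr : 0 < r <= r0 by rewrite r_0. have hr' : 0 <= r <= r0 by rewrite ltW.
have he : 0 < r <= e0 by rewrite r_0.
have -> : w N r = r ^+ 2 * (A r * ((bpoly N)^`()).[r] - A1 r * (bpoly N).[r]).
  by rewrite /w hornerM hornerXn; ring.
rewrite normrM ger0_norm ?exprn_ge0 ?(ltW r_0)//.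
have -> : r0 * (M * B2 + M * B1) * r = (r * r0) * (M * B2 + M * B1) by ring.
apply: ler_pM => //; first by rewrite exprn_ge0// ltW.
  by rewrite expr2 ler_pM2l.
apply: le_trans (ler_normB _ _) _; rewrite !normrM; apply: lerD; apply: ler_pM => //.
- exact: AM.
- exact: hB2.
- exact: A1M.
- exact: hB1.
Qed.

(** The mean value theorem between a small [e] and [r] bounds the variation of the Wronskian by the
    defect, and [w_small] removes the value at [e]. The rate 1/4 is the bound of kappa s / 2 given
    by kappa * r0 <= 1/2. *)
Let w_bound N r : 0 < r <= r0 -> `|w N.+2 r| <= 2 * kappa ^+ 2 * M * r0 ^+ (l + 3) * 4^-1 ^+ N.
Proof.
move=> /andP[r_0 rr0].
have [C C0 hC] := w_small N.+2.
set B := (X in _ <= X).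
have dwb s : 0 < s <= r0 -> `|A s * (('X^2 * (bpoly N.+2)^`())^`() - lam *: bpoly N.+2 + kappa ^+ 2 *: ('X^2 * bpoly N.+2)).[s]| * r0 <= B.
  move=> hs; have /andP[s0 sr] := hs.
  rewrite bpoly_ode hornerD !hornerZ !hornerXn normrM.
  have hE : `|kappa ^+ 2 * bcoef N * s ^+ (l + N + 2) + kappa ^+ 2 * bcoef N.+1 * s ^+ (l + N + 3)| <=
      2 * kappa ^+ 2 * r0 ^+ (l + 2) * 4^-1 ^+ N.
    have hb m : `|bcoef m * s ^+ m| <= 4^-1 ^+ m.
      rewrite normrM (ger0_norm (exprn_ge0 _ (ltW s0))).
      apply: (@le_trans _ _ ((kappa / 2) ^+ m * s ^+ m)); first by rewrite ler_wpM2r ?bcoef_le// exprn_ge0// ltW.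
      rewrite -exprMn; apply: lerXn2r; rewrite ?nnegrE//.
        by rewrite mulr_ge0 ?divr_ge0// ltW.
      have : kappa * s <= kappa * r0 by rewrite ler_pM2l.
      by move: kr0; lra.
    have -> : kappa ^+ 2 * bcoef N * s ^+ (l + N + 2) + kappa ^+ 2 * bcoef N.+1 * s ^+ (l + N + 3) =
       kappa ^+ 2 * s ^+ (l + 2) * (bcoef N * s ^+ N + bcoef N.+1 * s ^+ N.+1).
      by rewrite !exprD !exprS expr0; ring.
    rewrite normrM ger0_norm; last by rewrite mulr_ge0 ?exprn_ge0// ltW.
    have -> : 2 * kappa ^+ 2 * r0 ^+ (l + 2) * 4^-1 ^+ N = kappa ^+ 2 * r0 ^+ (l + 2) * (2 * 4^-1 ^+ N) by ring.
    apply: ler_pM => //; first by rewrite mulr_ge0 ?exprn_ge0// ltW.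
      by rewrite ler_wpM2l ?exprn_ge0 ?(ltW k0)// lerXn2r// nnegrE ltW.
    apply: le_trans (ler_normD _ _) _.
    have h1 := hb N; have h2 := hb N.+1.
    have h3 : 4^-1 ^+ N.+1 <= (4^-1 : R) ^+ N.
      by rewrite exprS ler_piMl ?exprn_ge0//; lra.
    lra.
  have -> : B = M * (2 * kappa ^+ 2 * r0 ^+ (l + 2) * 4^-1 ^+ N) * r0.
    rewrite /B; have -> : r0 ^+ (l + 3) = r0 ^+ (l + 2) * r0 by rewrite -exprSr addnS.
    ring.
  by rewrite ler_pM2r//; apply: ler_pM => //; exact: AM.
have B0 : 0 <= B.
  apply: le_trans (dwb r0 _); last by rewrite r00/=.
  by rewrite mulr_ge0// ltW.
have key e : 0 < e -> e < r -> e <= Num.min e0 r0 -> `|w N.+2 r| <= B + C * e.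
  move=> e_0 er em.
  have [|s /andP[es sr] hs] := der_MVT er (f := w N.+2) (f' := fun s => A s * (('X^2 * (bpoly N.+2)^`())^`() - lam *: bpoly N.+2 + kappa ^+ 2 *: ('X^2 * bpoly N.+2)).[s]).
    by move=> s /andP[es sr]; apply: dw; rewrite (lt_le_trans e_0)//= (le_trans sr).
  have -> : w N.+2 r = (w N.+2 r - w N.+2 e) + w N.+2 e by rewrite subrK.
  apply: le_trans (ler_normD _ _) _; apply: lerD; last by apply: hC; rewrite e_0.
  rewrite hs normrM; apply: le_trans (dwb s _); last by rewrite (lt_trans e_0)//= (le_trans (ltW sr)).
  rewrite ler_wpM2l//; rewrite ger0_norm; lra.
rewrite leNgt; apply/negP => h.
pose d := `|w N.+2 r| - B.
have d0 : 0 < d by rewrite subr_gt0.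
pose e := Num.min (Num.min (r / 2) (Num.min e0 r0)) (d / (2 * (C + 1))).
have C1 : 0 < 2 * (C + 1) by lra.
have e_0 : 0 < e by rewrite !lt_min !divr_gt0// e00 r00.
have er : e < r by apply: (@le_lt_trans _ _ (r / 2)); [rewrite !ge_min lexx|lra].
have em : e <= Num.min e0 r0 by rewrite ge_min; apply/orP; left; rewrite ge_min lexx orbT.
have ed : e * (2 * (C + 1)) <= d by rewrite -ler_pdivlMr// ge_min lexx orbT.
have := key e e_0 er em.
have : C * e <= e * (2 * (C + 1)) / 2 by rewrite mulrC; have := ltW e_0; lra.
by move: ed d0; rewrite /d; lra.
Qed.

(** The quotient of [A] by the truncated series has derivative [- w / (s * j) ^+ 2], which tends to
    zero geometrically in [N]; in the limit [A] is proportional to r^l times the full series. The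
    constant is fixed at [r0], where the series is at least 1/2, whence the factor 2 in its
    bound. *)
Lemma bessel_form : exists2 c, `|c| <= 2 * `|A r0| / r0 ^+ l &
  forall r N, 0 < r <= r0 -> `|A r - c * (r ^+ l * psum bcoef N r)| <= 2 * `|c| * r ^+ l * (kappa / 2 * r) ^+ N.
Proof.
(* [K r] is the sum of the series on ]0, r0], with an arbitrary value elsewhere. *)
have Klim r : exists K, 0 < r <= r0 -> forall N, `|K - psum bcoef N r| <= 2 * (kappa / 2 * r) ^+ N.
  have [/andP[r_0 rr]|nr] := boolP (0 < r <= r0); last by exists 0.
  pose q := kappa / 2 * r.
  have q0 : 0 <= q by rewrite mulr_ge0 ?divr_ge0// ltW.
  have q4 : q <= 4^-1.
    have : kappa * r <= kappa * r0 by rewrite ler_pM2l.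
    by rewrite /q; move: kr0; lra.
  have q01 : 0 <= q < 1 by rewrite q0/=; lra.
  have hu n : `|bcoef n * r ^+ n| <= 1 * q ^+ n.
    rewrite normrM (ger0_norm (exprn_ge0 _ (ltW r_0))) mul1r exprMn.
    by rewrite ler_wpM2r ?exprn_ge0 ?(ltW r_0)// bcoef_le.
  have [K hK] := geometric_series_limit q01 hu.
  exists K => _ N; apply: le_trans (hK N) _; rewrite mul1r mulrC ler_wpM2r ?exprn_ge0//.
  rewrite -[leRHS]invrK lef_pV2 ?posrE ?invr_gt0//; lra.
have [K hK] := choice Klim.
have r0r0 : 0 < r0 <= r0 by rewrite r00/=.
have K2 r : 0 < r <= r0 -> 2^-1 <= K r.
  move=> hr; have /andP[r_0 rr] := hr.
  have q4 : kappa * r <= 2^-1 by apply: le_trans kr0; rewrite ler_pM2l.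
  rewrite leNgt; apply/negP => h.
  have q01 : 0 <= kappa / 2 * r < 1.
    by apply/andP; split; [rewrite mulr_ge0 ?divr_ge0// ltW|lra].
  have : 2^-1 - K r <= 0.
    apply: (@le0_of_geometric _ _ 3 (kappa / 2 * r) q01) => -[|N].
      by have := hK r hr 0%N; rewrite expr0 ler_norml /psum big_geq//; lra.
    have y0 : 0 <= (kappa / 2 * r) ^+ N.+1 by case/andP: q01 => ? _; exact: exprn_ge0.
    by have := hK r hr N.+1; have := bpsum_ge N (ltW r_0) q4; rewrite ler_norml; lra.
  lra.
have cross r : 0 < r <= r0 -> A r * (r0 ^+ l * K r0) = A r0 * (r ^+ l * K r).
  move=> hr; have /andP[r_0 rr] := hr.
  have [->|rne] := eqVneq r r0; first by [].
  have {}rr : r < r0 by rewrite lt_neqAle rne.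
  pose j N s := (bpoly N).[s].
  have jE N s : j N s = s ^+ l * psum bcoef N s by exact: horner_bpoly.
  have krs s : 0 < s <= r0 -> kappa * s <= 2^-1.
    by move=> /andP[_ s1]; apply: le_trans kr0; rewrite ler_pM2l.
  have jge N s : r <= s <= r0 -> r ^+ l / 2 <= j N.+1 s.
    move=> /andP[rs sr]; rewrite jE; apply: ler_pM => //; first by rewrite exprn_ge0// ltW.
      by rewrite lerXn2r// ?nnegrE ltW// (lt_le_trans r_0).
    by apply: bpsum_ge; [rewrite ltW// (lt_le_trans r_0)|apply: krs; rewrite (lt_le_trans r_0)].
  have jle N s : 0 < s <= r0 -> `|j N s| <= 4 * r0 ^+ l.
    move=> hs; have /andP[s0 sr] := hs; rewrite jE normrM mulrC.
    apply: ler_pM => //.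
      have q01 : 0 <= kappa / 2 * s <= 1.
        by apply/andP; split; [rewrite mulr_ge0 ?divr_ge0// ltW|have := krs s hs; lra].
      have h0 := hK s hs 0%N; rewrite /psum big_geq// subr0 expr0 mulr1 in h0.
      have := hK s hs N; have : (kappa / 2 * s) ^+ N <= 1 by case/andP: q01 => ? ?; exact: exprn_ile1.
      by move: h0; rewrite !ler_norml /psum; lra.
    by rewrite ger0_norm ?exprn_ge0 ?(ltW s0)// lerXn2r// nnegrE ltW.
  have rl0 : 0 < r ^+ l by rewrite exprn_gt0.
  have dq N s : r <= s <= r0 -> is_derive s 1 (fun s => A s / j N.+2 s)
      (- w N.+2 s / (s * j N.+2 s) ^+ 2).
    move=> hs; have /andP[rs sr] := hs; have s0 : 0 < s by apply: lt_le_trans rs.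
    have hs' : 0 < s <= r0 by rewrite s0.
    have jn0 : j N.+2 s != 0.
      by rewrite gt_eqF// (lt_le_trans _ (jge _ _ hs))// divr_gt0.
    apply: (is_derive_eq (derM (dA hs') (derV jn0 (is_derive_poly _ _)))).
    rewrite /w hornerM hornerXn -/(j N.+2 s); field.
    by rewrite jn0 gt_eqF.
  pose D := 2 * kappa ^+ 2 * M * r0 ^+ (l + 3) / (r * (r ^+ l / 2)) ^+ 2 * r0 * (4 * r0 ^+ l) ^+ 2.
  have hN N : `|A r * j N.+2 r0 - A r0 * j N.+2 r| <= D * 4^-1 ^+ N.
    have [s /andP[rs sr] hs] := der_MVT rr (dq N).
    have hs1 : r <= s <= r0 by rewrite !ltW.
    have s0 : 0 < s by apply: lt_trans rs.
    have hs2 : 0 < s <= r0 by rewrite s0 ltW.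
    have jr := jge N.+1 r (_ : r <= r <= r0). have jr0 := jge N.+1 r0 (_ : r <= r0 <= r0).
    have {}jr : 0 < j N.+2 r by rewrite (lt_le_trans _ (jr _)) ?divr_gt0// lexx ltW.
    have {}jr0 : 0 < j N.+2 r0 by rewrite (lt_le_trans _ (jr0 _)) ?divr_gt0// lexx ltW.
    have -> : A r * j N.+2 r0 - A r0 * j N.+2 r = - (A r0 / j N.+2 r0 - A r / j N.+2 r) * (j N.+2 r0 * j N.+2 r).
      by field; rewrite !gt_eqF.
    rewrite hs normrM normrN.
    have -> : D * 4^-1 ^+ N = ((2 * kappa ^+ 2 * M * r0 ^+ (l + 3) * 4^-1 ^+ N) / (r * (r ^+ l / 2)) ^+ 2 * r0) * (4 * r0 ^+ l) ^+ 2.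
      by rewrite /D; ring.
    apply: ler_pM => //; last first.
      by rewrite normrM expr2; apply: ler_pM => //; apply: jle; rewrite ?r00//= r_0 ltW.
    rewrite normrM; apply: ler_pM => //; last by rewrite ger0_norm; lra.
    rewrite normrM normrN; apply: ler_pM => //; first exact: w_bound.
    have js := jge N.+1 s hs1.
    have p1 : 0 < r * (r ^+ l / 2) by rewrite mulr_gt0// divr_gt0.
    have p2 : r * (r ^+ l / 2) <= s * j N.+2 s.
      by apply: ler_pM => //; [exact: ltW|rewrite divr_ge0// ltW|exact: ltW].
    rewrite ger0_norm ?invr_ge0 ?sqr_ge0// lef_pV2 ?posrE ?exprn_gt0// ?(lt_le_trans p1)//.
    by rewrite lerXn2r// nnegrE ltW// (lt_le_trans p1).
  apply/eqP; rewrite -subr_eq0 -normr_le0.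
  pose C := D + (`|A r| * r0 ^+ l * 2 + `|A r0| * r ^+ l * 2).
  apply: (@le0_of_geometric _ _ C 4^-1).
    by apply/andP; split; lra.
  move=> N.
  have -> : A r * (r0 ^+ l * K r0) - A r0 * (r ^+ l * K r) =
     (A r * j N.+2 r0 - A r0 * j N.+2 r) + (A r * r0 ^+ l) * (K r0 - psum bcoef N.+2 r0)
      - (A r0 * r ^+ l) * (K r - psum bcoef N.+2 r).
    by rewrite !jE; ring.
  have kb s : 0 < s <= r0 -> `|K s - psum bcoef N.+2 s| <= 2 * 4^-1 ^+ N.
    move=> hs; have /andP[s0 sr] := hs; apply: le_trans (hK s hs _) _.
    rewrite ler_wpM2l//; apply: (@le_trans _ _ (4^-1 ^+ N.+2)).
      apply: lerXn2r; rewrite ?nnegrE//; first by rewrite mulr_ge0 ?divr_ge0// ltW.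
      by have := krs s hs; lra.
    rewrite !exprS mulrA ler_piMl ?exprn_ge0//; lra.
  rewrite /C mulrDl mulrDl; apply: le_trans (ler_normB _ _) _.
  rewrite addrA; apply: lerD; last first.
    rewrite normrM -[leRHS]mulrA; apply: ler_pM => //; last exact: kb.
    by rewrite normrM (ger0_norm (exprn_ge0 _ (ltW r_0))).
  apply: le_trans (ler_normD _ _) _; apply: lerD; first exact: hN.
  rewrite normrM -[leRHS]mulrA; apply: ler_pM => //; last exact: kb.
  by rewrite normrM (ger0_norm (exprn_ge0 _ (ltW r00))).
pose c := A r0 / (r0 ^+ l * K r0).
have K0 := K2 r0 r0r0.
have rl0 : 0 < r0 ^+ l by rewrite exprn_gt0.
have Kp : 0 < K r0 by lra.
exists c.
  rewrite /c normrM normfV (ger0_norm (_ : 0 <= r0 ^+ l * K r0)); last by rewrite mulr_ge0// ltW.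
  rewrite -mulrA mulrCA ler_wpM2l// invfM mulrC ler_pM2r ?invr_gt0//.
  by rewrite -[leRHS]invrK lef_pV2 ?posrE ?invr_gt0//.
move=> r N hr; have /andP[r_0 rr] := hr.
have -> : A r = c * (r ^+ l * K r).
  apply: (mulIf (_ : r0 ^+ l * K r0 != 0)); first by rewrite mulf_neq0// gt_eqF.
  by rewrite cross// /c mulrAC divfK// mulf_neq0// gt_eqF.
have -> : c * (r ^+ l * K r) - c * (r ^+ l * psum bcoef N r) = c * (r ^+ l * (K r - psum bcoef N r)) by ring.
rewrite normrM [`|_ ^+ l * _|]normrM (ger0_norm (exprn_ge0 _ (ltW r_0))).
have -> : 2 * `|c| * r ^+ l * (kappa / 2 * r) ^+ N = `|c| * (r ^+ l * (2 * (kappa / 2 * r) ^+ N)) by ring.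
by rewrite ler_wpM2l// ler_wpM2l ?exprn_ge0 ?(ltW r_0)// hK.
Qed.

End Bessel.

(** * Legendre expansion on a sphere *)

Lemma sum3 (V : nmodType) (f : 'I_3 -> V) : \sum_i f i = f 0 + f 1 + f 2%:R.
Proof.
rewrite !big_ord_recl big_ord0 addr0 addrA; congr (f _ + f _ + f _); exact: val_inj.
Qed.

(** * Orthonormal frames and recovery of the value at the pole *)

Section Frames.
Variable R : realType.
Implicit Types (c a b e x v : 'rV[R]_3) (r ph al : R).

(** The completeness relation: the projections on the three vectors add up to the identity. In
    dimension 3 this is equivalent to orthonormality, and it is the form used for the trace of the
    Hessian. *)
Definition frame a b e := forall i j : 'I_3,
  a 0 i * a 0 j + b 0 i * b 0 j + e 0 i * e 0 j = (i == j)%:R.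

Lemma dotv3 x v : dotv x v = x 0 0 * v 0 0 + x 0 1 * v 0 1 + x 0 2%:R * v 0 2%:R.
Proof. by rewrite /dotv sum3. Qed.

Lemma dotv_ge0 x : 0 <= dotv x x.
Proof. by rewrite dotv3 -!expr2 !addr_ge0 ?sqr_ge0. Qed.

Lemma dotvZ r x : dotv (r *: x) (r *: x) = r ^+ 2 * dotv x x.
Proof. by rewrite !dotv3 !mxE; ring. Qed.

(** [a] and [b] are the images of the first two axes under the rotation carrying the third axis to
    [e] in the plane they span. Its formula divides by 1 + z, so the opposite pole z = -1 is treated
    apart. *)
Lemma frame_exists e : dotv e e = 1 -> exists a b, frame a b e.
Proof.
move=> h; set x := e 0 0; set y := e 0 1; set z := e 0 2%:R.
have e3 i : e 0 i = nth 0 [:: x; y; z] i.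
  by case: i => [[|[|[|//]]] hi]/=; rewrite /x /y /z; congr (e _ _); exact: val_inj.
have {}h : x ^+ 2 + y ^+ 2 + z ^+ 2 = 1 by rewrite -h dotv3 /x /y /z !expr2.
pose mk (p q s : R) : 'rV[R]_3 := \row_j nth 0 [:: p; q; s] j.
have [z1|z1] := eqVneq (1 + z) 0.
  have {z1}z1 : z = -1 by lra.
  move: h; rewrite z1 sqrrN expr1n => h.
  have /eqP : x ^+ 2 + y ^+ 2 = 0 by lra.
  rewrite paddr_eq0 ?sqr_ge0// !sqrf_eq0 => /andP[/eqP x0 /eqP y0].
  exists (mk 1 0 0), (mk 0 1 0) => i j; rewrite !mxE !e3 x0 y0 z1.
  by case: i => [[|[|[|//]]] hi]; case: j => [[|[|[|//]]] hj]; rewrite /= -?val_eqE/=; ring.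
pose w := (1 + z)^-1.
have h1 : w * (1 + z) = 1 by rewrite mulVf.
have h2 : (x ^+ 2 + y ^+ 2) * w = 1 - z.
  have -> : x ^+ 2 + y ^+ 2 = (1 - z) * (1 + z) by lra.
  by rewrite -mulrA [_ * w]mulrC h1 mulr1.
exists (mk (1 - x ^+ 2 * w) (- x * y * w) (- x)), (mk (- x * y * w) (1 - y ^+ 2 * w) (- y)) => i j.
rewrite !mxE !e3.
have d (t : R) : t ^+ 2 * (w * (1 + z) - 1) = 0 by rewrite h1 subrr mulr0.
case: i => [[|[|[|//]]] hi]; case: j => [[|[|[|//]]] hj]; rewrite /= -?val_eqE/=.
- transitivity (1 - 2 * (x ^+ 2 * w) + x ^+ 2 * w * ((x ^+ 2 + y ^+ 2) * w) + x ^+ 2); first ring.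
  by rewrite h2; have := d x; lra.
- transitivity (x * y * (1 - 2 * w + w * ((x ^+ 2 + y ^+ 2) * w))); first ring.
  by rewrite h2; transitivity (x * y * (1 - w * (1 + z))); [ring|rewrite h1; ring].
- transitivity (x * ((x ^+ 2 + y ^+ 2) * w - (1 - z))); first ring.
  by rewrite h2; ring.
- transitivity (x * y * (1 - 2 * w + w * ((x ^+ 2 + y ^+ 2) * w))); first ring.
  by rewrite h2; transitivity (x * y * (1 - w * (1 + z))); [ring|rewrite h1; ring].
- transitivity (1 - 2 * (y ^+ 2 * w) + y ^+ 2 * w * ((x ^+ 2 + y ^+ 2) * w) + y ^+ 2); first ring.
  by rewrite h2; have := d y; lra.
- transitivity (y * ((x ^+ 2 + y ^+ 2) * w - (1 - z))); first ring.
  by rewrite h2; ring.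
- transitivity (x * ((x ^+ 2 + y ^+ 2) * w - (1 - z))); first ring.
  by rewrite h2; ring.
- transitivity (y * ((x ^+ 2 + y ^+ 2) * w - (1 - z))); first ring.
  by rewrite h2; ring.
- by rewrite -h; ring.
Qed.

(** The relation says Q^T Q = 1 for the matrix Q with rows [a], [b], [e]; lengths are read on Q Q^T
    = 1. *)
Lemma frame_unit a b e : frame a b e -> dotv a a = 1.
Proof.
move=> h; pose Q : 'M[R]_3 := \matrix_(i, j) nth 0 [:: a 0 j; b 0 j; e 0 j] i.
have : Q^T *m Q = 1%:M.
  by apply/matrixP => i j; rewrite !mxE -h sum3 !mxE.
move/mulmx1C/matrixP/(_ 0 0); rewrite !mxE eqxx mulr1n => <-.
by rewrite dotv3 sum3 !mxE.
Qed.

Lemma sphN_unit a b e ph al : frame a b e -> dotv (sphN a b e ph al) (sphN a b e ph al) = 1.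
Proof.
by move=> h; apply: (@frame_unit _ (sphT a b e ph al) (sphM a b ph)) => i j; exact: sph_frame.
Qed.

Lemma sphX_pole c a b e r ph : sphX c a b e r ph 0 = c + r *: e.
Proof. by rewrite /sphX /sphN sin0 cos0 !mul0r !scale0r !add0r scale1r. Qed.

Section SphereExpansion.
Variables (u : 'rV[R]_3 -> R) (c a b e : 'rV[R]_3) (r : R).
Hypothesis cu : forall ph al, {for sphX c a b e r ph al, continuous u}.

Let jX : jcont (fun ph al => u (sphX c a b e r ph al)).
Proof.
move=> p; apply: (@continuous_comp _ _ _ (fun p : R * R => (r, p.1, p.2))
  (fun p : R * R * R => u (sphX c a b e p.1.1 p.1.2 p.2)) p).
  apply: continuous_pair; last exact: cvg_snd.
  by apply: continuous_pair; [exact: cvg_cst|exact: cvg_fst].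
apply: (@continuous_comp _ _ _ (fun p : R * R * R => sphX c a b e p.1.1 p.1.2 p.2) u).
  exact: continuous_sphX.
exact: cu.
Qed.

Lemma jcont_sphA0 l : jcont (sphA0 u c a b e l r).
Proof.
apply: jcontM => //; apply: jcont_snd => x.
by apply: cvgM; [exact: continuous_polycos|exact: continuous_sin].
Qed.

Lemma sphA0_le (B : R) l : (forall ph al, `|u (sphX c a b e r ph al)| <= B) ->
  `|dblInt (sphA0 u c a b e l r)| <= B * pi * (pi *+ 2).
Proof.
move=> hB; apply: dblInt_le; first exact: jcont_sphA0.
move=> ph al _; rewrite -[leRHS]mulr1 normrM; apply: ler_pM => //.
rewrite normrM -[leRHS]mulr1; apply: ler_pM => //; first exact: legcos_le1.
by rewrite ler_norml sin_geN1 sin_le1.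
Qed.

(** First integrate over the longitude: the result is a function of the colatitude alone, and at
    angle 0 the circle shrinks to the pole, where it gives 2 pi times the value of [u]. Then apply
    the one-variable Legendre expansion. *)
Lemma sphere_expansion (K q : R) : 0 <= q < 1 ->
  (forall n, `|dblInt (sphA0 u c a b e n r) / legnorm R n| <= K * q ^+ n) ->
  forall m, `|(pi *+ 2) * u (c + r *: e) -
    \sum_(0 <= n < m) dblInt (sphA0 u c a b e n r) / legnorm R n| <= K * q ^+ m / (1 - q).
Proof.
move=> q01 hK m.
pose g al := Int 0 (pi *+ 2) (fun ph => u (sphX c a b e r ph al)).
have g0 : g 0 = pi *+ 2 * u (c + r *: e).
  rewrite /g (@eq_Int _ _ _ _ (fun=> u (c + r *: e))); last by move=> ph _; rewrite sphX_pole.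
  by rewrite Int_cst ?pi2_ge0// subr0 mulrC.
have cg : continuous g.
  apply: (@jcont_Int _ (fun al ph => u (sphX c a b e r ph al))) => p.
  apply: (@continuous_comp _ _ _ (fun p : R * R => (p.2, p.1)) (fun p => u (sphX c a b e r p.1 p.2))).
    by apply: continuous_pair; [exact: cvg_snd|exact: cvg_fst].
  exact: jX.
have hb n : Int 0 pi (fun al => g al * legcos n al * sin al) = dblInt (sphA0 u c a b e n r).
  rewrite dblInt_swap; last exact: jcont_sphA0.
  apply: eq_Int => al _; rewrite -mulrA mulrC /g -IntZ; last exact: (@jcont_l _ (fun ph al => u (sphX c a b e r ph al))).
  by apply: eq_Int => ph _; rewrite /sphA0 mulrC.
rewrite -g0; have := @legendre_expansion R g K q cg q01.
move=> /(_ _ m); under eq_bigr do rewrite hb; apply.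
by move=> n; rewrite hb.
Qed.

End SphereExpansion.

End Frames.

Lemma legnorm_gt0 (R : realType) l : 0 < legnorm R l.
Proof. by apply: lt_le_trans (legnorm_ge R l); rewrite invr_gt0 mulr_gt0// exprn_gt0. Qed.

(** The quadratic growth of the inverse norm is traded for 2^l, since only geometric rates are
    compared later. *)
Lemma legnormV_le (R : realType) l : (legnorm R l)^-1 <= 32 * 2 ^+ l.
Proof.
have p : 0 < 8 * l.+1%:R ^+ 2 :> R by rewrite mulr_gt0// exprn_gt0.
apply: (@le_trans _ _ (8 * l.+1%:R ^+ 2)).
  by rewrite -[leRHS]invrK lef_pV2 ?posrE ?invr_gt0 ?legnorm_gt0// legnorm_ge.
rewrite -natrX -!natrM -natrX -natrM ler_nat.
case: l {p} => [|[|l]]//; elim: l => // l.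
rewrite [(2 ^ l.+3)%N]expnS [(l.+4 ^ 2)%N]expnS [(l.+3 ^ 2)%N]expnS !expn1; nia.
Qed.

(** * Power series and gradient bound inside a ball *)

Section Interior.
Variables (R : realType) (U : set 'rV[R]_3) (u : 'rV[R]_3 -> R) (kappa : R).
Hypotheses (oU : open U) (cu : class_C 2 U u) (k0 : 0 < kappa).
Hypothesis helm : forall x, U x ->
  \sum_i 'D_('e_ i) ('D_('e_ i) u) x = - kappa ^+ 2 * u x.

(** The [l]-th mode is c_l r^l (1 + ...) with c_l of order r0^-l. With the 2^l of the Legendre norm,
    (2 / r0)^l = 2^-l (4 / r0)^l yields both a summable weight and the rate 4 / r0 = 8 / rho, so the
    length is half the inverse rate. The constant is 32 * 2 from the norm and from c_l, doubled by
    the remainder of [bessel_form] and again by [germ_series]. *)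
Lemma interior_germ c e (rho B : R) : dotv e e = 1 -> 0 < rho -> kappa * rho <= 1 ->
  (forall x, dotv (x - c) (x - c) < rho ^+ 2 -> U x /\ `|u x| <= B) ->
  exists a, germ (fun s => u (c + s *: e)) a (256 * pi * B) (8 / rho) (rho / 16).
Proof.
move=> e1 rho0 krho hB.
have [a [b fr]] := frame_exists e1.
pose J := [set r : R | `|r| < rho].
have hX r ph al : J r -> U (sphX c a b e r ph al) /\ `|u (sphX c a b e r ph al)| <= B.
  move=> Jr; apply: hB; rewrite /sphX addrAC subrr add0r dotvZ sphN_unit// mulr1.
  by rewrite -[r ^+ 2]real_normK ?num_real// ltrXn2r// nnegrE ltW.
have JU r ph al : J r -> U (sphX c a b e r ph al) by move=> /hX -/(_ ph al)[].
have oJ : open J.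
  have -> : J = ball (0 : R) rho by apply/seteqP; split=> x; rewrite /J -ball_normE/= sub0r normrN.
  exact: ball_open.
pose A l r := dblInt (sphA0 u c a b e l r).
pose A1 l r := dblInt (sphA1 u c a b e l r).
pose A2 l r := dblInt (sphA2 u c a b e l r).
have pi0 := pi_gt0 R.
pose r0 := rho / 2.
have r00 : 0 < r0 by rewrite divr_gt0.
have Jr0 r : 0 < r <= r0 -> J r.
  by move=> /andP[h1 h2]; rewrite /J/= gtr0_norm//; move: h2; rewrite /r0; lra.
have ucX r ph al : J r -> {for sphX c a b e r ph al, continuous u}.
  by move=> Jr; case: cu => h _; apply: h; exact: JU.
have J0 : J 0 by rewrite /J/= normr0.
have B0 : 0 <= B by apply: le_trans (hX 0 0 0 J0).2.
have AB l r : J r -> `|A l r| <= B * pi * (pi *+ 2).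
  move=> Jr; apply: sphA0_le; first by move=> ph al; exact: ucX.
  by move=> ph al; exact: (hX _ _ _ Jr).2.
have bes l : exists c0, `|c0| <= 2 * (B * pi * (pi *+ 2)) / r0 ^+ l /\
  forall r N, 0 < r <= r0 -> `|A l r - c0 * (r ^+ l * psum (bcoef kappa l) N r)| <= 2 * `|c0| * r ^+ l * (kappa / 2 * r) ^+ N.
  have dA := @der_sphA0 R U u oU cu c a b e J oJ JU l.
  have dA1 := @der_sphA1 R U u oU cu c a b e J oJ JU l.
  have [e0 e00 he0] : exists2 e0, 0 < e0 & forall r, 0 < r <= e0 -> `|A1 l r| <= `|A1 l 0| + 1.
    have cA1 : {for (0 : R), continuous (A1 l)} := der_continuous (dA1 0 J0).
    have : \forall r \near (0 : R), `|A1 l 0 - A1 l r| < 1 by move/cvgrPdist_lt: cA1; apply.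
    move=> /nbhs_ballP[d /= d0 hd]; exists (d / 2); first by rewrite divr_gt0.
    move=> r /andP[h1 h2]; have := hd r; rewrite /ball/= sub0r normrN gtr0_norm// => h3.
    have -> : A1 l r = A1 l 0 - (A1 l 0 - A1 l r) by rewrite opprB addrC subrK.
    apply: le_trans (ler_normB _ _) _; rewrite lerD2l ltW// h3//; lra.
  (* This bound is not uniform in [l], which is harmless: the conclusion of [bessel_form] involves
     only the value of the mode at [r0]. *)
  pose M := Num.max (B * pi * (pi *+ 2)) (`|A1 l 0| + 1).
  have [|r hr|r hr|r hr|r hr|r hr|c0 h1 h2] := @bessel_form R kappa l k0 (A l) (A1 l) (A2 l) r0 M e0 r00 _ e00.
  - by rewrite /r0; lra.
  - by apply: dA; exact: Jr0.
  - by apply: dA1; exact: Jr0.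
  - by apply: (sphA_ode oU cu helm fr JU); exact: Jr0.
  - by rewrite le_max AB//; exact: Jr0.
  - by rewrite le_max he0// orbT.
  exists c0; split=> //; apply: le_trans h1 _.
  rewrite ler_wpM2r ?invr_ge0 ?exprn_ge0 ?(ltW r00)// ler_wpM2l// AB//; apply: Jr0.
  by rewrite r00/=.
have [cc hcc] := choice bes.
pose n l := (legnorm R l)^-1.
have n0 l : 0 < n l by rewrite invr_gt0 legnorm_gt0.
have p2V : `|(pi *+ 2)^-1 : R| = (pi *+ 2)^-1 by rewrite ger0_norm// invr_ge0 pi2_ge0.
pose E := 128 * pi * B.
have E0 : 0 <= E by rewrite !mulr_ge0// ltW.
have s0 : 0 < 4 / r0 by rewrite divr_gt0.
pose F l t := n l * A l t / (pi *+ 2).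
pose coef l m := if (m < l)%N then 0 else n l * cc l / (pi *+ 2) * bcoef kappa l (m - l).
have ncc l : n l * `|cc l| / (pi *+ 2) <= 64 * pi * B * 2 ^+ l / r0 ^+ l.
  have [h1 _] := hcc l.
  have h2 := legnormV_le R l.
  apply: (@le_trans _ _ ((32 * 2 ^+ l) * (2 * (B * pi * (pi *+ 2)) / r0 ^+ l) / (pi *+ 2))).
    rewrite ler_wpM2r ?invr_ge0 ?pi2_ge0//.
    by apply: ler_pM => //; exact: ltW.
  rewrite (_ : 32 * 2 ^+ l * _ / _ = 64 * pi * B * 2 ^+ l / r0 ^+ l)//.
  have p2 : pi *+ 2 != 0 :> R by rewrite lt0r_neq0// mulrn_wgt0.
  have -> : 32 * 2 ^+ l * (2 * (B * pi * (pi *+ 2)) / r0 ^+ l) / (pi *+ 2) =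
    64 * pi * B * 2 ^+ l / r0 ^+ l * (pi *+ 2 / (pi *+ 2)) by ring.
  by rewrite divff// mulr1.
have kr0 : kappa / 2 <= r0^-1.
  rewrite -[leRHS]mul1r ler_pdivlMr// /r0; lra.
have p24 l : (2 : R) ^+ l = 2^-1 ^+ l * 4 ^+ l.
  by rewrite -exprMn; congr (_ ^+ _); lra.
have nb l m t : 0 <= t -> (l <= m)%N ->
    n l * `|cc l| / (pi *+ 2) * t ^+ l * (t / r0) ^+ (m - l) <= 64 * pi * B * 2^-1 ^+ l * (4 / r0 * t) ^+ m.
  move=> t0 lm.
  apply: (@le_trans _ _ (64 * pi * B * 2 ^+ l / r0 ^+ l * t ^+ l * (t / r0) ^+ (m - l))).
    apply: ler_wpM2r; first by rewrite exprn_ge0// divr_ge0// ltW.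
    by rewrite ler_wpM2r// exprn_ge0.
  have -> : 64 * pi * B * 2 ^+ l / r0 ^+ l * t ^+ l * (t / r0) ^+ (m - l) = 64 * pi * B * 2^-1 ^+ l * (4 ^+ l * (t / r0) ^+ m).
    have -> : (t / r0) ^+ m = t ^+ l / r0 ^+ l * (t / r0) ^+ (m - l).
      by rewrite -exprVn -exprMn -exprD subnKC.
    by rewrite p24; ring.
  rewrite ler_wpM2l//; first by rewrite !mulr_ge0 ?exprn_ge0// ltW.
  have -> : 4 / r0 * t = 4 * (t / r0) by ring.
  rewrite [(4 * _) ^+ m]exprMn; apply: ler_wpM2r.
    by rewrite exprn_ge0// divr_ge0// ltW.
  by apply: ler_weXn2l => //; lra.
have Jt t : 0 < t <= rho / 16 -> 0 < t <= r0.
  by move=> /andP[h1 h2]; rewrite h1/=; move: h2; rewrite /r0; lra.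
have hF l N t : 0 < t <= rho / 16 -> `|F l t - psum (coef l) N t| <= E * 2^-1 ^+ l * (4 / r0 * t) ^+ N.
  move=> ht; have ht0 := Jt _ ht; have /andP[t0 _] := ht0; have t0' := ltW t0.
  have [_ h2] := hcc l.
  (* Below degree [l] the truncation is zero, so the mode itself must be estimated; it is of order
     (4 t / r0)^l, and 4 t / r0 <= 1 lowers the exponent to [N]. *)
  have [Nl|lN] := ltnP N l.
    have -> : psum (coef l) N t = 0.
      rewrite /psum big_nat big1// => m /andP[_ mN]; rewrite /coef (ltn_trans mN Nl) mul0r//.
    rewrite subr0 /F; have := h2 t 0%N ht0.
    rewrite /psum big_geq// !mulr0 subr0 expr0 mulr1 => h3.
    rewrite [`|_ / _|]normrM [`|n l * _|]normrM (gtr0_norm (n0 l)) p2V.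
    apply: (@le_trans _ _ (2 * (n l * `|cc l| / (pi *+ 2) * t ^+ l * (t / r0) ^+ (l - l)))).
      rewrite subnn expr0 mulr1.
      have -> : 2 * (n l * `|cc l| / (pi *+ 2) * t ^+ l) = n l * (2 * `|cc l| * t ^+ l) / (pi *+ 2) by ring.
      by rewrite ler_wpM2r ?invr_ge0 ?pi2_ge0// ler_wpM2l// ltW.
    have -> : E * 2^-1 ^+ l * (4 / r0 * t) ^+ N = 2 * (64 * pi * B * 2^-1 ^+ l * (4 / r0 * t) ^+ N) by rewrite /E; ring.
    rewrite ler_wpM2l//; apply: le_trans (nb l l t t0' (leqnn l)) _.
    rewrite ler_wpM2l//; first by rewrite !mulr_ge0 ?exprn_ge0// ltW.
    have q0 : 0 <= 4 / r0 * t by rewrite mulr_ge0// ltW.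
    have q1 : 4 / r0 * t <= 1.
      have {}ht : t <= rho / 16 by case/andP: ht.
      rewrite mulrAC ler_pdivrMr// /r0; lra.
    by apply: ler_wiXn2l => //; exact: ltnW.
  have -> : psum (coef l) N t = n l * cc l / (pi *+ 2) * t ^+ l * psum (bcoef kappa l) (N - l) t.
    rewrite /psum (big_cat_nat (leq0n l) lN)/= big_nat big1 ?add0r; last first.
      by move=> m /andP[_ ml]; rewrite /coef ml mul0r.
    rewrite -[X in \sum_(X <= _ < N) _]add0n big_addn mulr_sumr; apply: eq_bigr => m _.
    rewrite /coef ltnNge leq_addl/= addnK exprD; ring.
  have -> : F l t - n l * cc l / (pi *+ 2) * t ^+ l * psum (bcoef kappa l) (N - l) t =
    n l / (pi *+ 2) * (A l t - cc l * (t ^+ l * psum (bcoef kappa l) (N - l) t)) by rewrite /F; ring.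
  rewrite normrM ger0_norm; last by rewrite divr_ge0 ?pi2_ge0// ltW.
  apply: (@le_trans _ _ (2 * (n l * `|cc l| / (pi *+ 2) * t ^+ l * (t / r0) ^+ (N - l)))).
    have -> : 2 * (n l * `|cc l| / (pi *+ 2) * t ^+ l * (t / r0) ^+ (N - l)) =
       n l / (pi *+ 2) * (2 * `|cc l| * t ^+ l * (t / r0) ^+ (N - l)) by ring.
    rewrite ler_wpM2l ?divr_ge0 ?pi2_ge0 ?(ltW (n0 _))//.
    apply: le_trans (h2 t _ ht0) _; rewrite ler_wpM2l ?mulr_ge0 ?exprn_ge0//.
    apply: lerXn2r; rewrite ?nnegrE ?mulr_ge0 ?divr_ge0 ?invr_ge0 ?(ltW k0) ?(ltW r00)//.
    by rewrite mulrC ler_wpM2l.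
  have -> : E * 2^-1 ^+ l * (4 / r0 * t) ^+ N = 2 * (64 * pi * B * 2^-1 ^+ l * (4 / r0 * t) ^+ N) by rewrite /E; ring.
  by rewrite ler_wpM2l// nb.
have hc l m : `|coef l m| <= E * 2^-1 ^+ l * (4 / r0) ^+ m.
  rewrite /coef; case: ltnP => lm.
    by rewrite normr0 !mulr_ge0 ?exprn_ge0// ltW.
  rewrite normrM; apply: (@le_trans _ _ (n l * `|cc l| / (pi *+ 2) * 1 ^+ l * (1 / r0) ^+ (m - l))).
    rewrite expr1n mulr1 [`|_ / _|]normrM [`|n l * _|]normrM (gtr0_norm (n0 l)) p2V div1r.
    apply: ler_wpM2l; first by rewrite divr_ge0 ?pi2_ge0// mulr_ge0// ltW.
    apply: le_trans (bcoef_le l k0 _) _.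
    by rewrite lerXn2r ?nnegrE ?invr_ge0 ?divr_ge0// ltW.
  apply: le_trans (nb l m 1 ler01 lm) _; rewrite mulr1 /E.
  have : 0 <= 64 * pi * B * 2^-1 ^+ l * (4 / r0) ^+ m.
    by rewrite !mulr_ge0 ?exprn_ge0// ltW.
  lra.
have -> : 256 * pi * B = 2 * E by rewrite /E; ring.
have -> : 8 / rho = 4 / r0 by rewrite /r0; field; rewrite lt0r_neq0.
apply: (@germ_series _ F coef _ E (2 * E)) => //.
  by rewrite (_ : 4 / r0 * (rho / 16) = 2^-1)// /r0; field; rewrite lt0r_neq0.
move=> N t ht; have ht0 := Jt _ ht.
have h20 : (0 : R) <= 2^-1 by lra. have h21 : (2^-1 : R) < 1 by lra.
have h2 : (0 : R) <= (2^-1 : R) < 1.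
  by apply/andP; split.
have := @sphere_expansion R u c a b e t (fun ph al => ucX t ph al (Jr0 _ ht0)) (pi *+ 2 * E) 2^-1 h2.
have FE l : A l t / legnorm R l = pi *+ 2 * F l t.
  by rewrite /F [RHS]mulrC divfK ?(mulrC (A l t))// lt0r_neq0// mulrn_wgt0.
have hb l : `|dblInt (sphA0 u c a b e l t) / legnorm R l| <= pi *+ 2 * E * 2^-1 ^+ l.
  rewrite -/(A l t) FE normrM (ger0_norm (pi2_ge0 R)) -mulrA ler_wpM2l ?pi2_ge0//.
  by have := hF l 0%N t ht; rewrite /psum big_geq// subr0 expr0 mulr1.
move=> /(_ hb N); under eq_bigr do rewrite -/(A _ t) FE.
rewrite -mulr_sumr -mulrBr normrM (ger0_norm (pi2_ge0 R)).
have -> : pi *+ 2 * E * 2^-1 ^+ N / (1 - 2^-1) = pi *+ 2 * (2 * E * 2^-1 ^+ N) by field.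
by rewrite ler_pM2l// mulrn_wgt0.
Qed.

(** The truncation of order 1 gives |u(c + t e) - u(c)| <= E s t, with E s = (256 pi B) (8 / rho);
    this bounds the directional derivative. *)
Lemma interior_gradient c e (rho B : R) : dotv e e = 1 -> 0 < rho -> kappa * rho <= 1 ->
  (forall x, dotv (x - c) (x - c) < rho ^+ 2 -> U x /\ `|u x| <= B) ->
  `|grd u e c| <= 2048 * pi * B / rho.
Proof.
move=> e1 rho0 krho hB.
have [a [E0 s0 sd ha hf]] := interior_germ e1 rho0 krho hB.
set E := 256 * pi * B in E0 ha hf; set s := 8 / rho in s0 sd ha hf.
have Uc : U c by apply: (hB c _).1; rewrite subrr dotv3 !mxE !mulr0 !addr0 exprn_gt0.
have df : is_derive (0 : R) 1 (fun t => u (c + t *: e)) (grd u e c).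
  have := @der_u_curve R U u oU cu (fun t => c + t *: e) 0 e.
  rewrite scale0r addr0; apply => // i.
  apply: (@der_ext _ (fun s => c 0 i + s * e 0 i)); first by near=> t; rewrite !mxE.
  apply: (is_derive_eq (derD (der_cst _ _) (derM (is_derive_id _ _) (der_cst _ _)))).
  by rewrite mulr0 addr0 mul1r add0r.
have cf : {for (0 : R), continuous (fun t : R => u (c + t *: e))} := der_continuous df.
have d0 : 0 < rho / 16 by rewrite divr_gt0.
have h1 t : 0 < t <= rho / 16 -> `|u (c + t *: e) - a 0%N| <= E * s * t.
  move=> ht; have := hf 1%N t ht; rewrite /psum big_nat1 expr0 mulr1 expr1.
  by rewrite mulrA.
(* A germ says nothing at [t = 0]; continuity of [u] identifies the constant coefficient. *)
have a0 : a 0%N = u c.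
  apply/eqP; rewrite -subr_eq0 -normr_le0 leNgt; apply/negP => h.
  move/cvgrPdist_lt: cf => /(_ _ (divr_gt0 h (ltr0n _ 2))); rewrite scale0r addr0 => /nbhs_ballP[d /= dd hd].
  pose t := Num.min (Num.min (d / 2) (rho / 16)) (`|a 0%N - u c| / (2 * (E * s + 1))).
  have Es : 0 <= E * s by rewrite mulr_ge0// ltW.
  have q0 : 0 < 2 * (E * s + 1) by lra.
  have t0 : 0 < t by rewrite !lt_min !divr_gt0.
  have t1 : t <= d / 2 by rewrite /t ge_min; apply/orP; left; rewrite ge_min lexx.
  have t2 : t <= rho / 16 by rewrite /t ge_min; apply/orP; left; rewrite ge_min lexx orbT.
  have t3 : t * (2 * (E * s + 1)) <= `|a 0%N - u c| by rewrite -ler_pdivlMr// /t ge_min lexx orbT.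
  have h2 := h1 t; rewrite t0 t2 in h2; have {}h2 := h2 isT.
  have h3 := hd t; rewrite /ball/= sub0r normrN gtr0_norm// in h3.
  have {}h3 : `|u c - u (c + t *: e)| < `|a 0%N - u c| / 2 by apply: h3; lra.
  have := ler_distD (u (c + t *: e)) (a 0%N) (u c).
  rewrite [`|a 0%N - u (c + _)|]distrC [`|u (c + _) - u c|]distrC.
  lra.
have -> : 2048 * pi * B / rho = E * s by rewrite /E /s; ring.
case: df => dd <-.
rewrite leNgt; apply/negP => h; move: (dd) => /cvg_ex[g hg].
have ge : g = 'D_1 (fun t : R => u (c + t *: e)) 0 by rewrite /derive; apply/esym/cvg_lim.
move: h; rewrite -ge => h.
have h' : 0 < `|g| - E * s by lra.
move/cvgrPdist_lt: hg => /(_ _ h') /nbhs_ballP[d /= dd0 hd].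
pose t := Num.min (d / 2) (rho / 16).
have t0 : 0 < t by rewrite !lt_min !divr_gt0.
have t1 : t <= d / 2 by rewrite /t ge_min lexx.
have t2 : t <= rho / 16 by rewrite /t ge_min lexx orbT.
have td : ball (0 : R) d t by rewrite /ball/= sub0r normrN gtr0_norm//; lra.
have {hd} := hd t td (lt0r_neq0 t0); rewrite addr0 scale0r addr0 [t *: 1]mulr1.
have := h1 t; rewrite t0 t2 a0 => /(_ isT) h2.
have h3 : `|t^-1 *: (u (c + t *: e) - u c)| <= E * s.
  by rewrite normrM gtr0_norm ?invr_gt0// mulrC ler_pdivrMr.
have := lerB_dist g (t^-1 *: (u (c + t *: e) - u c)).
lra.
Unshelve. all: by end_near. Qed.

End Interior.

(** * Outgoing radial solutions *)

Lemma poly_bound01 (R : realType) (p : {poly R}) :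
  exists2 K, 0 <= K & forall t, 0 <= t <= 1 -> `|p.[t]| <= K.
Proof.
exists (\sum_(i < size p) `|p`_i|); first exact: sumr_ge0.
move=> t /andP[t0 t1]; rewrite horner_coef; apply: le_trans (ler_norm_sum _ _ _) _.
apply: ler_sum => i _; rewrite normrM -[leRHS]mulr1 ler_wpM2l// ger0_norm ?exprn_ge0//.
exact: exprn_ile1.
Qed.

Lemma poly_lipschitz0 (R : realType) (p : {poly R}) :
  exists2 K, 0 <= K & forall t, 0 <= t <= 1 -> `|p.[t] - p.[0]| <= K * t.
Proof.
have [q hq] : exists q, p - p.[0]%:P = q * 'X.
  have /factor_theorem[q ->] : root (p - p.[0]%:P) 0.
    by rewrite /root hornerD hornerN hornerC subrr.
  by exists q; rewrite subr0.
have [K K0 hK] := poly_bound01 q; exists K => // t t01; have /andP[t0 _] := t01.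
have -> : p.[t] - p.[0] = (p - p.[0]%:P).[t] by rewrite hornerD hornerN hornerC.
by rewrite hq hornerM hornerX normrM (ger0_norm t0) ler_wpM2r// hK.
Qed.

Section Radial.
Variables (R : realType) (kappa : R) (l : nat).
Hypothesis k0 : 0 < kappa.

Let lam : R := (l * l.+1)%:R.
Let P := hP kappa l.
Let Q := hQ kappa l.

(* Real and imaginary parts of the outgoing solution [e ^ (i kappa r) (P + i Q)(1 / r)]
   of [v'' = (lam / r ^ 2 - kappa ^ 2) v], and their derivatives. *)
Definition outRe (r : R) : R := cos (kappa * r) * P.[r^-1] - sin (kappa * r) * Q.[r^-1].
Definition outIm (r : R) : R := sin (kappa * r) * P.[r^-1] + cos (kappa * r) * Q.[r^-1].
Let p1 (r : R) : R := - ('X^2 * P^`()).[r^-1].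
Let q1 (r : R) : R := - ('X^2 * Q^`()).[r^-1].
Definition outRe1 (r : R) : R := cos (kappa * r) * (p1 r - kappa * Q.[r^-1]) - sin (kappa * r) * (q1 r + kappa * P.[r^-1]).
Definition outIm1 (r : R) : R := sin (kappa * r) * (p1 r - kappa * Q.[r^-1]) + cos (kappa * r) * (q1 r + kappa * P.[r^-1]).

Let der_inv (p : {poly R}) (r : R) : 0 < r -> is_derive r 1 (fun r => p.[r^-1]) (- ('X^2 * p^`()).[r^-1]).
Proof.
move=> r0; apply: (is_derive_eq (der_comp (is_derive_poly p r^-1) (derV (lt0r_neq0 r0) (is_derive_id _ _)))).
by rewrite hornerM hornerXn exprVn; ring.
Qed.

Let der_coskr (r : R) : is_derive r 1 (fun r : R => cos (kappa * r)) (- kappa * sin (kappa * r)).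
Proof.
apply: (is_derive_eq (der_comp (is_derive_cos _) (derZ kappa (is_derive_id _ _)))); ring.
Qed.

Let der_sinkr (r : R) : is_derive r 1 (fun r : R => sin (kappa * r)) (kappa * cos (kappa * r)).
Proof.
apply: (is_derive_eq (der_comp (is_derive_sin _) (derZ kappa (is_derive_id _ _)))); ring.
Qed.

Let der_p1 (r : R) : 0 < r -> is_derive r 1 p1 (lam * (r^-1 ^+ 2) * P.[r^-1] + 2 * kappa * q1 r).
Proof.
move=> r0; apply: (is_derive_eq (derN (der_inv _ r0))).
have -> : ('X^2 * P^`())^`() = lam *: P - (2 * kappa) *: Q^`() by rewrite -(hP_ode l k0) addrK.
rewrite /q1 !(hornerM, hornerX, hornerD, hornerN, hornerZ); ring.
Qed.

Let der_q1 (r : R) : 0 < r -> is_derive r 1 q1 (lam * (r^-1 ^+ 2) * Q.[r^-1] - 2 * kappa * p1 r).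
Proof.
move=> r0; apply: (is_derive_eq (derN (der_inv _ r0))).
have -> : ('X^2 * Q^`())^`() = lam *: Q + (2 * kappa) *: P^`() by rewrite -(hQ_ode l k0) subrK.
rewrite /p1 !(hornerM, hornerX, hornerD, hornerN, hornerZ); ring.
Qed.

Lemma der_outRe (r : R) : 0 < r -> is_derive r 1 outRe (outRe1 r).
Proof.
move=> r0; apply: (is_derive_eq (derB (derM (der_coskr _) (der_inv P r0)) (derM (der_sinkr _) (der_inv Q r0)))).
by rewrite /outRe1 /p1 /q1; ring.
Qed.

Lemma der_outIm (r : R) : 0 < r -> is_derive r 1 outIm (outIm1 r).
Proof.
move=> r0; apply: (is_derive_eq (derD (derM (der_sinkr _) (der_inv P r0)) (derM (der_coskr _) (der_inv Q r0)))).
by rewrite /outIm1 /p1 /q1; ring.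
Qed.

Lemma der_outRe1 (r : R) : 0 < r -> is_derive r 1 outRe1 ((lam * (r^-1 ^+ 2) - kappa ^+ 2) * outRe r).
Proof.
move=> r0; apply: (is_derive_eq (derB (derM (der_coskr _) (derB (der_p1 r0) (derZ kappa (der_inv Q r0))))
  (derM (der_sinkr _) (derD (der_q1 r0) (derZ kappa (der_inv P r0)))))).
rewrite -/(q1 r) -/(p1 r) /outRe; ring.
Qed.

Lemma der_outIm1 (r : R) : 0 < r -> is_derive r 1 outIm1 ((lam * (r^-1 ^+ 2) - kappa ^+ 2) * outIm r).
Proof.
move=> r0; apply: (is_derive_eq (derD (derM (der_sinkr _) (derB (der_p1 r0) (derZ kappa (der_inv Q r0))))
  (derM (der_coskr _) (derD (der_q1 r0) (derZ kappa (der_inv P r0)))))).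
rewrite -/(q1 r) -/(p1 r) /outIm; ring.
Qed.

Lemma out_wronskian (r : R) : outRe r * outIm1 r - outRe1 r * outIm r = kappa.
Proof.
have := congr1 (horner^~ r^-1) (hwronskian l k0).
rewrite -/P -/Q hornerD hornerN hornerZ hornerD !expr2 hornerM [(Q * Q).[_]]hornerM.
rewrite hornerM [('X * 'X).[_]]hornerM hornerX hornerD hornerN !hornerM hornerC => h.
transitivity ((cos (kappa * r) ^+ 2 + sin (kappa * r) ^+ 2) * (P.[r^-1] * (q1 r + kappa * P.[r^-1]) - Q.[r^-1] * (p1 r - kappa * Q.[r^-1]))).
  by rewrite /outRe /outIm /outRe1 /outIm1; ring.
rewrite cos2Dsin2 mul1r -[RHS]h /p1 /q1 !hornerM !hornerX; ring.
Qed.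

Lemma out_sqr (r : R) : outRe r ^+ 2 + outIm r ^+ 2 = P.[r^-1] ^+ 2 + Q.[r^-1] ^+ 2.
Proof.
transitivity ((cos (kappa * r) ^+ 2 + sin (kappa * r) ^+ 2) * (P.[r^-1] ^+ 2 + Q.[r^-1] ^+ 2)).
  by rewrite /outRe /outIm; ring.
by rewrite cos2Dsin2 mul1r.
Qed.

(** V = r A solves V'' = (lam / r^2 - kappa^2) V. Its Wronskians with [outRe] and [outIm] are
    constant, and dividing them by the Wronskian kappa of that pair gives the coefficients of V. *)
Lemma radial_form (rho : R) (A A1 A2 : R -> R) : 0 <= rho ->
  (forall r, rho < r -> is_derive r 1 A (A1 r)) ->
  (forall r, rho < r -> is_derive r 1 A1 (A2 r)) ->
  (forall r, rho < r -> r ^+ 2 * A2 r = (lam - kappa ^+ 2 * r ^+ 2) * A r - 2 * r * A1 r) ->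
  exists al be, forall r, rho < r ->
    r * A r = al * outRe r + be * outIm r /\ A r + r * A1 r = al * outRe1 r + be * outIm1 r.
Proof.
move=> rho0 dA dA1 ode.
pose V r := r * A r. pose V1 r := A r + r * A1 r.
have pos r : rho < r -> 0 < r by exact: le_lt_trans.
have dV (r : R) : rho < r -> is_derive r 1 V (V1 r).
  move=> hr; apply: (is_derive_eq (derM (is_derive_id _ _) (dA r hr))).
  by rewrite mul1r.
have dV1 (r : R) : rho < r -> is_derive r 1 V1 ((lam * (r^-1 ^+ 2) - kappa ^+ 2) * V r).
  move=> hr; apply: (is_derive_eq (derD (dA r hr) (derM (is_derive_id _ _) (dA1 r hr)))).
  have r0 := pos r hr; have rn0 := lt0r_neq0 r0.
  apply: (mulfI rn0); have := ode r hr => h.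
  transitivity (2 * r * A1 r + r ^+ 2 * A2 r); first ring.
  by rewrite h /V; field.
pose f r := V r * outIm1 r - V1 r * outIm r.
pose g r := outRe r * V1 r - outRe1 r * V r.
have df (r : R) : rho < r -> is_derive r 1 f 0.
  move=> hr; have r0 := pos r hr.
  apply: (is_derive_eq (derB (derM (dV r hr) (der_outIm1 r0)) (derM (dV1 r hr) (der_outIm r0)))); ring.
have dg (r : R) : rho < r -> is_derive r 1 g 0.
  move=> hr; have r0 := pos r hr.
  apply: (is_derive_eq (derB (derM (der_outRe r0) (dV1 r hr)) (derM (der_outRe1 r0) (dV r hr)))); ring.
have cst (h : R -> R) (r : R) : (forall r : R, rho < r -> is_derive r 1 h 0) -> rho < r -> h r = h (rho + 1).
  move=> dh hr; apply: (@der0_cst _ _ rho (Num.max r (rho + 1) + 1)).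
  - by move=> x /andP[? _]; exact: dh.
  - by rewrite hr/= (@le_lt_trans _ _ (Num.max r (rho + 1))) ?le_max ?lexx//; lra.
  - apply/andP; split; first lra.
    by rewrite (@le_lt_trans _ _ (Num.max r (rho + 1))) ?le_max ?lexx ?orbT//; lra.
have kn0 := lt0r_neq0 k0.
exists (f (rho + 1) / kappa), (g (rho + 1) / kappa) => r hr.
rewrite -(cst f r df hr) -(cst g r dg hr) -/(V r) -/(V1 r).
have w := out_wronskian r.
split; apply: (mulfI kn0).
  transitivity ((outRe r * outIm1 r - outRe1 r * outIm r) * V r); first by rewrite w.
  by rewrite /f /g; field.
transitivity ((outRe r * outIm1 r - outRe1 r * outIm r) * V1 r); first by rewrite w.
by rewrite /f /g; field.
Qed.

(** By periodicity every phase recurs at arbitrarily large [r], so an asymptotic statement can be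
    read at a fixed angle. *)
Lemma far_phase (y r1 : R) : exists2 r, r1 < r & cos (kappa * r) = cos y /\ sin (kappa * r) = sin y.
Proof.
have p2 : 0 < pi *+ 2 :> R by rewrite mulrn_wgt0// pi_gt0.
have [n hn] : exists n : nat, (kappa * r1 - y) / (pi *+ 2) < n%:R.
  by exists (Num.bound `|(kappa * r1 - y) / (pi *+ 2)|); apply: le_lt_trans (ler_norm _) (archi_boundP _).
exists ((y + pi *+ 2 *+ n) / kappa).
  rewrite ltr_pdivlMr// mulrC -ltrBlDl; move: hn; rewrite ltr_pdivrMr// => hn.
  by rewrite -mulr_natl.
have -> : kappa * ((y + pi *+ 2 *+ n) / kappa) = y + pi *+ 2 *+ n by rewrite mulrC divfK// lt0r_neq0.
split; first exact: (periodicn (@cosD2pi R)).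
exact: (periodicn (@sinD2pi R)).
Qed.

(** [A] and [B] are the real and imaginary parts of one complex mode. The radiation condition
    removes the incoming component and leaves a complex multiple al + i be of the outgoing
    solution. *)
Lemma outgoing_form (rho : R) (A A1 A2 B B1 B2 : R -> R) : 0 <= rho ->
  (forall r, rho < r -> is_derive r 1 A (A1 r)) ->
  (forall r, rho < r -> is_derive r 1 A1 (A2 r)) ->
  (forall r, rho < r -> r ^+ 2 * A2 r = (lam - kappa ^+ 2 * r ^+ 2) * A r - 2 * r * A1 r) ->
  (forall r, rho < r -> is_derive r 1 B (B1 r)) ->
  (forall r, rho < r -> is_derive r 1 B1 (B2 r)) ->
  (forall r, rho < r -> r ^+ 2 * B2 r = (lam - kappa ^+ 2 * r ^+ 2) * B r - 2 * r * B1 r) ->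
  (forall eps : R, 0 < eps -> exists r1 : R, forall r : R, r1 < r -> `|r * (A1 r + kappa * B r)| <= eps) ->
  exists al be, forall r, rho < r ->
    r * A r = al * outRe r - be * outIm r /\ r * B r = be * outRe r + al * outIm r.
Proof.
move=> rho0 dA dA1 odeA dB dB1 odeB som.
have [a1 [b1 hA]] := radial_form rho0 dA dA1 odeA.
have [a2 [b2 hB]] := radial_form rho0 dB dB1 odeB.
(* To leading order the derivatives of [outRe] and [outIm] are [- kappa * outIm] and
   [kappa * outRe]. Hence [r * (A1 r + kappa * B r)] is [kappa * (x * outRe r + y * outIm r)] up to
   O(1/r). *)
pose x := b1 + a2. pose y := b2 - a1.
have [KP KP0 hKP] := poly_bound01 P. have [KQ KQ0 hKQ] := poly_bound01 Q.
have [KP1 KP10 hKP1] := poly_lipschitz0 ('X^2 * P^`()).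
have [KQ1 KQ10 hKQ1] := poly_lipschitz0 ('X^2 * Q^`()).
have [LP LP0 hLP] := poly_lipschitz0 P. have [LQ LQ0 hLQ] := poly_lipschitz0 Q.
have bnd (c s u v p q : R) : `|c| <= 1 -> `|s| <= 1 -> `|p| <= u -> `|q| <= v ->
    `|c * p + s * q| <= u + v.
  move=> hc hs hp hq; apply: le_trans (ler_normD _ _) _.
  by rewrite !normrM -[u]mul1r -[v]mul1r; apply: lerD; apply: ler_pM.
have c1 r : `|cos (kappa * r)| <= 1 by rewrite ler_norml cos_geN1 cos_le1.
have s1 r : `|sin (kappa * r)| <= 1 by rewrite ler_norml sin_geN1 sin_le1.
pose K := (`|a1| + `|b1|) * (KP + KQ + (KP1 + KQ1)) + kappa * (`|x| + `|y|) * (LP + LQ).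
have key r : rho < r -> 1 <= r ->
    `|kappa * (x * (cos (kappa * r) * P.[0] - sin (kappa * r) * Q.[0]) +
       y * (sin (kappa * r) * P.[0] + cos (kappa * r) * Q.[0]))| <= `|r * (A1 r + kappa * B r)| + K / r.
  move=> hr r1; have r0 : 0 < r by lra.
  have t01 : 0 <= r^-1 <= 1 by rewrite invr_ge0 (ltW r0)/= invf_le1.
  have [hA1 hA2] := hA r hr. have [hB1 hB2] := hB r hr.
  set c := cos (kappa * r). set s := sin (kappa * r).
  have c1' := c1 r; have s1' := s1 r; rewrite -/c in c1'; rewrite -/s in s1'.
  have sN : `|- s| <= 1 by rewrite normrN.
  have X20 (p : {poly R}) : ('X^2 * p).[0] = 0 by rewrite hornerM hornerXn expr0n mul0r.
  have hp1 : `|p1 r| <= KP1 / r by rewrite /p1 normrN; have := hKP1 _ t01; rewrite X20 subr0.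
  have hq1 : `|q1 r| <= KQ1 / r by rewrite /q1 normrN; have := hKQ1 _ t01; rewrite X20 subr0.
  have e : kappa * (x * (c * P.[0] - s * Q.[0]) + y * (s * P.[0] + c * Q.[0])) =
    r * (A1 r + kappa * B r) + (A r
     - (a1 * (c * p1 r + (- s) * q1 r) + b1 * (s * p1 r + c * q1 r))
     - kappa * (x * (c * (P.[r^-1] - P.[0]) + (- s) * (Q.[r^-1] - Q.[0])) +
          y * (s * (P.[r^-1] - P.[0]) + c * (Q.[r^-1] - Q.[0])))).
    have -> : r * (A1 r + kappa * B r) = (a1 * outRe1 r + b1 * outIm1 r) - A r + kappa * (a2 * outRe r + b2 * outIm r).
      by rewrite -hA2 -hB1; ring.
    by rewrite /outRe1 /outIm1 /outRe /outIm -/c -/s /x /y; ring.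
  rewrite e; apply: le_trans (ler_normD _ _) _; rewrite lerD2l.
  have hA0 : `|A r| <= (`|a1| + `|b1|) * (KP + KQ) / r.
    rewrite ler_pdivlMr// -{2}(gtr0_norm r0) -normrM mulrC hA1.
    apply: le_trans (ler_normD _ _) _; rewrite !normrM mulrDl; apply: lerD; rewrite ler_wpM2l//.
      by rewrite /outRe -mulNr; apply: bnd => //; [exact: hKP|exact: hKQ].
    by apply: bnd => //; [exact: hKP|exact: hKQ].
  have h2 : `|a1 * (c * p1 r + (- s) * q1 r) + b1 * (s * p1 r + c * q1 r)| <= (`|a1| + `|b1|) * (KP1 + KQ1) / r.
    apply: le_trans (ler_normD _ _) _; rewrite !normrM.
    have -> : (`|a1| + `|b1|) * (KP1 + KQ1) / r = `|a1| * (KP1 / r + KQ1 / r) + `|b1| * (KP1 / r + KQ1 / r) by ring.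
    by apply: lerD; rewrite ler_wpM2l// bnd.
  have h3 : `|kappa * (x * (c * (P.[r^-1] - P.[0]) + (- s) * (Q.[r^-1] - Q.[0])) +
          y * (s * (P.[r^-1] - P.[0]) + c * (Q.[r^-1] - Q.[0])))| <= kappa * (`|x| + `|y|) * (LP + LQ) / r.
    have -> : kappa * (`|x| + `|y|) * (LP + LQ) / r = kappa * (`|x| * (LP / r + LQ / r) + `|y| * (LP / r + LQ / r)) by ring.
    rewrite normrM (gtr0_norm k0); apply: ler_wpM2l; first exact: ltW.
    apply: le_trans (ler_normD _ _) _; rewrite !normrM.
    by apply: lerD; rewrite ler_wpM2l// bnd// ?hLP ?hLQ.
  have -> : K / r = (`|a1| + `|b1|) * (KP + KQ) / r + (`|a1| + `|b1|) * (KP1 + KQ1) / r + kappa * (`|x| + `|y|) * (LP + LQ) / r.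
    by rewrite /K; ring.
  apply: le_trans (ler_normB _ _) _; apply: lerD => //.
  by apply: le_trans (ler_normB _ _) _; apply: lerD.
have K0 : 0 <= K by rewrite addr_ge0 ?mulr_ge0 ?addr_ge0 ?(ltW k0)//.
(* The leading part is periodic in [r]; as it becomes arbitrarily small at infinity, it vanishes at
   every phase. *)
have lim0 z : x * (cos z * P.[0] - sin z * Q.[0]) + y * (sin z * P.[0] + cos z * Q.[0]) = 0.
  set W := LHS; apply/eqP; rewrite -normr_le0 leNgt; apply/negP => W0.
  pose eps := kappa * `|W| / 3.
  have eps0 : 0 < eps by rewrite divr_gt0// mulr_gt0.
  have [r1 hr1] := som eps eps0.
  have [r hr [hc hs]] := far_phase z (Num.max (Num.max rho r1) (Num.max 1 (K / eps))).
  move: hr; rewrite !gt_max => /andP[/andP[h1 h2] /andP[h3 h4]].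
  have := key r h1 (ltW h3); rewrite hc hs -/W.
  have := hr1 r h2; move: h4; rewrite ltr_pdivrMr// => h4.
  have h5 : K / r < eps by rewrite ltr_pdivrMr ?(lt_trans _ h3)// mulrC.
  rewrite [`|kappa * W|]normrM (gtr0_norm k0) => h6 h7.
  by move: h5 h6 h7 eps0; rewrite /eps; lra.
(* These two phases give a linear system in [x] and [y] whose determinant [P.[0] ^+ 2 + Q.[0] ^+ 2]
   is 1. *)
have e1 := lim0 0. have e2 := lim0 (pi / 2).
rewrite cos0 sin0 in e1; rewrite cos_pihalf sin_pihalf in e2.
have w0 : P.[0] ^+ 2 + Q.[0] ^+ 2 = 1.
  have := congr1 (horner^~ 0) (hwronskian l k0).
  rewrite -/P -/Q hornerD hornerN hornerZ hornerD !horner_exp hornerM hornerXn expr0n mul0r subr0 hornerC => h.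
  by apply: (mulfI (lt0r_neq0 k0)); rewrite mulr1.
have x0 : x = 0.
  transitivity (x * (P.[0] ^+ 2 + Q.[0] ^+ 2)); first by rewrite w0 mulr1.
  transitivity (P.[0] * (x * (1 * P.[0] - 0 * Q.[0]) + y * (0 * P.[0] + 1 * Q.[0])) -
     Q.[0] * (x * (0 * P.[0] - 1 * Q.[0]) + y * (1 * P.[0] + 0 * Q.[0]))); first ring.
  by rewrite e1 e2 !mulr0 subr0.
have y0 : y = 0.
  transitivity (y * (P.[0] ^+ 2 + Q.[0] ^+ 2)); first by rewrite w0 mulr1.
  transitivity (Q.[0] * (x * (1 * P.[0] - 0 * Q.[0]) + y * (0 * P.[0] + 1 * Q.[0])) +
     P.[0] * (x * (0 * P.[0] - 1 * Q.[0]) + y * (1 * P.[0] + 0 * Q.[0]))); first ring.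
  by rewrite e1 e2 !mulr0 addr0.
exists a1, a2 => r hr; have [hA1 _] := hA r hr; have [hB1 _] := hB r hr.
rewrite hA1 hB1; have -> : b1 = - a2 by move: x0; rewrite /x; lra.
have -> : b2 = a1 by move: y0; rewrite /y; lra.
by rewrite mulNr.
Qed.

End Radial.

Lemma poly_germ (R : realType) (p : {poly R}) (A s t : R) N : 0 <= A -> 0 <= s * t <= 2^-1 ->
  0 <= t -> (forall m, `|p`_m| <= A * s ^+ m) ->
  `|p.[t] - psum (fun m => p`_m) N t| <= 2 * A * (s * t) ^+ N.
Proof.
move=> A0 /andP[q0 q2] t0 hp; set q := s * t in q0 q2 *.
have -> : p.[t] = psum (fun m => p`_m) (maxn N (size p)) t.
  by rewrite (@horner_coef_wide _ (maxn N (size p))) ?leq_maxr// /psum big_mkord.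
rewrite /psum (big_cat_nat (leq0n N) (leq_maxl N (size p)))/= addrAC subrr add0r.
apply: le_trans (ler_norm_sum _ _ _) _.
apply: (@le_trans _ _ (\sum_(N <= m < maxn N (size p)) A * q ^+ m)).
  apply: ler_sum => m _; rewrite normrM (ger0_norm (exprn_ge0 _ t0)) /q exprMn mulrA.
  by rewrite ler_wpM2r ?exprn_ge0.
rewrite -mulr_sumr -mulrA mulrCA ler_wpM2l//.
have q1 : 0 <= q < 1 by apply/andP; split => //; lra.
apply: le_trans (sum_geometric_le _ _ q1) _; rewrite mulrC ler_wpM2r ?exprn_ge0//.
rewrite -[leRHS]invrK lef_pV2 ?posrE ?invr_gt0//; lra.
Qed.

(** With N a natural number above |x|, N^N bounds x^j / j! for all j: powers up to N are at most
    N^N, and each further factor N is absorbed by the factorial. *)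
Definition facbound (R : realType) (x : R) : R :=
  (Num.bound `|x|)%:R ^+ (Num.bound `|x|).

Lemma facbound_ge0 (R : realType) (x : R) : 0 <= facbound x.
Proof. by rewrite exprn_ge0. Qed.

Lemma expr_le_facbound (R : realType) (x : R) j : 0 <= x -> x ^+ j <= facbound x * j`!%:R.
Proof.
move=> x0; rewrite /facbound; set N := Num.bound `|x|.
have xN : x <= N%:R by rewrite ltW// -{1}(ger0_norm x0) archi_boundP.
have N0 : (0 < N)%N.
  by rewrite -(ltr0n R); apply: le_lt_trans (archi_boundP (normr_ge0 x)).
apply: (@le_trans _ _ (N%:R ^+ j)); first by rewrite lerXn2r// nnegrE ler0n.
rewrite -!natrX -natrM ler_nat; elim: j => [|j IH]; first by rewrite fact0 muln1 expn0 expn_gt0 N0.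
have [jN|Nj] := leqP j.+1 N.
  by apply: (@leq_trans (N ^ N)); [rewrite leq_pexp2l|rewrite leq_pmulr// fact_gt0].
by rewrite expnS factS mulnCA leq_mul// ltnW.
Qed.

(** * Convergent expansion in 1/r outside a ball *)

Section Exterior.
Variables (R : realType) (U : set 'rV[R]_3) (ur ui : 'rV[R]_3 -> R) (kappa : R).
Hypotheses (oU : open U) (cur : class_C 2 U ur) (cui : class_C 2 U ui) (k0 : 0 < kappa).
Hypothesis helmr : forall x, U x -> \sum_i 'D_('e_ i) ('D_('e_ i) ur) x = - kappa ^+ 2 * ur x.
Hypothesis helmi : forall x, U x -> \sum_i 'D_('e_ i) ('D_('e_ i) ui) x = - kappa ^+ 2 * ui x.
Variables (c : 'rV[R]_3) (rho r0 B : R).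
Hypotheses (rho0 : 0 <= rho) (rr0 : rho < r0).
Hypothesis hU : forall x, rho ^+ 2 < dotv (x - c) (x - c) -> U x.
Hypothesis hB : forall x, dotv (x - c) (x - c) = r0 ^+ 2 -> `|ur x| <= B /\ `|ui x| <= B.
Hypothesis som : forall eps : R, 0 < eps -> exists r1 : R, forall (r : R) (n : 'rV[R]_3),
  r1 < r -> dotv n n = 1 -> `|r * (grd ur n (c + r *: n) + kappa * ui (c + r *: n))| <= eps.

(* Real and imaginary parts of [r * e ^ (- i kappa r) * (ur + i ui)]. *)
Definition farRe (e : 'rV[R]_3) (r : R) : R :=
  r * (cos (kappa * r) * ur (c + r *: e) + sin (kappa * r) * ui (c + r *: e)).
Definition farIm (e : 'rV[R]_3) (r : R) : R :=
  r * (cos (kappa * r) * ui (c + r *: e) - sin (kappa * r) * ur (c + r *: e)).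

(** Each mode is an outgoing polynomial in 1/r whose amplitude is controlled on the sphere of radius
    [r0], and whose coefficients are controlled by the leading one. The constant is [4 * E] with E =
    128 pi M r0 B: one doubling for polynomial remainders, one in [germ_series]. It does not depend
    on the direction [e]. *)
Lemma exterior_germ e : dotv e e = 1 ->
  (exists a, germ (fun t => farRe e t^-1) a (512 * pi * facbound (4 * kappa * r0) * r0 * B) (4 * r0) (8 * r0)^-1) /\
  (exists a, germ (fun t => farIm e t^-1) a (512 * pi * facbound (4 * kappa * r0) * r0 * B) (4 * r0) (8 * r0)^-1).
Proof.
move=> e1.
have [a [b fr]] := frame_exists e1.
pose J := [set r : R | rho < r].
have r00 : 0 < r0 by exact: le_lt_trans rr0.
have dX r ph al : dotv (sphX c a b e r ph al - c) (sphX c a b e r ph al - c) = r ^+ 2.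
  by rewrite /sphX addrAC subrr add0r dotvZ sphN_unit// mulr1.
have JU r ph al : J r -> U (sphX c a b e r ph al).
  move=> Jr; have r_0 : 0 < r by exact: le_lt_trans Jr.
  by apply: hU; rewrite dX ltrXn2r// nnegrE// ltW.
have oJ : open J by exact: open_gt.
have ucr r ph al : J r -> {for sphX c a b e r ph al, continuous ur}.
  by move=> Jr; case: cur => h _; apply: h; exact: JU.
have uci r ph al : J r -> {for sphX c a b e r ph al, continuous ui}.
  by move=> Jr; case: cui => h _; apply: h; exact: JU.
have pi0 := pi_gt0 R.
have p20 : 0 < pi *+ 2 :> R by rewrite mulrn_wgt0.
have B0 : 0 <= B by apply: le_trans (hB (dX r0 0 0)).1.
pose A l r := dblInt (sphA0 ur c a b e l r). pose A1 l r := dblInt (sphA1 ur c a b e l r).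
pose D l r := dblInt (sphA0 ui c a b e l r). pose D1 l r := dblInt (sphA1 ui c a b e l r).
have Jr0 : J r0 by [].
pose V1 := r0 * (B * pi * (pi *+ 2)).
have V10 : 0 <= V1 by rewrite !mulr_ge0// ltW.
have modes l : exists ab : R * R, [/\ (forall r, J r ->
    r * A l r = ab.1 * outRe kappa l r - ab.2 * outIm kappa l r /\
    r * D l r = ab.2 * outRe kappa l r + ab.1 * outIm kappa l r),
    `|ab.1| * (habs kappa l l * r0^-1 ^+ l) <= 2 * V1 & `|ab.2| * (habs kappa l l * r0^-1 ^+ l) <= 2 * V1].
  (* The radiation condition is uniform in the direction, so it passes to the mode by integration
     over the sphere. *)
  have sA (eps : R) : 0 < eps -> exists r1 : R, forall r : R, r1 < r -> `|r * (A1 l r + kappa * D l r)| <= eps.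
    move=> eps0.
    have eps1 : 0 < eps / (pi * (pi *+ 2)) by rewrite divr_gt0// mulr_gt0.
    have [r1 hr1] := som eps1; exists (Num.max rho r1) => r; rewrite gt_max => /andP[Jr r1r].
    have j0 : jcont (sphA0 ui c a b e l r) by apply: jcont_sphA0 => ph al; exact: uci.
    have jw : jcont (fun _ al => legcos l al * sin al : R).
      by apply: jcont_snd => x; apply: cvgM; [exact: continuous_polycos|exact: continuous_sin].
    have j1 : jcont (sphA1 ur c a b e l r).
      apply: (@jcontM _ (fun ph al => grd ur (sphN a b e ph al) (sphX c a b e r ph al))) => // p.
      pose tr (p : R * R) := (r, p.1, p.2).
      have ctr : {for p, continuous tr}.
        apply: continuous_pair; last exact: cvg_snd.
        by apply: continuous_pair; [exact: cvg_cst|exact: cvg_fst].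
      apply: (@continuous_at_grd R U ur cur _ (fun p : R * R => sphX c a b e r p.1 p.2) (fun p => sphN a b e p.1 p.2) p) => [||i].
      - exact: JU.
      - exact: (@continuous_comp _ _ _ tr (fun p => sphX c a b e p.1.1 p.1.2 p.2) p ctr (@continuous_sphX _ _ _ _ _ (tr p))).
      - exact: (@continuous_comp _ _ _ tr (fun p => sphN a b e p.1.2 p.2 0 i) p ctr (@continuous_sphN _ _ _ _ _ (tr p))).
    have jk : jcont (fun ph al => kappa * sphA0 ui c a b e l r ph al) by apply: jcontM => //; exact: jcont_cst.
    have -> : r * (A1 l r + kappa * D l r) =
      dblInt (fun ph al => r * (sphA1 ur c a b e l r ph al + kappa * sphA0 ui c a b e l r ph al)).
      by rewrite dblIntZ ?dblIntD ?dblIntZ//; exact: jcontD.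
    have -> : eps = eps / (pi * (pi *+ 2)) * pi * (pi *+ 2).
      by rewrite -mulrA divfK// mulf_neq0// lt0r_neq0.
    apply: dblInt_le; first by apply: jcontM; [exact: jcont_cst|exact: jcontD].
    move=> ph al _.
    have -> : r * (sphA1 ur c a b e l r ph al + kappa * sphA0 ui c a b e l r ph al) =
       (r * (grd ur (sphN a b e ph al) (sphX c a b e r ph al) + kappa * ui (sphX c a b e r ph al))) * (legcos l al * sin al).
      by rewrite /sphA1 /sphA0; ring.
    rewrite normrM -[leRHS]mulr1; apply: ler_pM => //.
      by apply: hr1 => //; exact: sphN_unit.
    rewrite normrM -[leRHS]mulr1; apply: ler_pM => //; first exact: legcos_le1.
    by rewrite ler_norml sin_geN1 sin_le1.
  have [|||||||al [be hab]] := @outgoing_form R kappa l k0 rho (A l) (A1 l) (fun r => dblInt (sphA2 ur c a b e l r))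
    (D l) (D1 l) (fun r => dblInt (sphA2 ui c a b e l r)) rho0.
  - by move=> r Jr; exact: (der_sphA0 oU cur oJ JU).
  - by move=> r Jr; exact: (der_sphA1 oU cur oJ JU).
  - by move=> r Jr; exact: (sphA_ode oU cur helmr fr JU).
  - by move=> r Jr; exact: (der_sphA0 oU cui oJ JU).
  - by move=> r Jr; exact: (der_sphA1 oU cui oJ JU).
  - by move=> r Jr; exact: (sphA_ode oU cui helmi fr JU).
  - exact: sA.
  exists (al, be); rewrite /=.
  have [h1 h2] := hab r0 Jr0.
  set h := habs kappa l l * r0^-1 ^+ l.
  have h0 : 0 <= h by rewrite mulr_ge0 ?exprn_ge0 ?invr_ge0// ltW// habs_gt0.
  have hA : `|r0 * A l r0| <= V1.
    rewrite normrM (gtr0_norm r00); apply: ler_wpM2l; first exact: ltW.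
    apply: sphA0_le; first by move=> ph al'; exact: ucr.
    by move=> ph al'; exact: (hB (dX _ _ _)).1.
  have hD : `|r0 * D l r0| <= V1.
    rewrite normrM (gtr0_norm r00); apply: ler_wpM2l; first exact: ltW.
    apply: sphA0_le; first by move=> ph al'; exact: uci.
    by move=> ph al'; exact: (hB (dX _ _ _)).2.
  (* Adding the squares of the two mode equations at [r0] removes the phase and leaves (al^2 + be^2)
     |p_l(1/r0)|^2, to which the lower bound [hY_ge] applies. *)
  have e2 : (al ^+ 2 + be ^+ 2) * h ^+ 2 <= (2 * V1) ^+ 2.
    apply: (@le_trans _ _ ((r0 * A l r0) ^+ 2 + (r0 * D l r0) ^+ 2)).
      rewrite h1 h2.
      have -> : (al * outRe kappa l r0 - be * outIm kappa l r0) ^+ 2 + (be * outRe kappa l r0 + al * outIm kappa l r0) ^+ 2 =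
        (al ^+ 2 + be ^+ 2) * (outRe kappa l r0 ^+ 2 + outIm kappa l r0 ^+ 2) by ring.
      rewrite out_sqr ler_wpM2l ?addr_ge0 ?sqr_ge0// hY_ge// invr_ge0 ltW//.
    have sq (x : R) : `|x| <= V1 -> x ^+ 2 <= V1 ^+ 2.
      by move=> hx; rewrite -[x ^+ 2]real_normK ?num_real// lerXn2r// nnegrE.
    apply: le_trans (lerD (sq _ hA) (sq _ hD)) _; rewrite [(2 * V1) ^+ 2]exprMn.
    rewrite -[leLHS]mulr2n -[leLHS]mulr_natl; apply: ler_wpM2r; first exact: sqr_ge0.
    by rewrite -natrX ler_nat.
  have fin (x : R) : x ^+ 2 * h ^+ 2 <= (2 * V1) ^+ 2 -> `|x| * h <= 2 * V1.
    move=> hx; have xh : 0 <= `|x| * h by exact: mulr_ge0.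
    have V20 : 0 <= 2 * V1 by exact: mulr_ge0.
    rewrite -(@ler_sqr _ (`|x| * h)) ?nnegrE//.
    by rewrite [(`|x| * h) ^+ 2]exprMn real_normK ?num_real.
  have ah := mulr_ge0 (sqr_ge0 al) (sqr_ge0 h); have bh := mulr_ge0 (sqr_ge0 be) (sqr_ge0 h).
  by split=> //; apply: fin; apply: le_trans e2; rewrite mulrDl (lerDl, lerDr).
have e7 : V1 / (pi *+ 2) = r0 * B * pi by rewrite /V1 !mulrA mulfK ?lt0r_neq0.
have [ab hab] := choice modes.
clearbody V1.
pose M := facbound (4 * kappa * r0).
have M0 : 0 <= M by exact: facbound_ge0.
pose E := 128 * pi * M * r0 * B.
have E0 : 0 <= E by rewrite !mulr_ge0// ltW.
pose n l := (legnorm R l)^-1.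
have n0 l : 0 < n l by rewrite invr_gt0 legnorm_gt0.
(* Real and imaginary parts of (al + i be) p_l with the Legendre normalisation: the contribution of
   degree [l] once the factor e^(i kappa r) is removed. *)
pose pr l := (n l / (pi *+ 2)) *: ((ab l).1 *: hP kappa l - (ab l).2 *: hQ kappa l).
pose pq l := (n l / (pi *+ 2)) *: ((ab l).2 *: hP kappa l + (ab l).1 *: hQ kappa l).
have np l : 0 <= n l / (pi *+ 2) by rewrite divr_ge0 ?ltW.
(* With j = l - m, the ratio kappa^j / j! to the leading coefficient becomes at most M 4^-j r0^-j,
   since (4 kappa r0)^j <= M j!. The gain 4^-j against the 2^l of the norm gives 2^-l 4^m, which is
   the weight needed to sum over [l]. *)
have hcoefE l m : (m <= l)%N -> n l / (pi *+ 2) * (`|(ab l).1| * habs kappa l m + `|(ab l).2| * habs kappa l m) <= E * 2^-1 ^+ l * (4 * r0) ^+ m.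
  move=> ml; have [_ h1 h2] := hab l.
  have hm := habs_gt0 k0 ml.
  have key (x : R) : `|x| * (habs kappa l l * r0^-1 ^+ l) <= 2 * V1 -> `|x| * habs kappa l m <= 2 * V1 * M * 4^-1 ^+ (l - m) * r0 ^+ m.
    move=> hx; have := habs_ratio k0 (leq_subr m l); rewrite subKn// => hr.
    have hf := @expr_le_facbound R (4 * kappa * r0) (l - m) (_ : 0 <= 4 * kappa * r0).
    have {}hf := hf (mulr_ge0 (mulr_ge0 (ler0n _ 4) (ltW k0)) (ltW r00)).
    rewrite -/M in hf.
    set j := (l - m)%N in hr hf *.
    have f0 : 0 < j`!%:R :> R by rewrite ltr0n fact_gt0.
    rewrite -(ler_pM2r f0) -[leLHS]mulrA.
    apply: (@le_trans _ _ (`|x| * (habs kappa l l * kappa ^+ j))); first by rewrite ler_wpM2l.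
    have rj : r0 ^+ l = r0 ^+ j * r0 ^+ m by rewrite -exprD subnK.
    have e3 : `|x| * (habs kappa l l * kappa ^+ j) = `|x| * (habs kappa l l * r0^-1 ^+ l) * (kappa ^+ j * r0 ^+ j * r0 ^+ m).
      have : r0^-1 ^+ l * (r0 ^+ j * r0 ^+ m) = 1.
        by rewrite -rj -exprMn mulVf ?expr1n// lt0r_neq0.
      move=> h; transitivity (`|x| * (habs kappa l l * kappa ^+ j) * (r0^-1 ^+ l * (r0 ^+ j * r0 ^+ m))); first by rewrite h mulr1.
      by ring.
    rewrite e3.
    apply: (@le_trans _ _ (2 * V1 * (kappa ^+ j * r0 ^+ j * r0 ^+ m))).
      by rewrite ler_wpM2r// !mulr_ge0// exprn_ge0// ltW.
    have e4 : kappa ^+ j * r0 ^+ j = 4^-1 ^+ j * (4 * kappa * r0) ^+ j.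
      by rewrite -!exprMn; congr (_ ^+ _); field.
    rewrite e4.
    have -> : 2 * V1 * (4^-1 ^+ j * (4 * kappa * r0) ^+ j * r0 ^+ m) = 2 * V1 * 4^-1 ^+ j * r0 ^+ m * (4 * kappa * r0) ^+ j by ring.
    have -> : 2 * V1 * M * 4^-1 ^+ j * r0 ^+ m * j`!%:R = 2 * V1 * 4^-1 ^+ j * r0 ^+ m * (M * j`!%:R) by ring.
    by apply: ler_wpM2l => //; rewrite !mulr_ge0// exprn_ge0// ltW.
  have k1 := key _ h1. have k2 := key _ h2.
  apply: (@le_trans _ _ (32 * 2 ^+ l / (pi *+ 2) * (2 * (2 * V1 * M * 4^-1 ^+ (l - m) * r0 ^+ m)))).
    apply: ler_pM => //; first by rewrite addr_ge0// mulr_ge0// ltW.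
      by apply: ler_wpM2r; [rewrite invr_ge0 ltW|exact: legnormV_le].
    by lra.
  have -> : E * 2^-1 ^+ l * (4 * r0) ^+ m = E * 2^-1 ^+ l * 4 ^+ m * r0 ^+ m by rewrite exprMn mulrA.
  have e5 : (2 : R) ^+ l = 2^-1 ^+ l * 4 ^+ m * 4 ^+ (l - m).
    rewrite -mulrA -exprD subnKC// -exprMn; congr (_ ^+ _); lra.
  have e6 : (4 : R) ^+ (l - m) * 4^-1 ^+ (l - m) = 1.
    by rewrite -exprMn mulfV ?expr1n.
  rewrite le_eqVlt; apply/orP; left; apply/eqP.
  transitivity (128 * (V1 / (pi *+ 2)) * M * 2^-1 ^+ l * 4 ^+ m * r0 ^+ m * (4 ^+ (l - m) * 4^-1 ^+ (l - m))).
    by rewrite e5; ring.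
  by rewrite e6 e7 /E; ring.
have hb (x y : R) l m : (m <= l)%N -> `|x| <= habs kappa l m -> `|y| <= habs kappa l m ->
   `|(ab l).1 * x| + `|(ab l).2 * y| <= `|(ab l).1| * habs kappa l m + `|(ab l).2| * habs kappa l m.
  by move=> ml hx hy; rewrite !normrM; apply: lerD; rewrite ler_wpM2l.
have coefr l m : `|(pr l)`_m| <= E * 2^-1 ^+ l * (4 * r0) ^+ m.
  rewrite /pr coefZ coefB !coefZ coef_hP coef_hQ normrM (ger0_norm (np l)).
  have [ml|lm] := leqP m l; last first.
    by rewrite hcoef_gt// !mulr0 subr0 normr0 mulr0 !mulr_ge0 ?exprn_ge0 ?mulr_ge0// ltW.
  apply: le_trans (hcoefE l m ml); apply: ler_wpM2l; first exact: np.
  have [h1 h2] := hcoef_le k0 ml.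
  by apply: le_trans (ler_normB _ _) _; exact: hb.
have coefq l m : `|(pq l)`_m| <= E * 2^-1 ^+ l * (4 * r0) ^+ m.
  rewrite /pq coefZ coefD !coefZ coef_hP coef_hQ normrM (ger0_norm (np l)).
  have [ml|lm] := leqP m l; last first.
    by rewrite hcoef_gt// !mulr0 addr0 normr0 mulr0 !mulr_ge0 ?exprn_ge0 ?mulr_ge0// ltW.
  apply: le_trans (hcoefE l m ml); apply: ler_wpM2l; first exact: np.
  have [h1 h2] := hcoef_le k0 ml.
  by apply: le_trans (ler_normD _ _) _; rewrite addrC; exact: hb.
pose d := (8 * r0)^-1.
have d0 : 0 < d by rewrite invr_gt0 mulr_gt0.
have sd : 4 * r0 * d = 2^-1 by rewrite /d; field; rewrite lt0r_neq0.
have s0 : 0 < 4 * r0 by rewrite mulr_gt0.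
have E2 l : 0 <= E * 2^-1 ^+ l by rewrite mulr_ge0// exprn_ge0.
have sbound (t : R) : 0 < t <= d -> 0 <= 4 * r0 * t <= 2^-1.
  move=> /andP[t0 td]; rewrite mulr_ge0 ?(ltW t0) ?(ltW s0)//= -sd.
  by rewrite ler_pM2l.
have gr l N (t : R) : 0 < t <= d -> `|(pr l).[t] - psum (fun m => (pr l)`_m) N t| <= 2 * E * 2^-1 ^+ l * (4 * r0 * t) ^+ N.
  move=> ht; have /andP[t0 _] := ht.
  rewrite -[2 * E * _]mulrA; apply: poly_germ => //; [exact: sbound|exact: ltW].
have gq l N (t : R) : 0 < t <= d -> `|(pq l).[t] - psum (fun m => (pq l)`_m) N t| <= 2 * E * 2^-1 ^+ l * (4 * r0 * t) ^+ N.
  move=> ht; have /andP[t0 _] := ht.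
  rewrite -[2 * E * _]mulrA; apply: poly_germ => //; [exact: sbound|exact: ltW].
have prb l (t : R) : 0 < t <= d -> `|(pr l).[t]| <= 2 * E * 2^-1 ^+ l.
  by move=> ht; have := gr l 0%N t ht; rewrite /psum big_geq// subr0 expr0 mulr1.
have pqb l (t : R) : 0 < t <= d -> `|(pq l).[t]| <= 2 * E * 2^-1 ^+ l.
  by move=> ht; have := gq l 0%N t ht; rewrite /psum big_geq// subr0 expr0 mulr1.
have Js (t : R) : 0 < t <= d -> J t^-1.
  move=> /andP[t0 td]; rewrite /J/=; apply: (lt_trans rr0).
  rewrite -(invrK r0) ltf_pV2 ?posrE ?invr_gt0//; apply: (le_lt_trans td).
  by rewrite /d ltf_pV2 ?posrE ?mulr_gt0//; lra.
have h20 : (0 : R) <= 2^-1 by lra. have h21 : (2^-1 : R) < 1 by lra.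
have h2 : (0 : R) <= (2^-1 : R) < 1 by apply/andP; split.
have c1 r : `|cos (kappa * r)| <= 1 by rewrite ler_norml cos_geN1 cos_le1.
have s1 r : `|sin (kappa * r)| <= 1 by rewrite ler_norml sin_geN1 sin_le1.
have bnd (x y p q v : R) : `|x| <= 1 -> `|y| <= 1 -> `|p| <= v -> `|q| <= v -> `|x * p + y * q| <= 2 * v.
  move=> hx hy hp hq; apply: le_trans (ler_normD _ _) _; rewrite !normrM.
  have -> : 2 * v = 1 * v + 1 * v by ring.
  by apply: lerD; apply: ler_pM.
have AE l (t : R) : 0 < t <= d -> A l t^-1 / legnorm R l = pi *+ 2 * t * (cos (kappa * t^-1) * (pr l).[t] + (- sin (kappa * t^-1)) * (pq l).[t]).
  move=> ht; have /andP[t0 _] := ht; have [h _ _] := hab l; have [h1 _] := h _ (Js t ht).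
  have -> : A l t^-1 = t * (t^-1 * A l t^-1) by rewrite mulrA mulfV ?mul1r// lt0r_neq0.
  rewrite h1 /pr /pq /outRe /outIm invrK !hornerZ !hornerD !hornerN !hornerZ -/(n l).
  have {1}-> : n l = (pi *+ 2) * (n l / (pi *+ 2)) by rewrite mulrC divfK// lt0r_neq0.
  by move: (n l / _) => w; ring.
have DE l (t : R) : 0 < t <= d -> D l t^-1 / legnorm R l = pi *+ 2 * t * (sin (kappa * t^-1) * (pr l).[t] + cos (kappa * t^-1) * (pq l).[t]).
  move=> ht; have /andP[t0 _] := ht; have [h _ _] := hab l; have [_ h1] := h _ (Js t ht).
  have -> : D l t^-1 = t * (t^-1 * D l t^-1) by rewrite mulrA mulfV ?mul1r// lt0r_neq0.
  rewrite h1 /pr /pq /outRe /outIm invrK !hornerZ !hornerD !hornerN !hornerZ -/(n l).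
  have {1}-> : n l = (pi *+ 2) * (n l / (pi *+ 2)) by rewrite mulrC divfK// lt0r_neq0.
  by move: (n l / _) => w; ring.
have sN r : `|- sin (kappa * r)| <= 1 by rewrite normrN.
have expand (u : 'rV[R]_3 -> R) (F : nat -> R) (t : R) N : 0 < t <= d ->
    (forall ph al, {for sphX c a b e t^-1 ph al, continuous u}) ->
    (forall l, dblInt (sphA0 u c a b e l t^-1) / legnorm R l = pi *+ 2 * t * F l) ->
    (forall l, `|F l| <= 4 * E * 2^-1 ^+ l) ->
    `|t^-1 * u (c + t^-1 *: e) - \sum_(0 <= l < N) F l| <= 8 * E * 2^-1 ^+ N.
  move=> /andP[t0 _] cu hF hFb.
  have pt : 0 < pi *+ 2 * t by rewrite mulr_gt0.
  have hb' l : `|dblInt (sphA0 u c a b e l t^-1) / legnorm R l| <= pi *+ 2 * t * (4 * E) * 2^-1 ^+ l.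
    rewrite hF normrM (gtr0_norm pt) -mulrA ler_wpM2l//; first exact: ltW.
  have := sphere_expansion cu h2 hb' N; under eq_bigr do rewrite hF.
  rewrite -mulr_sumr => hs.
  rewrite -(ler_pM2l pt) -{1}(gtr0_norm pt) -normrM.
  have -> : pi *+ 2 * t * (t^-1 * u (c + t^-1 *: e) - \sum_(0 <= l < N) F l) =
     pi *+ 2 * u (c + t^-1 *: e) - pi *+ 2 * t * \sum_(0 <= l < N) F l.
    rewrite mulrBr; congr (_ - _); rewrite mulrA mulfK ?lt0r_neq0//.
  apply: le_trans hs _.
  rewrite (_ : _ / (1 - 2^-1) = pi *+ 2 * t * (8 * E * 2^-1 ^+ N))//; by field.
have -> : 512 * pi * facbound (4 * kappa * r0) * r0 * B = 2 * (2 * E) by rewrite /E -/M; ring.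
have far (t : R) N : 0 < t <= d ->
    `|t^-1 * ur (c + t^-1 *: e) - \sum_(0 <= l < N) (cos (kappa * t^-1) * (pr l).[t] + (- sin (kappa * t^-1)) * (pq l).[t])| <= 8 * E * 2^-1 ^+ N /\
    `|t^-1 * ui (c + t^-1 *: e) - \sum_(0 <= l < N) (sin (kappa * t^-1) * (pr l).[t] + cos (kappa * t^-1) * (pq l).[t])| <= 8 * E * 2^-1 ^+ N.
  move=> ht; have Jt := Js t ht; have e4 l : 4 * E * 2^-1 ^+ l = 2 * (2 * E * 2^-1 ^+ l) by ring.
  split; apply: expand => //.
  - by move=> ph al; exact: ucr.
  - by move=> l; exact: AE.
  - by move=> l; rewrite e4; apply: bnd => //; [exact: prb|exact: pqb].
  - by move=> ph al; exact: uci.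
  - by move=> l; exact: DE.
  - by move=> l; rewrite e4; apply: bnd => //; [exact: prb|exact: pqb].
have E20 : 0 <= 2 * E by rewrite mulr_ge0.
have sd' : 4 * r0 * d <= 2^-1 by rewrite sd.
have coef2 (x : R) l m : `|x| <= E * 2^-1 ^+ l * (4 * r0) ^+ m -> `|x| <= 2 * E * 2^-1 ^+ l * (4 * r0) ^+ m.
  move=> hx; apply: (le_trans hx).
  have : 0 <= E * 2^-1 ^+ l * (4 * r0) ^+ m by rewrite mulr_ge0// exprn_ge0// ltW.
  lra.
split.
- apply: (@germ_series R (fun l t => (pr l).[t]) (fun l m => (pr l)`_m) _ (2 * E) (16 * E)) => //.
    by move=> l m; exact: coef2.
  move=> N t ht; have [h3 h4] := far t N ht.
  set C := cos _ in h3 h4; set S := sin _ in h3 h4.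
  have -> : farRe e t^-1 - \sum_(0 <= l < N) (pr l).[t] =
    C * (t^-1 * ur (c + t^-1 *: e) - \sum_(0 <= l < N) (C * (pr l).[t] + - S * (pq l).[t])) +
    S * (t^-1 * ui (c + t^-1 *: e) - \sum_(0 <= l < N) (S * (pr l).[t] + C * (pq l).[t])).
    rewrite /farRe -/C -/S !big_split/= -!mulr_sumr.
    set x := \sum_(_ <= _ < _) _; set y := \sum_(_ <= _ < _) _.
    transitivity (C * (t^-1 * ur (c + t^-1 *: e)) + S * (t^-1 * ui (c + t^-1 *: e)) - (C ^+ 2 + S ^+ 2) * x); last ring.
    by rewrite cos2Dsin2; ring.
  have -> : 16 * E * 2^-1 ^+ N = 2 * (8 * E * 2^-1 ^+ N) by ring.
  by apply: bnd => //; [exact: c1|exact: s1].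
- apply: (@germ_series R (fun l t => (pq l).[t]) (fun l m => (pq l)`_m) _ (2 * E) (16 * E)) => //.
    by move=> l m; exact: coef2.
  move=> N t ht; have [h3 h4] := far t N ht.
  set C := cos _ in h3 h4; set S := sin _ in h3 h4.
  have -> : farIm e t^-1 - \sum_(0 <= l < N) (pq l).[t] =
    C * (t^-1 * ui (c + t^-1 *: e) - \sum_(0 <= l < N) (S * (pr l).[t] + C * (pq l).[t])) +
    - S * (t^-1 * ur (c + t^-1 *: e) - \sum_(0 <= l < N) (C * (pr l).[t] + - S * (pq l).[t])).
    rewrite /farIm -/C -/S !big_split/= -!mulr_sumr.
    set x := \sum_(_ <= _ < _) _; set y := \sum_(_ <= _ < _) _.
    transitivity (C * (t^-1 * ui (c + t^-1 *: e)) - S * (t^-1 * ur (c + t^-1 *: e)) - (C ^+ 2 + S ^+ 2) * x); last ring.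
    by rewrite cos2Dsin2; ring.
  have -> : 16 * E * 2^-1 ^+ N = 2 * (8 * E * 2^-1 ^+ N) by ring.
  by apply: bnd => //; [exact: c1|exact: sN].
Qed.

End Exterior.

(** * Change of centre in the radiation condition *)

Section Euclidean.
Variable R : realType.
Implicit Types (x y v : 'rV[R]_3) (r : R).

Lemma enorm_sqr x : enorm x ^+ 2 = dotv x x.
Proof. by rewrite /enorm sqr_sqrtr// dotv_ge0. Qed.

Lemma enorm_ge0 x : 0 <= enorm x.
Proof. exact: sqrtr_ge0. Qed.

Lemma enormZ r x : enorm (r *: x) = `|r| * enorm x.
Proof. by rewrite /enorm dotvZ sqrtrM ?sqr_ge0// sqrtr_sqr. Qed.

Lemma enorm_eq1 x : enorm x = 1 -> dotv x x = 1.
Proof. by move=> h; rewrite -enorm_sqr h expr1n. Qed.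

Lemma enorm_le r x : 0 <= r -> dotv x x <= r ^+ 2 -> enorm x <= r.
Proof. by move=> r0 h; rewrite -ler_sqr ?nnegrE ?enorm_ge0// enorm_sqr. Qed.

Lemma dotv_gt0 x : x != 0 -> 0 < dotv x x.
Proof.
move=> x0; rewrite lt_neqAle dotv_ge0 andbT eq_sym dotv3 -!expr2; apply: contra x0.
rewrite paddr_eq0 ?addr_ge0 ?sqr_ge0// paddr_eq0 ?sqr_ge0// !sqrf_eq0.
move=> /andP[/andP[/eqP h0 /eqP h1] /eqP h2]; apply/eqP/rowP => -[[|[|[|//]]] hi]; rewrite mxE.
- by rewrite -h0; congr (x _ _); exact: val_inj.
- by rewrite -h1; congr (x _ _); exact: val_inj.
- by rewrite -h2; congr (x _ _); exact: val_inj.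
Qed.

Lemma enorm_dotv x y : dotv x y <= enorm x * enorm y.
Proof.
apply: (@le_trans _ _ `|dotv x y|); first exact: ler_norm.
have xy0 : 0 <= enorm x * enorm y by rewrite mulr_ge0 ?enorm_ge0.
rewrite -ler_sqr ?nnegrE// real_normK ?num_real// exprMn !enorm_sqr -subr_ge0.
rewrite (_ : _ - _ = (x 0 0 * y 0 1 - x 0 1 * y 0 0) ^+ 2 + (x 0 0 * y 0 2%:R - x 0 2%:R * y 0 0) ^+ 2
  + (x 0 1 * y 0 2%:R - x 0 2%:R * y 0 1) ^+ 2); last by rewrite !dotv3; ring.
by rewrite !addr_ge0// sqr_ge0.
Qed.

Lemma enormD x y : enorm (x + y) <= enorm x + enorm y.
Proof.
apply: enorm_le; first by rewrite addr_ge0 ?enorm_ge0.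
have -> : dotv (x + y) (x + y) = dotv x x + 2 * dotv x y + dotv y y by rewrite !dotv3 !mxE; ring.
rewrite sqrrD !enorm_sqr lerD2r lerD2l -[leRHS]mulr_natl ler_wpM2l//.
exact: enorm_dotv.
Qed.

Lemma enormN x : enorm (- x) = enorm x.
Proof. by rewrite -scaleN1r enormZ normrN1 mul1r. Qed.

Lemma coord_le_enorm x i : `|x 0 i| <= enorm x.
Proof.
rewrite -ler_sqr ?nnegrE ?enorm_ge0// enorm_sqr real_normK ?num_real// /dotv (bigD1 i)//= -expr2 lerDl.
by apply: sumr_ge0 => j _; rewrite -expr2 sqr_ge0.
Qed.

Lemma coord_le_norm x i : `|x 0 i| <= `|x|.
Proof. by rewrite [leRHS]/Num.Def.normr/= mx_normrE; apply/bigmax_geP; right => /=; exists (0, i). Qed.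

Lemma enorm_le_norm x : enorm x <= 2 * `|x|.
Proof.
have h i : x 0 i * x 0 i <= `|x| ^+ 2.
  by rewrite -expr2 -[x 0 i ^+ 2]real_normK ?num_real// lerXn2r ?nnegrE// coord_le_norm.
apply: enorm_le; first by rewrite mulr_ge0.
rewrite dotv3 exprMn; have := h 0; have := h 1; have := h 2%:R; have := sqr_ge0 `|x|.
by move: (`|x| ^+ 2) => y; lra.
Qed.

Lemma nbhs_enorm_ball (P : set 'rV[R]_3) x : nbhs x P ->
  exists2 d, 0 < d & forall y, enorm (y - x) < d -> P y.
Proof.
move=> /nbhs_ballP[d /= d0 hd].
exists d => // y yx; apply: hd; split=> // i j; rewrite /ball/= distrC ord1.
by apply: le_lt_trans yx; have := coord_le_enorm (y - x) j; rewrite !mxE.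
Qed.

Lemma continuous_dotv_sub v : continuous (fun x => dotv (x - v) (x - v)).
Proof.
move=> x; apply: (@cvg_sumr _ _ (nbhs x) (nbhs_filter x)) => i.
have h : (y - v) 0 i @[y --> x] --> (x - v) 0 i.
  have -> : (fun y : 'rV[R]_3 => (y - v) 0 i) = (fun y => y 0 i - v 0 i).
    by apply/funext => y; rewrite !mxE.
  rewrite !mxE.
  have hc : (fun y : 'rV[R]_3 => y 0 i) y @[y --> x] --> x 0 i by exact: coord_continuous.
  exact: (cvgB hc (cvg_cst _)).
by apply: cvgM; exact: h.
Qed.

Lemma bounded_on_sphere (f : 'rV[R]_3 -> R) v r :
  (forall x, dotv (x - v) (x - v) = r ^+ 2 -> {for x, continuous f}) ->
  exists B : R, forall x, dotv (x - v) (x - v) = r ^+ 2 -> `|f x| <= B.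
Proof.
move=> cf; pose K := [set x | dotv (x - v) (x - v) = r ^+ 2].
have cK : compact K.
  apply: bounded_closed_compact.
    exists (enorm v + `|r|); split; first exact: num_real.
    move=> M hM x /= Kx; apply: le_trans (ltW hM).
    rewrite [leLHS]/Num.Def.normr/= mx_normrE; apply: bigmax_le => [|[i j] _ /=].
      by rewrite addr_ge0 ?enorm_ge0.
    rewrite ord1; apply: (le_trans (coord_le_enorm _ _)).
    rewrite -{1}(subrK v x) addrC; apply: (le_trans (enormD _ _)); rewrite lerD2l.
    by apply: enorm_le => //; rewrite Kx real_normK ?num_real.
  have -> : K = (fun x => dotv (x - v) (x - v)) @^-1` [set r ^+ 2] by [].
  apply: closed_comp; last exact: closed_eq.
  by move=> x _; exact: continuous_dotv_sub.
have [[x0 Kx0]|nK] := pselect (K !=set0); last first.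
  by exists 0 => x Kx; exfalso; apply: nK; exists x.
have cfK : {within K, continuous (fun x => `|f x|)}.
  apply: continuous_in_subspaceT => x /set_mem Kx.
  exact: continuous_comp (cf x Kx) (@norm_continuous _ _ _).
have [c _ hc] := @EVT_max_rV _ _ _ K (ex_intro _ x0 Kx0) cK cfK.
by exists `|f c| => x Kx; apply: hc; exact/mem_set.
Qed.

End Euclidean.

(** * Decay at infinity and independence of the centre *)

Section Recentre.
Variables (R : realType) (U : set 'rV[R]_3) (ur ui : 'rV[R]_3 -> R) (kappa : R).
Hypotheses (oU : open U) (cur : class_C 2 U ur) (cui : class_C 2 U ui) (k0 : 0 < kappa).
Hypothesis helmr : forall x, U x -> \sum_i 'D_('e_ i) ('D_('e_ i) ur) x = - kappa ^+ 2 * ur x.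
Hypothesis helmi : forall x, U x -> \sum_i 'D_('e_ i) ('D_('e_ i) ui) x = - kappa ^+ 2 * ui x.

(** The real part of the radiation condition about the centre [c], for the solution ur + i ui: [r]
    is the distance to [c] and [n] the radial direction. *)
Definition radiates (c : 'rV[R]_3) := forall eps : R, 0 < eps ->
  exists r1 : R, forall (r : R) (n : 'rV[R]_3), r1 < r -> dotv n n = 1 ->
    `|r * (grd ur n (c + r *: n) + kappa * ui (c + r *: n))| <= eps.

Variable rho : R.
Hypotheses (rho0 : 0 < rho) (hU : forall x, rho < enorm x -> U x).

Lemma exterior_center (c x : 'rV[R]_3) : (rho + enorm c) ^+ 2 < dotv (x - c) (x - c) -> U x.
Proof.
move=> h; apply: hU; have c0 := enorm_ge0 c.
have {}h : rho + enorm c < enorm (x - c).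
  by rewrite -ltr_sqr ?nnegrE ?enorm_ge0 ?addr_ge0 ?(ltW rho0)// enorm_sqr.
by have := enormD x (- c); rewrite enormN; lra.
Qed.

Lemma far_germ (c e : 'rV[R]_3) : radiates c -> dotv e e = 1 -> exists2 d, 0 < d &
  agerm (fun t => farRe ur ui kappa c e t^-1) d /\ agerm (fun t => farIm ur ui kappa c e t^-1) d.
Proof.
move=> som e1; pose rho' := rho + enorm c; pose r0 := rho' + 1.
have c0 := enorm_ge0 c.
have rho'0 : 0 <= rho' by rewrite addr_ge0// ltW.
have rr0 : rho' < r0 by rewrite /r0; lra.
have sU x : dotv (x - c) (x - c) = r0 ^+ 2 -> U x.
  by move=> h; apply: (@exterior_center c); rewrite h ltrXn2r// nnegrE//; lra.
have [Br hBr] := @bounded_on_sphere R ur c r0 (fun x hx => cur.1 x (sU x hx)).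
have [Bi hBi] := @bounded_on_sphere R ui c r0 (fun x hx => cui.1 x (sU x hx)).
have [|[a ha] [b hb]] := @exterior_germ R U ur ui kappa oU cur cui k0 helmr helmi c rho' r0 (Num.max Br Bi)
   rho'0 rr0 (@exterior_center c) _ som e e1.
  by move=> x hx; rewrite !le_max hBr// hBi// orbT.
exists (8 * r0)^-1; first by rewrite invr_gt0 mulr_gt0//; lra.
by split; [exists a; do 2 eexists; exact: ha|exists b; do 2 eexists; exact: hb].
Qed.

Hypothesis som0 : radiates 0.

(** The truncation at [N = 0] of [exterior_germ] bounds r |psi| uniformly in the direction;
    restoring the phase mixes the two real parts and doubles the constant. Beyond [8 * r0] the
    variable 1/r lies in the interval of the germ. *)
Lemma radiation_decay : exists K r1 : R, [/\ 0 <= K, 0 < r1 &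
  forall x, r1 <= enorm x -> U x /\ (`|ur x| <= K / enorm x /\ `|ui x| <= K / enorm x)].
Proof.
have e0 : enorm (0 : 'rV[R]_3) = 0 by rewrite /enorm dotv3 !mxE !mulr0 !addr0 sqrtr0.
pose r0 := rho + 1.
have rr0 : rho < r0 by rewrite /r0; lra.
have r00 : 0 < r0 by exact: lt_trans rr0.
have cU x : rho ^+ 2 < dotv (x - 0) (x - 0) -> U x.
  by move=> h; apply: (@exterior_center 0); rewrite e0 addr0.
have sU x : dotv (x - 0) (x - 0) = r0 ^+ 2 -> U x.
  by move=> h; apply: cU; rewrite h ltrXn2r// ltW.
have [Br hBr] := @bounded_on_sphere R ur 0 r0 (fun x hx => cur.1 x (sU x hx)).
have [Bi hBi] := @bounded_on_sphere R ui 0 r0 (fun x hx => cui.1 x (sU x hx)).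
have hB x : dotv (x - 0) (x - 0) = r0 ^+ 2 -> `|ur x| <= Num.max Br Bi /\ `|ui x| <= Num.max Br Bi.
  by move=> hx; rewrite !le_max hBr// hBi// orbT.
have ext := @exterior_germ R U ur ui kappa oU cur cui k0 helmr helmi 0 rho r0 (Num.max Br Bi)
   (ltW rho0) rr0 cU hB som0.
set K := 512 * pi * _ * r0 * _ in ext.
have r80 : 0 < 8 * r0 by rewrite mulr_gt0.
have K0 : 0 <= K.
  have e1 : dotv ('e_ 0 : 'rV[R]_3) 'e_ 0 = 1 by rewrite dotv3 !mxE/= !mulr0 !addr0 mulr1.
  by have [[a []]] := ext _ e1.
exists (2 * K), (8 * r0); split=> //; first by rewrite mulr_ge0.
move=> x hx; have x0 : 0 < enorm x by apply: lt_le_trans hx.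
split; first by apply: hU; lra.
pose e := (enorm x)^-1 *: x; pose r := enorm x.
have e1 : dotv e e = 1.
  by apply: enorm_eq1; rewrite enormZ gtr0_norm ?invr_gt0// mulVf// lt0r_neq0.
have xe : x = 0 + r *: e by rewrite add0r scalerA mulfV ?scale1r// lt0r_neq0.
have ht : 0 < r^-1 <= (8 * r0)^-1 by rewrite invr_gt0 x0/= lef_pV2.
have [[a [_ _ _ _ hr]] [b [_ _ _ _ hi]]] := ext e e1.
have {}hr : `|farRe ur ui kappa 0 e r| <= K.
  by have := hr 0%N _ ht; rewrite /psum big_geq// subr0 expr0 mulr1 invrK.
have {}hi : `|farIm ur ui kappa 0 e r| <= K.
  by have := hi 0%N _ ht; rewrite /psum big_geq// subr0 expr0 mulr1 invrK.
have c1 : `|cos (kappa * r)| <= 1 by rewrite ler_norml cos_geN1 cos_le1.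
have s1 : `|sin (kappa * r)| <= 1 by rewrite ler_norml sin_geN1 sin_le1.
have bnd (c s p q : R) : `|c| <= 1 -> `|s| <= 1 -> `|p| <= K -> `|q| <= K -> `|c * p + s * q| <= 2 * K.
  move=> hc hs hp hq; apply: le_trans (ler_normD _ _) _; rewrite !normrM.
  have -> : 2 * K = 1 * K + 1 * K by ring.
  by apply: lerD; apply: ler_pM.
have cs := cos2Dsin2 (kappa * r).
have er : r * ur x = cos (kappa * r) * farRe ur ui kappa 0 e r + - sin (kappa * r) * farIm ur ui kappa 0 e r.
  rewrite /farRe /farIm -xe.
  transitivity ((cos (kappa * r) ^+ 2 + sin (kappa * r) ^+ 2) * (r * ur x)); first by rewrite cs mul1r.
  by ring.
have ei : r * ui x = sin (kappa * r) * farRe ur ui kappa 0 e r + cos (kappa * r) * farIm ur ui kappa 0 e r.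
  rewrite /farRe /farIm -xe.
  transitivity ((cos (kappa * r) ^+ 2 + sin (kappa * r) ^+ 2) * (r * ui x)); first by rewrite cs mul1r.
  by ring.
rewrite !ler_pdivlMr//; split.
  by rewrite -[X in _ * X](gtr0_norm x0) -normrM mulrC er bnd// normrN.
by rewrite -[X in _ * X](gtr0_norm x0) -normrM mulrC ei bnd.
Qed.

(** On a ball of fixed radius about x the solution is O(1 / |x|), and the interior gradient estimate
    transfers this decay to the derivatives. *)
Lemma gradient_decay : exists G r1 : R, [/\ 0 <= G, 0 < r1 &
  forall x v, r1 <= enorm x -> `|grd ur v x| <= enorm v * (G / enorm x)].
Proof.
have [K [r1 [K0 r10 hK]]] := radiation_decay.
pose d := Num.min 1 kappa^-1.
have d0 : 0 < d by rewrite lt_min ltr01 invr_gt0.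
have d1 : d <= 1 by rewrite ge_min lexx.
have kd : kappa * d <= 1.
  by rewrite -(mulfV (lt0r_neq0 k0)) ler_pM2l// ge_min lexx orbT.
pose G := 2048 * pi * (2 * K) / d.
have G0 : 0 <= G := divr_ge0 (mulr_ge0 (mulr_ge0 (ler0n _ 2048) (pi_ge0 R)) (mulr_ge0 (ler0n _ 2) K0)) (ltW d0).
(* The margin keeps the unit ball about x beyond [r1], with norms at least half of |x|. *)
exists G, (r1 + 2); split=> //; first lra.
move=> x v hx; have x0 : 0 < enorm x by lra.
have [->|v0] := eqVneq v 0.
  by rewrite grd0 normr0; apply: mulr_ge0; [exact: enorm_ge0|exact: divr_ge0 G0 (ltW x0)].
have ev : 0 < enorm v by rewrite sqrtr_gt0 dotv_gt0.
pose e := (enorm v)^-1 *: v.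
have e1 : dotv e e = 1.
  by apply: enorm_eq1; rewrite enormZ gtr0_norm ?invr_gt0// mulVf// lt0r_neq0.
have -> : v = enorm v *: e by rewrite scalerA mulfV ?scale1r// lt0r_neq0.
rewrite grdZ normrM enormZ (gtr0_norm ev) -mulrA ler_pM2l//.
have -> : enorm e = 1 by rewrite enormZ gtr0_norm ?invr_gt0// mulVf// lt0r_neq0.
rewrite mul1r.
have -> : G / enorm x = 2048 * pi * (2 * K / enorm x) / d by rewrite /G; ring.
apply: (interior_gradient oU cur k0 helmr) => // y hy.
have yx : enorm (x - y) <= 1.
  rewrite -enormN opprB; apply: le_trans d1; apply: ltW.
  by rewrite -ltr_sqr ?nnegrE ?enorm_ge0 ?(ltW d0)// enorm_sqr.
have y1 : enorm x - 1 <= enorm y.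
  by have := enormD (x - y) y; rewrite subrK; lra.
have ry : r1 <= enorm y by lra.
have [Uy [h _]] := hK y ry; split=> //; apply: le_trans h _.
have y0 : 0 < enorm y by lra.
rewrite ler_pdivrMr// mulrAC ler_pdivlMr//.
have -> : 2 * K * enorm y = K * (2 * enorm y) by ring.
by rewrite ler_wpM2l//; lra.
Qed.

(** The radial directions [n] from [c] and [m] from the origin differ by O(1/r), and the gradient is
    O(1/r), so replacing one direction by the other changes the condition by O(1/r). *)
Lemma radiates_recentre (c : 'rV[R]_3) : radiates c.
Proof.
move=> eps eps0.
have [G [r1 [G0 r10 hG]]] := gradient_decay.
have [r2 hr2] := som0 (divr_gt0 eps0 (ltr0n _ 4)).
have c0 := enorm_ge0 c.
pose q := 8 * enorm c * G / eps.
(* The first threshold gives [X >= r / 2], the next two carry [r1] and [r2] over to [X], and the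
   last makes the change of direction cost at most [eps / 2]. *)
exists (Num.max (Num.max (2 * enorm c) (2 * r1)) (Num.max (2 * r2) (2 * q))) => r n.
rewrite !gt_max => /andP[/andP[h1 h2] /andP[h3 h4]] n1.
have r0 : 0 < r by lra.
have nn : enorm n = 1 by rewrite /enorm n1 sqrtr1.
set x := c + r *: n; pose X := enorm x; pose m := X^-1 *: x.
have rn : enorm (r *: n) = r by rewrite enormZ nn mulr1 gtr0_norm.
have X1 : r - enorm c <= X.
  by have := enormD x (- c); rewrite enormN /x addrAC subrr add0r rn -/x -/X; lra.
have X2 : X <= r + enorm c by rewrite /X /x addrC (le_trans (enormD _ _))// rn.
have Xr : r / 2 <= X by lra.
have X0 : 0 < X by lra.
have m1 : dotv m m = 1.
  by apply: enorm_eq1; rewrite enormZ gtr0_norm ?invr_gt0// mulVf// lt0r_neq0.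
have xm : x = 0 + X *: m by rewrite add0r scalerA mulfV ?scale1r// lt0r_neq0.
have hm : `|X * (grd ur m x + kappa * ui x)| <= eps / 4.
  by have := hr2 X m; rewrite -xm; apply => //; lra.
(* Both terms of the decomposition have norm at most |c| / r, because [|X - r| <= enorm c]. *)
have dn : enorm (n - m) <= 2 * enorm c / r.
  have -> : n - m = (X - r) / (r * X) *: x - r^-1 *: c.
    have -> : n = r^-1 *: (x - c) by rewrite /x addrAC subrr add0r scalerA mulVf ?scale1r// lt0r_neq0.
    rewrite /m scalerBr addrAC -scalerBl; congr (_ *: _ - _).
    by field; rewrite !lt0r_neq0.
  apply: le_trans (enormD _ _) _; rewrite enormN !enormZ.
  have -> : `|r^-1| = r^-1 by rewrite gtr0_norm// invr_gt0.
  have -> : `|(X - r) / (r * X)| = `|X - r| / (r * X) by rewrite normrM [X in _ * X]gtr0_norm// invr_gt0 mulr_gt0.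
  rewrite -/X.
  have -> : `|X - r| / (r * X) * X = `|X - r| / r by field; rewrite !lt0r_neq0.
  have h : `|X - r| <= enorm c by rewrite ler_norml; lra.
  have -> : 2 * enorm c / r = enorm c / r + r^-1 * enorm c by ring.
  by rewrite lerD2r ler_pM2r// invr_gt0.
have -> : r * (grd ur n x + kappa * ui x) = r / X * (X * (grd ur m x + kappa * ui x)) + r * grd ur (n - m) x.
  have -> : grd ur n x = grd ur m x + grd ur (n - m) x.
    have -> : n = 1 *: m + 1 *: (n - m) by rewrite !scale1r addrC subrK.
    by rewrite grd_lin !mul1r scale1r addrAC !scale1r subrr add0r.
  by field; rewrite lt0r_neq0.
apply: le_trans (ler_normD _ _) _.
have i1 : `|r / X * (X * (grd ur m x + kappa * ui x))| <= 2 * (eps / 4).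
  rewrite normrM; apply: ler_pM => //.
  have rX : 0 <= r / X by rewrite divr_ge0// ltW.
  by rewrite ger0_norm// ler_pdivrMr//; lra.
have i2 : `|r * grd ur (n - m) x| <= eps / 2.
  rewrite normrM (gtr0_norm r0).
  have hg := hG x (n - m) (_ : r1 <= enorm x); have {}hg : `|grd ur (n - m) x| <= enorm (n - m) * (G / X).
    by apply: hg; rewrite -/X; lra.
  apply: (@le_trans _ _ (r * (2 * enorm c / r * (G / X)))).
    by rewrite ler_pM2l//; apply: (le_trans hg); rewrite ler_wpM2r// divr_ge0// ltW.
  have -> : r * (2 * enorm c / r * (G / X)) = 2 * enorm c * G / X by field; rewrite !lt0r_neq0.
  rewrite ler_pdivrMr//.
  have : 8 * enorm c * G < eps * r / 2.
    move: h4; rewrite /q mulrA ltr_pdivrMr//; lra.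
  have : eps * (r / 2) <= eps * X by rewrite ler_pM2l.
  have := mulr_gt0 eps0 X0.
  lra.
lra.
Qed.

End Recentre.

(** * Uniqueness along a ray *)

Section LocallyAnalytic.
Variable R : realType.
Implicit Types (f g : R -> R) (al be : R).

(* Near each point of ]al, be[, [f] has one-sided power series expansions to the
   right of every point, on intervals of a common length. *)
Definition locan f al be := forall x : R, al < x < be ->
  exists2 d : R, 0 < d & forall c : R, `|c - x| < d -> agerm (fun t => f (c + t)) d.

Lemma locan_min f g al be x : locan f al be -> locan g al be -> al < x < be ->
  exists2 d : R, 0 < d & forall c : R, `|c - x| < d ->
    agerm (fun t => f (c + t)) d /\ agerm (fun t => g (c + t)) d.
Proof.
move=> hf hg xI; have [d d0 hd] := hf x xI; have [e e0 he] := hg x xI.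
exists (Num.min d e); first by rewrite lt_min d0.
move=> c; rewrite lt_min => /andP[cd ce]; split.
  by apply: agerm_sub (hd c cd); rewrite ge_min lexx.
by apply: agerm_sub (he c ce); rewrite ge_min lexx orbT.
Qed.

Lemma locanD f g al be : locan f al be -> locan g al be -> locan (fun s => f s + g s) al be.
Proof.
move=> hf hg x xI; have [d d0 hd] := locan_min hf hg xI; exists d => // c cd.
by have [h1 h2] := hd c cd; exact: agermD.
Qed.

Lemma locanB f g al be : locan f al be -> locan g al be -> locan (fun s => f s - g s) al be.
Proof.
move=> hf hg x xI; have [d d0 hd] := locan_min hf hg xI; exists d => // c cd.
by have [h1 h2] := hd c cd; exact: agermB.
Qed.

Lemma locanM f g al be : locan f al be -> locan g al be -> locan (fun s => f s * g s) al be.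
Proof.
move=> hf hg x xI; have [d d0 hd] := locan_min hf hg xI.
have d2 : 0 < d / 2 by rewrite divr_gt0.
exists (d / 2) => // c cd; have [|h1 h2] := hd c; first by lra.
exact: agermM.
Qed.

Lemma locan_eq0 f al be p q : locan f al be -> al <= p -> p < q -> q <= be ->
  (forall x, p < x < q -> f x = 0) -> forall x, p < x < be -> f x = 0.
Proof.
move=> hf alp pq qbe; apply: (germ_propagate alp pq qbe) => x xI.
have [d d0 hd] := hf x xI; have d2 : 0 < d / 2 by rewrite divr_gt0.
exists (d / 2) => // c cd; have -> : 2 * (d / 2) = d by field.
by apply: hd; lra.
Qed.

End LocallyAnalytic.

Section Helmholtz.
Variables (R : realType) (U : set 'rV[R]_3) (u : 'rV[R]_3 -> R) (kappa : R).
Hypotheses (oU : open U) (cu : class_C 2 U u) (k0 : 0 < kappa).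
Hypothesis helm : forall x, U x -> \sum_i 'D_('e_ i) ('D_('e_ i) u) x = - kappa ^+ 2 * u x.

(** One radius [rho] serves all centres within rho / 16: the ball of radius rho about such a centre
    lies in the ball of radius 2 rho about [x1], where [u] is defined and bounded. *)
Lemma locan_line (x0 e : 'rV[R]_3) al be : dotv e e = 1 ->
  (forall s, al < s < be -> U (x0 + s *: e)) -> locan (fun s => u (x0 + s *: e)) al be.
Proof.
move=> e1 hU s sI; have Us := hU s sI; set x1 := x0 + s *: e in Us.
have [d1 d10 hd1] := nbhs_enorm_ball (open_nbhs_nbhs (conj oU Us)).
have : \forall y \near x1, `|u x1 - u y| < 1 by have /cvgrPdist_lt := cu.1 _ Us; apply.
move=> /nbhs_enorm_ball[d2 d20 hd2].
pose rho := Num.min (Num.min (d1 / 2) (d2 / 2)) kappa^-1.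
have rho0 : 0 < rho by rewrite !lt_min !divr_gt0// invr_gt0.
have r1 : rho <= d1 / 2 by rewrite !ge_min lexx.
have r2 : rho <= d2 / 2 by rewrite !ge_min lexx orbT.
have kr : kappa * rho <= 1.
  by rewrite -(mulfV (lt0r_neq0 k0)) ler_pM2l// ge_min lexx orbT.
exists (rho / 16); first by rewrite divr_gt0.
move=> c cs.
have [y|a ha] := @interior_germ R U u kappa oU cu k0 helm (x0 + c *: e) e rho (`|u x1| + 1) e1 rho0 kr.
  move=> hy.
  have {}hy : enorm (y - (x0 + c *: e)) < rho.
    by rewrite -ltr_sqr ?nnegrE ?enorm_ge0 ?(ltW rho0)// enorm_sqr.
  have yx : enorm (y - x1) < 2 * rho.
    have -> : y - x1 = (y - (x0 + c *: e)) + (c - s) *: e.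
      by rewrite /x1 scalerBl opprD addrA addrA; congr (_ - _); rewrite opprD addrA subrK.
    apply: le_lt_trans (enormD _ _) _; rewrite enormZ.
    have -> : enorm e = 1 by rewrite /enorm e1 sqrtr1.
    by rewrite mulr1; lra.
  split; first by apply: hd1; lra.
  have /hd2 h : enorm (y - x1) < d2 by lra.
  have := lerB_dist (u y) (u x1); rewrite distrC in h; lra.
apply: (@agerm_ext _ (fun t => u (x0 + c *: e + t *: e))); last by exists a; do 2 eexists; exact: ha.
by move=> t _; rewrite scalerDl addrA.
Qed.

End Helmholtz.

(** * The plane wave as a solution of the Helmholtz equation *)

Section PlaneWave.
Variables (R : realType) (k : 'rV[R]_3).

(** Two coefficients make the family stable under differentiation; (1, 0) and (0, 1) give the real
    and imaginary parts of psi0. The analyticity of psi0 along lines then follows from [locan_line],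
    as for any other solution. *)
Definition wave (a b : R) (x : 'rV[R]_3) : R := a * cos (dotv k x) + b * sin (dotv k x).

Lemma dotv_line (x v : 'rV[R]_3) (s : R) : dotv k (x + s *: v) = dotv k x + s * dotv k v.
Proof. by rewrite !dotv3 !mxE; ring. Qed.

Lemma is_derive_wave a b x v : is_derive x v (wave a b) (wave (b * dotv k v) (- a * dotv k v) x).
Proof.
apply: is_derive_line.
pose f (y : R) : R := a * cos y + b * sin y.
have df (y : R) : is_derive y 1 f (- a * sin y + b * cos y).
  by apply: (is_derive_eq (derD (derZ a (is_derive_cos y)) (derZ b (is_derive_sin y)))); ring.
apply: (@der_ext _ (fun s : R => f (dotv k x + s * dotv k v))).
  by near=> s; rewrite /wave dotv_line.
apply: (is_derive_eq (der_comp (df _) (derD (der_cst _ _) (derM (is_derive_id _ _) (der_cst _ _))))).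
by rewrite /wave mul0r addr0; ring.
Unshelve. all: by end_near. Qed.

Lemma continuous_wave a b : continuous (wave a b).
Proof.
move=> x.
have ck : {for x, continuous (dotv k : 'rV[R]_3 -> R)}.
  apply: (@cvg_sumr _ _ (nbhs x) (nbhs_filter x)) => i.
  have hc : (fun y : 'rV[R]_3 => y 0 i) y @[y --> x] --> x 0 i by exact: coord_continuous.
  exact: (cvgM (cvg_cst _) hc).
have cc := continuous_comp ck (@continuous_cos R (dotv k x)).
have cs := continuous_comp ck (@continuous_sin R (dotv k x)).
exact: (cvgD (cvgM (cvg_cst _) cc) (cvgM (cvg_cst _) cs)).
Qed.

Lemma derive_wave a b v : 'D_v (wave a b) = wave (b * dotv k v) (- a * dotv k v).
Proof. by apply/funext => x; case: (is_derive_wave a b x v) => _ ->. Qed.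

Lemma class_C_wave m (U : set 'rV[R]_3) a b : class_C m U (wave a b).
Proof.
elim: m a b => [|m IH] a b; split=> //; try by move=> x _; exact: continuous_wave.
move=> i; split; first by move=> x _; case: (is_derive_wave a b x ('e_ i)).
by rewrite derive_wave; exact: IH.
Qed.

Lemma helmholtz_wave a b x :
  \sum_i 'D_('e_ i) ('D_('e_ i) (wave a b)) x = - dotv k k * wave a b x.
Proof.
have e i : dotv k ('e_ i) = k 0 i.
  rewrite /dotv (bigD1 i)//= big1 ?addr0 => [|j ji]; first by rewrite mxE !eqxx mulr1.
  by rewrite mxE (negbTE ji) andbF mulr0.
rewrite [dotv k k]/dotv -sumrN mulr_suml; apply: eq_bigr => i _.
rewrite derive_wave e; apply: (etrans (congr1 (fun f => f x) (derive_wave (b * k 0 i) (- a * k 0 i) ('e_ i)))).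
by rewrite e /wave; ring.
Qed.

End PlaneWave.

Lemma agerm_bounded (R : realType) (f : R -> R) d : agerm f d ->
  exists2 K, 0 <= K & forall t, 0 < t <= d -> `|f t| <= K.
Proof.
move=> [a [A [s [A0 _ _ _ h]]]]; exists A => // t ht.
by have := h 0%N t ht; rewrite /psum big_geq// subr0 expr0 mulr1.
Qed.

(** * Comparison of two solutions on one ray *)

Section RayUniqueness.
Variables (R : realType) (U : set 'rV[R]_3) (ur ui vr vi : 'rV[R]_3 -> R) (kappa rho : R).
Hypotheses (oU : open U) (k0 : 0 < kappa) (rho0 : 0 < rho).
Hypothesis hU : forall x, rho < enorm x -> U x.
Hypotheses (cur : class_C 2 U ur) (cui : class_C 2 U ui) (cvr : class_C 2 U vr) (cvi : class_C 2 U vi).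
Hypothesis helmur : forall x, U x -> \sum_i 'D_('e_ i) ('D_('e_ i) ur) x = - kappa ^+ 2 * ur x.
Hypothesis helmui : forall x, U x -> \sum_i 'D_('e_ i) ('D_('e_ i) ui) x = - kappa ^+ 2 * ui x.
Hypothesis helmvr : forall x, U x -> \sum_i 'D_('e_ i) ('D_('e_ i) vr) x = - kappa ^+ 2 * vr x.
Hypothesis helmvi : forall x, U x -> \sum_i 'D_('e_ i) ('D_('e_ i) vi) x = - kappa ^+ 2 * vi x.
Hypotheses (radu : radiates ur ui kappa 0) (radv : radiates vr vi kappa 0).
Variables (k x0 e : 'rV[R]_3).
Hypotheses (kk : dotv k k = kappa ^+ 2) (e1 : dotv e e = 1) (ke : dotv k e < kappa).
Hypothesis rayU : forall s, 0 < s -> U (x0 + s *: e).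

Let X (s : R) := x0 + s *: e.

(* The difference of the intensities along the ray, without the common term
   [|psi0| ^ 2]. *)
Let I (s : R) : R :=
  2 * (wave k 1 0 (X s) * (ur (X s) - vr (X s)) + wave k 0 1 (X s) * (ui (X s) - vi (X s)))
  + ((ur (X s) * ur (X s) + ui (X s) * ui (X s)) - (vr (X s) * vr (X s) + vi (X s) * vi (X s))).

Let locan_I be : locan I 0 be.
Proof.
have hX s : 0 < s < be -> U (x0 + s *: e) by move=> /andP[s0 _]; exact: rayU.
have lur := locan_line oU cur k0 helmur e1 hX; have lui := locan_line oU cui k0 helmui e1 hX.
have lvr := locan_line oU cvr k0 helmvr e1 hX; have lvi := locan_line oU cvi k0 helmvi e1 hX.
have lw a b : locan (fun s => wave k a b (x0 + s *: e)) 0 be.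
  apply: (@locan_line R setT (wave k a b) kappa openT _ k0 _ x0 e) => //.
  - exact: class_C_wave.
  - by move=> x _; rewrite helmholtz_wave kk.
have l2 : locan (fun s => 2 * (wave k 1 0 (X s) * (ur (X s) - vr (X s)) + wave k 0 1 (X s) * (ui (X s) - vi (X s)))) 0 be.
  have h := locanD (locanM (lw 1 0) (locanB lur lvr)) (locanM (lw 0 1) (locanB lui lvi)).
  move=> x xI; have [d d0 hd] := h x xI; exists d => // c cd.
  exact: (agermZ 2 (hd c cd)).
exact: (locanD l2 (locanB (locanD (locanM lur lur) (locanM lui lui)) (locanD (locanM lvr lvr) (locanM lvi lvi)))).
Qed.

Let ray_far p : (forall s, p < s -> I s = 0) ->
  exists S : R, forall s, S < s -> ur (X s) = vr (X s) /\ ui (X s) = vi (X s).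
Proof.
move=> I0.
have [d1 d10 [gur gui]] := far_germ oU cur cui k0 helmur helmui rho0 hU
  (radiates_recentre oU cur cui k0 helmur helmui rho0 hU radu x0) e1.
have [d2 d20 [gvr gvi]] := far_germ oU cvr cvi k0 helmvr helmvi rho0 hU
  (radiates_recentre oU cvr cvi k0 helmvr helmvi rho0 hU radv x0) e1.
(* The bound 1 serves to absorb [t ^+ n.+1] into [t ^+ n]. *)
pose d := Num.min (Num.min d1 d2) 1.
have d0 : 0 < d by rewrite !lt_min d10 d20 ltr01.
have dd1 : d <= d1 by rewrite !ge_min lexx.
have dd2 : d <= d2 by rewrite !ge_min lexx orbT.
have d_1 : d <= 1 by rewrite ge_min lexx orbT.
have {}gur := agerm_sub dd1 gur; have {}gui := agerm_sub dd1 gui.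
have {}gvr := agerm_sub dd2 gvr; have {}gvi := agerm_sub dd2 gvi.
pose fr t := farRe ur ui kappa x0 e t^-1; pose fi t := farIm ur ui kappa x0 e t^-1.
pose gr t := farRe vr vi kappa x0 e t^-1; pose gi t := farIm vr vi kappa x0 e t^-1.
pose hr t := fr t - gr t; pose hi t := fi t - gi t.
have [K1 K10 b1] := agerm_bounded gur. have [K2 K20 b2] := agerm_bounded gui.
have [K3 K30 b3] := agerm_bounded gvr. have [K4 K40 b4] := agerm_bounded gvi.
pose K := K1 + K2 + K3 + K4.
have K0 : 0 <= K by rewrite !addr_ge0.
have rec (r : R) (wr wi : 'rV[R]_3 -> R) :
    r * wr (X r) = cos (kappa * r) * farRe wr wi kappa x0 e r - sin (kappa * r) * farIm wr wi kappa x0 e r /\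
    r * wi (X r) = sin (kappa * r) * farRe wr wi kappa x0 e r + cos (kappa * r) * farIm wr wi kappa x0 e r.
  rewrite /farRe /farIm -/(X r); have cs := cos2Dsin2 (kappa * r); split.
    transitivity ((cos (kappa * r) ^+ 2 + sin (kappa * r) ^+ 2) * (r * wr (X r))); first by rewrite cs mul1r.
    by ring.
  transitivity ((cos (kappa * r) ^+ 2 + sin (kappa * r) ^+ 2) * (r * wi (X r))); first by rewrite cs mul1r.
  by ring.
pose a := dotv k x0; pose om := kappa - dotv k e.
have om0 : 0 < om by rewrite subr_gt0.
(* In [r ^+ 2 * I r = 0] the quadratic terms become squares of the far-field functions, the phase
   having modulus 1, and their difference factors through [hr] and [hi]. The interference term keeps
   one factor [r], which is the gain [t] on the right. *)
have key (t : R) : 0 < t <= d -> p < t^-1 ->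
    `|cos (a - om * t^-1) * hr t + sin (a - om * t^-1) * hi t| <= K * t * (`|hr t| + `|hi t|).
  move=> ht pt; have /andP[t0 _] := ht; set r := t^-1 in pt *.
  have r0 : 0 < r by rewrite invr_gt0.
  have [e2 e3] := rec r ur ui; have [e4 e5] := rec r vr vi.
  have -> : a - om * r = (a + r * dotv k e) - kappa * r by rewrite /om; ring.
  rewrite cosB sinB; set c := cos (kappa * r) in e2 e3 e4 e5 *; set s := sin (kappa * r) in e2 e3 e4 e5 *.
  have cs : c ^+ 2 + s ^+ 2 = 1 by exact: cos2Dsin2.
  have e6 : 2 * r * ((cos (a + r * dotv k e) * c + sin (a + r * dotv k e) * s) * hr t +
      (sin (a + r * dotv k e) * c - cos (a + r * dotv k e) * s) * hi t) =
      - (hr t * (fr t + gr t) + hi t * (fi t + gi t)).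
    have := I0 r pt; rewrite /I /wave dotv_line -/a mul1r mul0r addr0 mul0r add0r mul1r => h.
    have h2 : 2 * r * (cos (a + r * dotv k e) * (r * ur (X r) - r * vr (X r)) + sin (a + r * dotv k e) * (r * ui (X r) - r * vi (X r)))
       + ((r * ur (X r)) ^+ 2 + (r * ui (X r)) ^+ 2 - ((r * vr (X r)) ^+ 2 + (r * vi (X r)) ^+ 2)) = 0.
      by rewrite -[RHS](mulr0 (r ^+ 2)) -[in RHS]h; ring.
    rewrite e2 e3 e4 e5 -/(fr t) -/(fi t) -/(gr t) -/(gi t) in h2.
    have h3 (x y : R) : (c * x - s * y) ^+ 2 + (s * x + c * y) ^+ 2 = x ^+ 2 + y ^+ 2.
      by rewrite -[RHS]mul1r -[in RHS]cs; ring.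
    rewrite !h3 in h2.
    apply/eqP; rewrite -subr_eq0 opprK; apply/eqP; rewrite -[RHS]h2 /hr /hi; ring.
  have r2 : 0 < 2 * r by rewrite mulr_gt0.
  rewrite -(ler_pM2l r2) -{1}(gtr0_norm r2) -normrM e6 normrN.
  have -> : 2 * r * (K * t * (`|hr t| + `|hi t|)) = 2 * K * (`|hr t| + `|hi t|).
    by rewrite /r; field; rewrite lt0r_neq0.
  apply: le_trans (ler_normD _ _) _; rewrite [leRHS]mulrDr; apply: lerD; rewrite normrM mulrC ler_wpM2r//.
    by apply: le_trans (ler_normD _ _) _; have := b1 t ht; have := b3 t ht; rewrite -/(fr t) -/(gr t) /K; lra.
  by apply: le_trans (ler_normD _ _) _; have := b2 t ht; have := b4 t ht; rewrite -/(fi t) -/(gi t) /K; lra.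
have ghr : agerm hr d by exact: agermB.
have ghi : agerm hi d by exact: agermB.
have [h0|[n [al [be [M [ab M0 hM]]]]]] := germ_pair_lead d0 ghr ghi.
  exists d^-1 => s ds.
  have s0 : 0 < s by apply: lt_trans ds; rewrite invr_gt0.
  have ht : 0 < s^-1 <= d by rewrite invr_gt0 s0/= -(invrK d) lef_pV2 ?posrE ?invr_gt0// ltW.
  have [/eqP + /eqP] := h0 _ ht; rewrite !subr_eq0 /fr /fi /gr /gi invrK => /eqP h1 /eqP h2.
  have [e2 e3] := rec s ur ui; have [e4 e5] := rec s vr vi.
  by split; apply: (mulfI (lt0r_neq0 s0)); rewrite ?e2 ?e4 ?e3 ?e5 h1 h2.
(* [2 * M] pays for replacing [hr] and [hi] by their leading terms on the left of [key]; the other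
   term bounds its right-hand side. *)
exfalso; pose L := K * (`|al| + `|be| + 2 * M) + 2 * M.
have L0 : 0 <= L by rewrite addr_ge0 ?mulr_ge0 ?addr_ge0 ?mulr_ge0.
(* Since [om] is positive, any phase [z] is reached at arbitrarily large [r]. The three thresholds
   ensure that [I] vanishes, that the expansions hold, and that [L / r] is smaller than [|W|]. *)
have lead z : cos (a - z) * al + sin (a - z) * be = 0.
  set c := cos (a - z); set s := sin (a - z); pose W := c * al + s * be; rewrite -/W.
  apply/eqP; rewrite -normr_le0 leNgt; apply/negP => W0.
  have [r hr0 [hc hs]] := far_phase om0 z (Num.max (Num.max p d^-1) (L / `|W|)).
  move: hr0; rewrite !gt_max => /andP[/andP[pr dr] Lr].
  have r0 : 0 < r by apply: lt_trans dr; rewrite invr_gt0.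
  pose t := r^-1; have t0 : 0 < t by rewrite invr_gt0.
  have td : t <= d by rewrite -(invrK d) lef_pV2 ?posrE ?invr_gt0// ltW.
  have ht : 0 < t <= d by rewrite t0.
  have t1 : t <= 1 by apply: le_trans td _.
  have [m1 m2] := hM t ht.
  have := key t ht; rewrite invrK => /(_ pr).
  have -> : cos (a - om * r) = c by rewrite /c !cosB hc hs.
  have -> : sin (a - om * r) = s by rewrite /s !sinB hc hs.
  move=> hk.
  have c1 : `|c| <= 1 by rewrite ler_norml cos_geN1 cos_le1.
  have s1 : `|s| <= 1 by rewrite ler_norml sin_geN1 sin_le1.
  have tn : 0 < t ^+ n by rewrite exprn_gt0.
  have q1 : `|hr t| <= (`|al| + M) * t ^+ n.
    have -> : hr t = (hr t - al * t ^+ n) + al * t ^+ n by rewrite subrK.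
    apply: le_trans (ler_normD _ _) _; rewrite mulrDl addrC; apply: lerD.
      by rewrite normrM (gtr0_norm tn).
    by apply: (le_trans m1); rewrite ler_wpM2l// exprS ler_piMl// ltW.
  have q2 : `|hi t| <= (`|be| + M) * t ^+ n.
    have -> : hi t = (hi t - be * t ^+ n) + be * t ^+ n by rewrite subrK.
    apply: le_trans (ler_normD _ _) _; rewrite mulrDl addrC; apply: lerD.
      by rewrite normrM (gtr0_norm tn).
    by apply: (le_trans m2); rewrite ler_wpM2l// exprS ler_piMl// ltW.
  have q3 : `|W| * t ^+ n <= L * t * t ^+ n.
    rewrite -{1}(gtr0_norm tn) -normrM.
    have -> : W * t ^+ n = (c * hr t + s * hi t) - (c * (hr t - al * t ^+ n) + s * (hi t - be * t ^+ n)) by rewrite /W; ring.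
    apply: le_trans (ler_normB _ _) _.
    have -> : L * t * t ^+ n = K * t * ((`|al| + M) * t ^+ n + (`|be| + M) * t ^+ n) + (1 * (M * t ^+ n.+1) + 1 * (M * t ^+ n.+1)).
      by rewrite /L exprS; ring.
    apply: lerD.
      by apply: (le_trans hk); apply: ler_wpM2l; [rewrite mulr_ge0// ltW|exact: (lerD q1 q2)].
    apply: le_trans (ler_normD _ _) _; rewrite !normrM; apply: lerD; exact: ler_pM.
  move: q3; rewrite ler_pM2r// /t ler_pdivlMr// => q4.
  by move: Lr; rewrite ltr_pdivrMr// ltNge mulrC q4.
have al0 : al = 0 by have := lead a; rewrite subrr cos0 sin0 mul1r mul0r addr0.
have be0 : be = 0.
  have := lead (a - pi / 2); have -> : a - (a - pi / 2) = pi / 2 by ring.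
  by rewrite cos_pihalf sin_pihalf mul1r mul0r add0r.
by move: ab; rewrite al0 be0 eqxx.
Qed.

(** Right-hand expansions carry the vanishing of the intensity difference from ]p, q[ to all larger
    parameters, never to smaller ones; the equality obtained far away must therefore be brought back
    along the reversed line. *)
Lemma ray_uniqueness p q : 0 < p -> p < q -> (forall s, p < s < q ->
    (wave k 1 0 (X s) + ur (X s)) ^+ 2 + (wave k 0 1 (X s) + ui (X s)) ^+ 2 =
    (wave k 1 0 (X s) + vr (X s)) ^+ 2 + (wave k 0 1 (X s) + vi (X s)) ^+ 2) ->
  forall s, 0 < s -> ur (X s) = vr (X s) /\ ui (X s) = vi (X s).
Proof.
move=> p0 pq hI.
have I0 s : p < s -> I s = 0.
  move=> ps; apply: (@locan_eq0 _ I 0 (s + q) p q (@locan_I _)) => //; first exact: ltW.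
  - by lra.
  - move=> y yI; have := hI y yI => /eqP; rewrite -subr_eq0 => /eqP <-.
    by rewrite /I; ring.
  - by apply/andP; split => //; lra.
have [S hS] := ray_far I0.
pose T := Num.max S 0.
have T0 : 0 <= T by rewrite le_max lexx orbT.
have hT s : T < s -> ur (X s) = vr (X s) /\ ui (X s) = vi (X s).
  by rewrite gt_max => /andP[h _]; exact: hS.
(* Continuation towards [x0], along the ray with direction [- e]. *)
have back (f g : 'rV[R]_3 -> R) : class_C 2 U f -> class_C 2 U g ->
    (forall x, U x -> \sum_i 'D_('e_ i) ('D_('e_ i) f) x = - kappa ^+ 2 * f x) ->
    (forall x, U x -> \sum_i 'D_('e_ i) ('D_('e_ i) g) x = - kappa ^+ 2 * g x) ->
    (forall s, T < s -> f (X s) = g (X s)) -> forall s, 0 < s -> f (X s) = g (X s).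
  move=> cf cg hf hg fg s s0; have [|sT] := ltP T s; first exact: fg.
  have ne1 : dotv (- e) (- e) = 1 by rewrite -scaleN1r dotvZ sqrrN expr1n mul1r.
  have XN (y : R) : x0 + y *: - e = X (- y) by rewrite /X scalerN scaleNr.
  have rN y : - (T + 2) < y < 0 -> U (x0 + y *: - e).
    by move=> /andP[_ y0]; rewrite XN; apply: rayU; lra.
  have lf := locan_line oU cf k0 hf ne1 rN; have lg := locan_line oU cg k0 hg ne1 rN.
  have := locan_eq0 (locanB lf lg) (lexx _) (_ : - (T + 2) < - (T + 1)) (_ : - (T + 1) <= 0).
  have h1 : - (T + 2) < - (T + 1) by lra. have h2 : - (T + 1) <= 0 by lra.
  move=> /(_ h1 h2) h.
  have {}h := h _ (- s); rewrite XN opprK in h.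
  apply/eqP; rewrite -subr_eq0; apply/eqP; apply: h; last by lra.
  move=> y /andP[y1 y2]; rewrite XN fg ?subrr//; lra.
by move=> s s0; split; [apply: back => // y /hT[]|apply: back => // y /hT[]].
Qed.

End RayUniqueness.

Local Open Scope complex_scope.

Lemma sum_complex (R : realType) (f g : 'I_3 -> R) :
  \sum_i (f i +i* g i) = (\sum_i f i) +i* (\sum_i g i).
Proof. by rewrite !sum3. Qed.

(** * Real and imaginary parts of a radiation solution *)

Section RadiationSolution.
Variables (R : realType) (kappa : R) (U : set 'rV[R]_3) (psi : 'rV[R]_3 -> R[i]).
Hypothesis hpsi : radiation_solution kappa U psi.

Let pr x : R := complex.Re (psi x).
Let pi x : R := complex.Im (psi x).

Lemma radiation_solution_class_C : class_C 2 U pr /\ class_C 2 U pi.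
Proof. by case: hpsi => h _ _; exact: h. Qed.

Lemma radiation_solution_helmholtz x : U x ->
  \sum_i 'D_('e_ i) ('D_('e_ i) pr) x = - kappa ^+ 2 * pr x /\
  \sum_i 'D_('e_ i) ('D_('e_ i) pi) x = - kappa ^+ 2 * pi x.
Proof.
move=> Ux; have [_ /(_ x Ux) + _] := hpsi.
have -> : laplacian psi x = (\sum_i 'D_('e_ i) ('D_('e_ i) pr) x) +i* (\sum_i 'D_('e_ i) ('D_('e_ i) pi) x).
  by rewrite -sum_complex; apply: eq_bigr.
rewrite /pr /pi; case: (psi x) => p q /eqP; rewrite eq_complex /= mul0r subr0 mul0r addr0 => /andP[/eqP h1 /eqP h2].
by split; rewrite mulNr; [rewrite -h1|rewrite -h2]; rewrite opprK.
Qed.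

(** The real part is at most the modulus, and for a C^1 function the directional derivative along
    [n] is the combination of partial derivatives in [grd]. *)
Lemma radiation_solution_radiates (rho : R) : open U -> (forall x, rho < enorm x -> U x) ->
  radiates pr pi kappa 0.
Proof.
move=> oU hU eps eps0; have [_ _ /(_ eps eps0)[r1 hr1]] := hpsi.
have [cr _] := radiation_solution_class_C.
have cr1 : class_C 1 U pr.
  case: cr => h1 h2; split=> // i; have [h3 h4] := h2 i; split=> //.
  by have [h5 _] := h4; split.
exists (Num.max (Num.max rho r1) 0) => r n; rewrite !gt_max => /andP[/andP[h1 h2] r0] n1.
rewrite add0r; set x := r *: n.
have xr : enorm x = r by rewrite enormZ /enorm n1 sqrtr1 mulr1 gtr0_norm.
have Ux : U x by apply: hU; rewrite xr.
have xn : (enorm x)^-1 *: x = n by rewrite xr scalerA mulVf ?scale1r// lt0r_neq0.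
have := hr1 x Ux; rewrite xn xr => /(_ h2) h; rewrite -lecR; apply: ltW; apply: le_lt_trans h.
apply: le_trans (normc_ge_Re _); rewrite lecR.
have [_ dn] := derive_partial n oU cr1 Ux.
rewrite /cderive -/pr -/pi dn /pi /pr; case: (psi x) => p q /=.
by rewrite !mul0r sub0r opprK subr0; exact: lexx.
Qed.

End RadiationSolution.

(** Boundedness of the complement is in the sup norm; the factor 2 covers the ratio sqrt 3 between
    the two norms. *)
Lemma exterior_region_far (R : realType) (S U : set 'rV[R]_3) : exterior_region S U ->
  exists2 rho : R, 0 < rho & forall x, rho < enorm x -> U x.
Proof.
move=> [_ _ [M [_ hM]] _]; exists (2 * (`|M| + 1)).
  by rewrite mulr_gt0// ltr_wpDl.
move=> x hx; apply: contrapT => Ux.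
have h : `|x| <= `|M| + 1.
  by apply: hM => //; rewrite (le_lt_trans (ler_norm _))// ltrDl.
have := enorm_le_norm x; lra.
Qed.

Theorem theorem2p1 (R : realType) (kappa : R) (k : 'rV[R]_3)
  (S U : set 'rV[R]_3) (x0 theta : 'rV[R]_3) (Lambda : set 'rV[R]_3)
  (psi1 psi1' : 'rV[R]_3 -> R[i])
  (hkappa : 0 < kappa)
  (hk : enorm k = kappa)
  (hScompact : compact S)
  (hSregular : regular_surface S)
  (hU : exterior_region S U)
  (htheta : enorm theta = 1)
  (hthetak : theta <> (enorm k)^-1 *: k)
  (hL : ray x0 theta `<=` U)
  (hLambda : open_interval_of_ray x0 theta Lambda)
  (hLambda0 : Lambda !=set0)
  (hpsi1 : radiation_solution kappa U psi1)
  (hpsi1' : radiation_solution kappa U psi1')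
  (hint : forall x, Lambda x ->
     `|plane_wave k x + psi1 x| ^+ 2 = `|plane_wave k x + psi1' x| ^+ 2) :
  forall x, ray x0 theta x -> psi1 x = psi1' x.
Proof.
have [rho rho0 hfar] := exterior_region_far hU.
have [oU _ _ _] := hU.
have e1 := enorm_eq1 htheta.
have kk : dotv k k = kappa ^+ 2 by rewrite -enorm_sqr hk.
(* Strict Cauchy-Schwarz: the squared distance of theta to k / kappa is 2 - 2 (k . theta) / kappa,
   and it is positive as the two unit vectors differ. *)
have ke : dotv k theta < kappa.
  have : 0 < dotv (theta - kappa^-1 *: k) (theta - kappa^-1 *: k).
    by apply: dotv_gt0; rewrite subr_eq0; apply/eqP; rewrite -hk.
  have -> : dotv (theta - kappa^-1 *: k) (theta - kappa^-1 *: k) =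
     dotv theta theta - 2 * (dotv k theta / kappa) + dotv k k / kappa ^+ 2.
    by rewrite !dotv3 !mxE; field; rewrite lt0r_neq0.
  rewrite e1 kk mulfV ?expf_neq0 ?lt0r_neq0// => h.
  have : dotv k theta / kappa < 1 by lra.
  by rewrite ltr_pdivrMr// mul1r.
have rayU s : 0 < s -> U (x0 + s *: theta) by move=> s0; apply: hL; exists s.
have [I [oI _ I0 LI]] := hLambda.
have [p [q [p0 pq hpq]]] : exists p q : R, [/\ 0 < p, p < q & forall s, p < s < q -> I s].
  case: hLambda0 => x; rewrite LI => -[s Is _].
  have /nbhs_ballP[d /= d0 hd] := open_nbhs_nbhs (conj oI Is).
  exists s, (s + d); split; [exact: I0|by rewrite ltrDl|].
  by move=> y /andP[sy yd]; apply: hd; rewrite /ball/= ltr_norml; lra.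
have [cur cui] := radiation_solution_class_C hpsi1.
have [cvr cvi] := radiation_solution_class_C hpsi1'.
have hu := radiation_solution_helmholtz hpsi1.
have hv := radiation_solution_helmholtz hpsi1'.
have ru := radiation_solution_radiates hpsi1 oU hfar.
have rv := radiation_solution_radiates hpsi1' oU hfar.
move=> _ [s s0 <-].
have [] := ray_uniqueness oU hkappa rho0 hfar cur cui cvr cvi (fun x Ux => (hu x Ux).1)
  (fun x Ux => (hu x Ux).2) (fun x Ux => (hv x Ux).1) (fun x Ux => (hv x Ux).2)
  ru rv kk e1 ke rayU p0 pq _ s0; last first.
  by move=> hr hi; apply/eqP; rewrite eq_complex hr hi !eqxx.
move=> t tI; have : Lambda (x0 + t *: theta) by rewrite LI; exists t => //; exact: hpq.
move=> /hint; rewrite -!add_Re2_Im2 => /complexI.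
rewrite /plane_wave /wave !mul1r !mul0r !addr0 !add0r.
by case: (psi1 _) => a b; case: (psi1' _).
Qed.
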